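(* Let $p_i(x,y)=r_i(x)+s_i(x)y$, $i=1,2$, be two finite linear-like submersions. Then $p_1$ is topologically equivalent to $p_2$ if and only if either $Z_{p_1}=Z_{p_2}=\emptyset$, or both of the following conditions hold: (a) $\mathscr{F}(p_1)$ and $\mathscr{F}(p_2)$ are topologically equivalent. (b) There exist an equivalence homeomorphism $h$ between $\mathscr{F}(p_1)$ and $\mathscr{F}(p_2)$ and a monotone bijection $\sigma:r_1(Z_{p_1})\to r_2(Z_{p_2})$ such that $\sigma(p_1(\nu_a))=p_2(h(\nu_a))$ for every $a\in Z_{p_1}$.
   Context: A linear-like function is a function $p:\mathbb{R}^2\to\mathbb{R}$ of the form $p(x,y)=r(x)+s(x)y$, where $r,s:\mathbb{R}\to\mathbb{R}$ are $C^\infty$; put $Z_p=\{x\in\mathbb{R}: s(x)=0\}$. It is a submersion if its gradient vanishes nowhere. A finite linear-like submersion is a linear-like submersion for which $Z_p$ is finite (possibly empty). For $a\in\mathbb{R}$, $\nu_a=\{a\}\times\mathbb{R}$; when $a\in Z_p$ this line is a connected component of the level set $p^{-1}(r(a))$. For a $C^\infty$ submersion $f:\mathbb{R}^2\to\mathbb{R}$, $\mathscr{F}(f)$ denotes the regular foliation of $\mathbb{R}^2$ whose leaves are the connected components of the level sets of $f$. For a leaf $\gamma$ of $\mathscr{F}(f)$, $f(\gamma)$ denotes the constant value of $f$ on $\gamma$. Two functions $f,g:\mathbb{R}^2\to\mathbb{R}$ are topologically equivalent if there exist homeomorphisms $h:\mathbb{R}^2\to\mathbb{R}^2$ and $\ell:\mathbb{R}\to\mathbb{R}$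 such that $\ell\circ f=g\circ h$. Two regular foliations $\mathscr{F},\mathscr{G}$ of $\mathbb{R}^2$ are topologically equivalent if there is a homeomorphism $h:\mathbb{R}^2\to\mathbb{R}^2$ carrying each leaf of $\mathscr{F}$ onto a leaf of $\mathscr{G}$; such $h$ is called an equivalence homeomorphism between $\mathscr{F}$ and $\mathscr{G}$. Monotone means (strictly) increasing or (strictly) decreasing. *)

(* Defs.v *)
(* Mathematical Components and MathComp-Analysis; the plane is R * R with its
   product topology, for an arbitrary R : realType. *)
From mathcomp Require Import all_boot all_order all_algebra.
From mathcomp Require Import all_classical all_reals all_analysis.

Set Implicit Arguments.
Unset Strict Implicit.
Unset Printing Implicit Defensive.

Import Order.TTheory GRing.Theory Num.Theory.
Import numFieldNormedType.Exports.

Local Open Scope classical_set_scope.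
Local Open Scope ring_scope.

Definition homeomorphism (T U : topologicalType) (h : T -> U) : Prop :=
  exists g : U -> T, [/\ cancel h g, cancel g h, continuous h & continuous g].

Definition smooth (R : realType) (f : R -> R) : Prop :=
  forall (n : nat) (x : R), derivable (derive1n n f) x 1.

Definition linear_like (R : realType) (r s : R -> R) : R * R -> R :=
  fun z => r z.1 + s z.1 * z.2.

(* Z_p for p = linear_like r s; p determines s. *)
Definition zero_set (R : realType) (s : R -> R) : set R := [set x | s x = 0].

Definition gradient (R : realType) (f : R * R -> R) (z : R * R) : R * R :=
  ('D_(1, 0) f z, 'D_(0, 1) f z).

Definition submersion (R : realType) (f : R * R -> R) : Prop :=
  forall z, gradient f z <> (0, 0).

Definition finite_linear_like_submersion (R : realType) (r s : R -> R) : Prop :=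
  [/\ smooth r, smooth s, submersion (linear_like r s)
    & finite_set (zero_set s)].

Definition vertical_line (R : realType) (a : R) : set (R * R) :=
  [set z | z.1 = a].

(* A foliation is represented by its set of leaves. *)
Definition foliation (R : realType) (f : R * R -> R) : set (set (R * R)) :=
  [set L | exists z, L = connected_component (f @^-1` [set f z]) z].

(* The value of f on L, meaningful when f is constant on the nonempty set L. *)
Definition leaf_value (R : realType) (f : R * R -> R) (L : set (R * R)) : R :=
  get (f @` L).

Lemma leaf_valueE (R : realType) (f : R * R -> R) (L : set (R * R))
    (z : R * R) : (forall w, L w -> f w = f z) -> L z -> leaf_value f L = f z.
Proof.
move=> fL Lz; rewrite /leaf_value.
by case: xgetP => [_ -> [w Lw <-]|/(_ (f z))[]]; [exact: fL|exists z].
Qed.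

Definition equiv_functions (R : realType) (f g : R * R -> R) : Prop :=
  exists (h : R * R -> R * R) (l : R -> R),
    [/\ homeomorphism h, homeomorphism l & l \o f = g \o h].

Definition equiv_homeomorphism (R : realType) (F G : set (set (R * R)))
    (h : R * R -> R * R) : Prop :=
  homeomorphism h /\ forall L, F L -> G (h @` L).

Definition equiv_foliations (R : realType) (F G : set (set (R * R))) : Prop :=
  exists h, equiv_homeomorphism F G h.

Definition monotone_on (R : realType) (A : set R) (f : R -> R) : Prop :=
  {in A &, {homo f : x y / x < y}} \/ {in A &, {homo f : x y /~ x < y}}.

(* Main.v *)
(* A zero a of s makes the line x = a a leaf of p = r + s y, inseparable from
   the graph leaves of the same value over the two borders strips; all other
   leaves are graphs over the components of the complement of the zero set, and
   two graph leaves over different components are separated.  Hence the values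
   r(Z) are exactly the values taken on pairs of inseparable leaves, which gives
   the direct implication.

   Conversely, an equivalence homeomorphism h respects inseparability, which
   forces it to map vertical leaves to vertical leaves.  Up to reflecting the
   second plane in x, in y and in its values, h preserves the left-to-right
   order of the vertical leaves, increases the values along every strip and
   preserves the orientation of the vertical leaves; each of these three signs
   is constant because it is locally constant along the x-axis, including at
   the zeros.  So the two functions have the same order of zeros, the same signs
   of r' at the zeros and the same signs of s on the strips, and sigma matches
   the order of the values.

   Two functions with the same such data are equivalent: reparametrize x so that
   r becomes affine near the zeros, slide points along the leaves so that the
   two functions s agree near the zeros, and finish with a shear in y. *)
Require Import Defs.
From mathcomp Require Import all_boot all_order all_algebra.
From mathcomp Require Import all_classical all_reals all_analysis.
From mathcomp Require Import ring lra.
Import Order.TTheory GRing.Theory Num.Theory.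
Import numFieldNormedType.Exports.
Local Open Scope classical_set_scope.
Local Open Scope ring_scope.
Set Implicit Arguments.
Unset Strict Implicit.

(** * Continuity on the line and on the plane *)

Section Tools.
Variable R : realType.
Implicit Types (x y a b c d e : R) (z w : R * R).

(** A shear alone cannot give the converse: [s1] and [s2] may have the same zeros and signs and yet
    vanish at different rates, so matching leaves at equal abscissas could send heights near a
    vertical leaf to 0 or to infinity. This forces the slide along the leaves and, before it, the
    straightening of [r], which makes explicit where a nearby leaf crosses height 0. These
    operations do not respect smoothness. Smoothness therefore enters only once, to show that at a
    zero [s] is flat and [r] is steep; both estimates are stated without derivatives. Together they
    make the function strictly monotone in [x] near any bounded piece of a vertical leaf, which
    controls the foliation there. The bijection [sigma] carries information absent from [h]: an
    equivalence homeomorphism compares values only within one strip, whereas the change of values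
    must order the values of distant zeros simultaneously. *)

Lemma nbhs_lineP x (U : set R) :
  nbhs x U <-> exists2 d, 0 < d & forall y, `|y - x| < d -> U y.
Proof.
rewrite nbhs_ballP; split=> -[d d0 dU]; exists d => // y yd; apply: dU;
  by rewrite /ball/= distrC.
Qed.

Lemma nbhs_planeP z (U : set (R * R)) :
  nbhs z U <->
  exists2 d, 0 < d & forall w, `|w.1 - z.1| < d -> `|w.2 - z.2| < d -> U w.
Proof.
rewrite nbhs_ballP; split=> -[d d0 dU]; exists d => //.
  by move=> w w1 w2; apply: dU; split; rewrite /ball/= distrC.
by move=> w [w1 w2]; apply: dU; rewrite distrC.
Qed.

Lemma finite_isolated (Z : set R) x : finite_set Z ->
  exists2 d, 0 < d & forall a, Z a -> `|a - x| < d -> a = x.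
Proof.
move=> Zf.
have : nbhs x (~` (Z `\ x)).
  apply: open_nbhs_nbhs; split; last by move=> [_] /=.
  rewrite openC; apply: accessible_finite_set_closed.1; last exact: finite_setD.
  exact: hausdorff_accessible (@Rhausdorff R).
move=> /nbhs_lineP[d d0 dU]; exists d => // a Za ax.
by apply: contrapT => nax; apply: (dU a ax); split.
Qed.

(** Connectedness of the line, in the form that carries a property across strips and zeros alike. *)
Lemma locally_constant (P : R -> Prop) :
  (forall x, exists2 d, 0 < d & forall y, `|y - x| < d -> P y <-> P x) ->
  forall x y, P x -> P y.
Proof.
move=> Ploc x y Px.
have Pop : open (P : set R).
  rewrite openE => u Pu; have [d d0 dP] := Ploc u.
  by apply/nbhs_lineP; exists d => // v /dP[_ +]; apply.
have Pcl : closed (P : set R).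
  rewrite -openC openE => u Pu; have [d d0 dP] := Ploc u.
  by apply/nbhs_lineP; exists d => // v /dP[Pvu _] Pv; apply: Pu; exact: Pvu.
have cT : connected [set: R].
  by apply/connected_intervalP.
suff -> : P = [set: R] by [].
by apply: cT; [exists x| exists P; rewrite ?setTI| exists P; rewrite ?setTI].
Qed.

Lemma cvg_pt (f : R * R -> R) z l : 
  f w @[w --> z] --> l <->
  forall e, 0 < e -> exists2 d, 0 < d &
    forall w, `|w.1 - z.1| < d -> `|w.2 - z.2| < d -> `|f w - l| < e.
Proof.
split=> [fl e e0|fl].
  have /cvgrPdist_lt/(_ e e0)/nbhs_planeP[d d0 dP] := fl.
  by exists d => // w w1 w2; rewrite distrC; apply: dP.
apply/cvgrPdist_lt => e /fl[d d0 dP]; apply/nbhs_planeP; exists d => // w w1 w2 /=.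
by rewrite distrC; apply: dP.
Qed.

Lemma continuous_lineP (f : R -> R) : continuous f <->
  forall x e, 0 < e -> exists2 d, 0 < d &
    forall y, `|y - x| < d -> `|f y - f x| < e.
Proof.
split=> [fc x e e0|fc x].
  have /cvgrPdist_lt/(_ e e0)/nbhs_lineP[d d0 dP] := fc x.
  by exists d => // y yx; rewrite distrC; apply: dP.
apply/cvgrPdist_lt => e /(fc x)[d d0 dP]; apply/nbhs_lineP; exists d => // w wx.
by rewrite distrC; apply: dP.
Qed.

Lemma continuous_planeP (h : R * R -> R * R) : 
  (forall z, (h w).1 @[w --> z] --> (h z).1) ->
  (forall z, (h w).2 @[w --> z] --> (h z).2) -> continuous h.
Proof.
move=> h1 h2 z U /nbhs_planeP[e e0 eU].
have /cvg_pt/(_ _ e0)[d1 d10 h1d] := h1 z.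
have /cvg_pt/(_ _ e0)[d2 d20 h2d] := h2 z.
apply/nbhs_planeP; exists (Num.min d1 d2); first by rewrite lt_min d10.
move=> w; rewrite !lt_min => /andP[w11 w12] /andP[w21 w22].
by apply: eU; [exact: h1d|exact: h2d].
Qed.

Lemma continuous_fst (h : R * R -> R * R) z : {for z, continuous h} ->
  (h w).1 @[w --> z] --> (h z).1.
Proof. by move=> hz; apply: cvg_comp hz _; exact: cvg_fst. Qed.

Lemma continuous_snd (h : R * R -> R * R) z : {for z, continuous h} ->
  (h w).2 @[w --> z] --> (h z).2.
Proof. by move=> hz; apply: cvg_comp hz _; exact: cvg_snd. Qed.

Lemma linear_like_continuous (r s : R -> R) : continuous r -> continuous s ->
  continuous (linear_like r s).
Proof.
move=> rc sc z; rewrite /linear_like.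
have f1 : w.1 @[w --> z] --> z.1 by exact: cvg_fst.
have f2 : w.2 @[w --> z] --> z.2 by exact: cvg_snd.
have fr : r w.1 @[w --> z] --> r z.1 by apply: (cvg_comp _ _ f1); exact: rc.
have fs : s w.1 @[w --> z] --> s z.1 by apply: (cvg_comp _ _ f1); exact: sc.
exact: cvgD fr (cvgM fs f2).
Qed.

End Tools.

(** * Leaves of linear-like functions *)

Section Leaves.
Variable R : realType.
Implicit Types (x y a b c d e : R) (z w : R * R) (r s sg : R -> R).

(** Strict differentiability at [a] with derivative 0, phrased so that it survives changes of [x]
    and of [s] that are not smooth. *)
Definition flat_at s a := forall e, 0 < e -> exists2 d, 0 < d &
  forall x y, `|x - a| < d -> `|y - a| < d -> `|s x - s y| <= e * `|x - y|.

(** A lower Lipschitz bound: when [r] is used as a new abscissa near [a], the inverse change of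
    variable is Lipschitz. *)
Definition steep_at (sga : R) r a := exists C d, [/\ 0 < C, 0 < d &
  forall x y, `|x - a| < d -> `|y - a| < d -> y <= x ->
    x - y <= C * (sga * (r x - r y))].

(* All that is used of a smooth finite linear-like submersion; [sg a] is the sign
   of [r'] at a zero [a] of [s], where [s] has derivative 0. *)
Definition tame r s sg := [/\ continuous r, continuous s,
  finite_set (zero_set s), forall a, s a = 0 -> flat_at s a &
  forall a, s a = 0 -> (sg a = 1 \/ sg a = -1) /\ steep_at (sg a) r a].

(** For [|y| <= B] flatness lets [s x * y] vary by at most half of what steepness guarantees for
    [r]; hence the factor 2 in the constant, and the dependence of [d] on [B]. Using [|B| + 1] keeps
    that constant positive for every [B]. *)
Lemma tame_monotone r s sg a B : tame r s sg -> s a = 0 ->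
  exists2 d, 0 < d & forall x x' y, `|x - a| < d -> `|x' - a| < d ->
    `|y| <= B -> x' < x ->
    0 < sg a * (linear_like r s (x, y) - linear_like r s (x', y)).
Proof.
move=> [rc sc Zf sf st] sa0; have [sg1 [C [d1 [C0 d10 rP]]]] := st a sa0.
have B0 : 0 < C * (`|B| + 1) *+ 2.
  by rewrite mulrn_wgt0 // mulr_gt0 // ltr_wpDl.
have [d2 d20 sP] := sf a sa0 (C * (`|B| + 1) *+ 2)^-1 ltac:(by rewrite invr_gt0).
exists (Num.min d1 d2); first by rewrite lt_min d10.
move=> x x' y; rewrite !lt_min => /andP[x1 x2] /andP[x'1 x'2] yB x'x.
rewrite /linear_like /=.
have r1 := rP _ _ x1 x'1 (ltW x'x).
have := sP _ _ x2 x'2; rewrite (gtr0_norm (_ : 0 < x - x')) ?subr_gt0//.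
rewrite -(ler_pM2l B0) mulrA divff ?gt_eqF// mul1r => s1.
have yB' : `|y| <= `|B| + 1 by rewrite (le_trans yB)// ler_wpDr// ler_norm.
have s2 : (C * `|(s x - s x') * y|) *+ 2 <= x - x'.
  apply: le_trans s1; rewrite normrM !mulr2n.
  have : C * (`|s x - s x'| * `|y|) <= C * (`|s x - s x'| * (`|B| + 1)).
    by rewrite ler_pM2l// ler_wpM2l.
  lra.
have -> : r x + s x * y - (r x' + s x' * y) = r x - r x' + (s x - s x') * y by ring.
have sgn : - `|(s x - s x') * y| <= sg a * ((s x - s x') * y).
  by case: sg1 => ->; rewrite ?mul1r ?mulN1r ?lerN2 ?ler_norm// lerNl -normrN ler_norm.
rewrite mulrDr; set A := sg a * (r x - r x') in r1 *.
set D := `|_| in s2 sgn; set E := sg a * _ in sgn *.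
have CE : C * (- D) <= C * E by rewrite ler_pM2l.
suff : 0 < C * (A + E) by rewrite pmulr_rgt0.
rewrite mulr2n in s2; rewrite mulrDr; lra.
Qed.

(** Strict for both points, so [same_side b b y] fails; [same_strip] thereby excludes the zeros of
    [s] by itself. *)
Definition same_side b x y := (x < b) && (y < b) || (b < x) && (b < y).

(* [x] and [y] lie in the same component of the complement of the zero set. *)
Definition same_strip s x y := forall b, s b = 0 -> same_side b x y.

(* For a zero [a]: it is an end point of the component containing [x]. *)
Definition borders s a x :=
  s x <> 0 /\ forall b, s b = 0 -> b <> a -> same_side b a x.

Definition leaf (p : R * R -> R) z := connected_component (p @^-1` [set p z]) z.

Lemma same_side_refl b x : x <> b -> same_side b x x.
Proof. by rewrite /same_side => /eqP; rewrite neq_lt => /orP[] ->; rewrite ?orbT. Qed.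

Lemma same_side_sym b x y : same_side b x y -> same_side b y x.
Proof. by rewrite /same_side => /orP[]/andP[-> ->]; rewrite ?orbT. Qed.

Lemma same_side_trans b y x c : same_side b x y -> same_side b y c -> same_side b x c.
Proof.
by rewrite /same_side => /orP[]/andP[h1 h2] /orP[]/andP[h3 h4];
  rewrite ?h1 ?h4 ?orbT//; have := lt_trans h2 h3; rewrite ltxx.
Qed.

Lemma same_strip_sym s x y : same_strip s x y -> same_strip s y x.
Proof. by move=> + b sb => /(_ b sb)/same_side_sym. Qed.

Lemma same_strip_trans s y x c : same_strip s x y -> same_strip s y c -> same_strip s x c.
Proof. by move=> xy yz b sb; apply: same_side_trans (xy b sb) (yz b sb). Qed.

Lemma same_strip_refl s x : s x <> 0 -> same_strip s x x.
Proof. by move=> sx b sb; apply: same_side_refl => xb; apply: sx; rewrite xb. Qed.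

Lemma same_strip_neq0 s x y : same_strip s x y -> s x <> 0.
Proof. by move=> xy /[dup] sx0 /xy; rewrite /same_side ltxx. Qed.

Lemma connected_fst (C : set (R * R)) z w b : connected C -> C z -> C w ->
  ~~ same_side b z.1 w.1 -> exists2 u, C u & u.1 = b.
Proof.
move=> Cc Cz Cw nb.
have /connected_intervalP Ic : connected ((fun u : R * R => u.1) @` C).
  apply: connected_continuous_connected => //; apply: continuous_subspaceT.
  by move=> u; exact: cvg_fst.
suff [u Cu ub] : ((fun u : R * R => u.1) @` C) b by exists u.
have [zw|wz] := leP z.1 w.1.
  apply: (Ic z.1 w.1); [by exists z|by exists w|].
  move: nb; rewrite /same_side negb_or !negb_and -!leNgt => /andP[/orP[]h1 /orP[]h2];
  apply/andP; split; lra.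
apply: (Ic w.1 z.1); [by exists w|by exists z|].
move: nb; rewrite /same_side negb_or !negb_and -!leNgt => /andP[/orP[]h1 /orP[]h2];
apply/andP; split; lra.
Qed.

Lemma connected_graph r s c x y : continuous r -> continuous s -> same_strip s x y ->
  exists2 C : set (R * R), connected C &
   [/\ C (x, (c - r x) / s x), C (y, (c - r y) / s y) & forall w, C w -> linear_like r s w = c].
Proof.
move=> rc sc xy.
pose G t := (t, (c - r t) / s t).
pose a := Num.min x y; pose b := Num.max x y.
have sn t : t \in `[a, b] -> s t != 0.
  rewrite in_itv /= /a /b => /andP[ta tb]; apply/eqP => /xy.
  move: ta tb; rewrite /same_side ge_min le_max.
  by move=> /orP[]? /orP[]? /orP[]/andP[? ?]; lra.
exists (G @` [set` `[a, b]]).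
  apply: connected_continuous_connected; first exact: segment_connected.
  apply: continuous_in_subspaceT => t; rewrite inE => /sn st.
  have yt : (c - r u) / s u @[u --> t] --> (c - r t) / s t.
    by apply: cvgM; [apply: cvgB; [exact: cvg_cst|exact: rc]|apply: cvgV => //; exact: sc].
  have xt : u @[u --> t] --> t by exact: cvg_id.
  exact: (cvg_pair xt yt).
split.
- by exists x => //=; rewrite in_itv /= ge_min le_max !lexx.
- by exists y => //=; rewrite in_itv /= ge_min le_max !lexx !orbT.
move=> _ [t /sn st <-]; rewrite /linear_like /= mulrCA divff// mulr1; ring.
Qed.

Lemma linear_like_solve r s x y c : s x <> 0 ->
  linear_like r s (x, y) = c -> y = (c - r x) / s x.
Proof.
by move=> /eqP sx; rewrite /linear_like /= => <-; rewrite addrAC subrr add0r mulrC mulKf.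
Qed.

Lemma linear_like_solveK r s x c : s x <> 0 ->
  linear_like r s (x, (c - r x) / s x) = c.
Proof. by move=> /eqP sx; rewrite /linear_like /= mulrCA divff// mulr1; ring. Qed.

Lemma linear_like0 r s z : s z.1 = 0 -> linear_like r s z = r z.1.
Proof. by rewrite /linear_like => ->; rewrite mul0r addr0. Qed.

(** The line is closed, and also relatively open in its level set: at a fixed height [tame_monotone]
    lets the value [r a] occur near the line only on it. A connected part of the level set that
    meets the line therefore stays in it. *)
Lemma connected_in_line r s sg (C : set (R * R)) z : tame r s sg -> connected C ->
  (forall w, C w -> linear_like r s w = r z.1) -> s z.1 = 0 -> C z ->
  forall w, C w -> w.1 = z.1.
Proof.
move=> t Cc Cr sz Cz w Cw.
set a := z.1 in Cr sz *.
pose O := interior [set w : R * R | linear_like r s w = r a -> w.1 = a].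
have line : C `&` [set u | u.1 = a] = C.
  apply: Cc; first by exists z.
    exists O; first exact: open_interior.
    apply/seteqP; split=> u [Cu]; last first.
      by move=> /interior_subset /= uO; split=> //; apply: uO; exact: Cr.
    move=> ua; split=> //; apply/nbhs_planeP.
    have [d d0 dP] := tame_monotone (`|u.2| + 1) t sz.
    exists (Num.min d 1); first by rewrite lt_min d0 ltr01.
    move=> [v1 v2] /=; rewrite !lt_min => /andP[v1d _] /andP[_ v2d] pv.
    have v2B : `|v2| <= `|u.2| + 1.
      have -> : v2 = u.2 + (v2 - u.2) by ring.
      by rewrite (le_trans (ler_normD _ _))// lerD2l ltW.
    have pa : linear_like r s (a, v2) = r a by rewrite linear_like0.
    apply/eqP; case: (ltgtP v1 a) => // va; exfalso.
      have := dP a v1 v2; rewrite subrr normr0 -ua => /(_ d0 v1d v2B).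
      by rewrite {1}ua => /(_ va); rewrite ua pv pa subrr mulr0 ltxx.
    have := dP v1 a v2; rewrite subrr normr0 -{1}ua => /(_ v1d d0 v2B va).
    by rewrite pv pa subrr mulr0 ltxx.
  exists [set u | u.1 = a] => //; apply: (@closed_comp _ _ (fun u : R * R => u.1) [set a]).
    by move=> u _; exact: cvg_fst.
  exact: accessible_closed_set1 (hausdorff_accessible (@Rhausdorff R)) a.
by have [] : (C `&` [set u | u.1 = a]) w by rewrite line.
Qed.

Lemma leaf_level p z w : leaf p z w -> p w = p z.
Proof. exact: connected_component_sub. Qed.

(** A leaf leaving its strip would cross a vertical line on its own level, and [connected_in_line]
    would confine it to that line. Conversely the graph of [(c - r) / s] connects the points. *)
Lemma leaf_strip r s sg z w : tame r s sg -> s z.1 <> 0 ->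
  leaf (linear_like r s) z w <->
  same_strip s z.1 w.1 /\ linear_like r s w = linear_like r s z.
Proof.
move=> t sz; split=> [zw|[zw pwz]].
  have lvl := @leaf_level _ z w zw; split=> // b sb; apply: contrapT => /negP nb.
  have Cc : connected (leaf (linear_like r s) z) by exact: component_connected.
  have Cz : leaf (linear_like r s) z z by exact: connected_component_refl.
  have [u Cu ub] := connected_fst Cc Cz zw nb.
  have pu := leaf_level Cu; rewrite linear_like0 ub// in pu.
  have : z.1 = u.1.
    apply: (connected_in_line t Cc _ _ Cu Cz); last by rewrite ub.
    by move=> v /leaf_level ->; rewrite -pu ub.
  by move=> zu; apply: sz; rewrite zu ub.
have [rc sc _ _ _] := t.
have [C Cc [Cz Cw Cp]] := connected_graph (linear_like r s z) rc sc zw.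
apply: (connected_component_max _ _ Cc (B := C)).
- rewrite -(linear_like_solve sz (erefl : _ = linear_like r s z)) in Cz.
  by rewrite -surjective_pairing in Cz.
- exact: Cp.
- have sw := same_strip_neq0 (same_strip_sym zw).
  rewrite -(linear_like_solve sw (_ : linear_like r s (w.1, w.2) = _)) in Cw.
    by rewrite -surjective_pairing in Cw.
  by rewrite -surjective_pairing.
Qed.

Lemma vertical_connected a : connected (@vertical_line R a).
Proof.
have -> : @vertical_line R a = (fun y => (a, y)) @` setT.
  apply/seteqP; split=> [[u v]|_ [y _ <-]//].
  by rewrite /vertical_line /= => ->; exists v.
apply: connected_continuous_connected; first by apply/connected_intervalP.
apply: continuous_subspaceT => y.
have xt : a @[_ --> y] --> a by exact: cvg_cst.
have yt : u @[u --> y] --> y by exact: cvg_id.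
exact: (cvg_pair xt yt).
Qed.

Lemma leaf_vertical r s sg z w : tame r s sg -> s z.1 = 0 ->
  leaf (linear_like r s) z w <-> w.1 = z.1.
Proof.
move=> t sz; split=> [zw|wz].
  have Cz : leaf (linear_like r s) z z by exact: connected_component_refl.
  apply: (connected_in_line t (@component_connected _ _ _) _ sz Cz) zw.
  by move=> u /leaf_level ->; rewrite linear_like0.
apply: (connected_component_max _ _ (@vertical_connected z.1) (B := vertical_line z.1)) => //.
move=> u; rewrite /vertical_line /= => uz.
by rewrite !linear_like0// uz.
Qed.

Lemma leaf_refl p z : leaf p z z.
Proof. exact: connected_component_refl. Qed.

End Leaves.

(** * Inseparable leaves *)

Section Inseparable.
Variable R : realType.
Implicit Types (x y a b c d e : R) (z w : R * R) (r s sg : R -> R) (p q : R * R -> R).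

(** Mentions only leaves and neighbourhoods, hence is transported by leaf equivalences. Two points
    of one leaf satisfy it too, so distinct leaves have to be demanded separately. *)
Definition insep p z w := forall U V, nbhs z U -> nbhs w V ->
  exists u v, [/\ U u, V v & leaf p u v].

Lemma insep_value p z w : continuous p -> insep p z w -> p z = p w.
Proof.
move=> pc zw; apply/eqP/negPn/negP => pzw.
have e0 : 0 < `|p z - p w| / 2 by rewrite divr_gt0// normr_gt0 subr_eq0.
have /cvgrPdist_lt/(_ _ e0) Uz := pc z.
have /cvgrPdist_lt/(_ _ e0) Vw := pc w.
have [u [v [/= zu wv /leaf_level puv]]] := zw _ _ Uz Vw.
have : `|p z - p w| <= `|p z - p u| + `|p w - p v|.
  rewrite puv [`|p w - _|]distrC.
  have -> : p z - p w = p z - p u + (p u - p w) by ring.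
  exact: ler_normD.
lra.
Qed.

Lemma same_side_near b x y : `|y - x| < `|x - b| -> same_side b x y.
Proof.
rewrite /same_side; case: (ltgtP x b) => [xb|bx|->]; last first.
- by rewrite subrr normr0 ltNge normr_ge0.
- by rewrite [`|x - b|]gtr0_norm ?subr_gt0// ltr_norml => /andP[+ _]/=; lra.
by rewrite [`|x - b|]ltr0_norm ?subr_lt0// ltr_norml => /andP[_ +]/=; rewrite orbF; lra.
Qed.

Lemma adjacent_near r s sg a : tame r s sg -> s a = 0 ->
  exists2 d, 0 < d & forall y, `|y - a| < d ->
    (y <> a -> borders s a y) /\
    (forall x, borders s a x -> same_side a x y -> same_strip s x y).
Proof.
move=> [_ _ Zf _ _] sa; have [d d0 dP] := finite_isolated a Zf.
have far y b : s b = 0 -> b <> a -> `|y - a| < d -> same_side b a y.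
  move=> sb ba ya; apply: same_side_near; apply: lt_le_trans ya _.
  by rewrite distrC leNgt; apply/negP => /(dP _ sb).
exists d => // y ya; split.
  move=> nya; split; last by move=> b sb ba; exact: far.
  by move=> sy; apply: nya; exact: dP.
move=> x [sx ax] xy b sb; have [->//|ba] := eqVneq b a; move/eqP in ba.
apply: same_side_trans (far _ _ sb ba ya); apply: same_side_sym; exact: ax.
Qed.

Lemma adjacent_right r s sg a : tame r s sg -> s a = 0 ->
  exists2 x, a < x & borders s a x.
Proof.
move=> t sa; have [d d0 dP] := adjacent_near t sa; exists (a + d / 2); first lra.
by apply: (dP _ _).1; [rewrite addrAC subrr add0r gtr0_norm; lra|lra].
Qed.

Lemma adjacent_left r s sg a : tame r s sg -> s a = 0 ->
  exists2 x, x < a & borders s a x.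
Proof.
move=> t sa; have [d d0 dP] := adjacent_near t sa; exists (a - d / 2); first lra.
by apply: (dP _ _).1; [rewrite addrAC subrr add0r normrN gtr0_norm; lra|lra].
Qed.

Lemma adjacent_neq s a x : s a = 0 -> borders s a x -> x <> a.
Proof. by move=> sa [sx _] xa; apply: sx; rewrite xa. Qed.

(** The leaf through [(x, z.2)], with [x] close to [z.1] on the side of [w], has a value close to
    that of [z]; over [w.1] it passes at a height close to [w.2], the error in value being divided
    by [s w.1]. *)
Lemma insep_adjacent r s sg z w : tame r s sg -> s z.1 = 0 -> borders s z.1 w.1 ->
  linear_like r s w = linear_like r s z -> insep (linear_like r s) z w.
Proof.
move=> t sz zw pwz U V /nbhs_planeP[d1 d10 dU] /nbhs_planeP[e e0 eV].
have [rc sc _ _ _] := t.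
have [d2 d20 d2P] := adjacent_near t sz.
have [sw _] := zw; move/eqP: (sw) => sw0.
have e'0 : 0 < e * `|s w.1| by rewrite mulr_gt0// normr_gt0.
have /cvg_pt/(_ _ e'0)[d3 d30 d3P] := @linear_like_continuous R r s rc sc z.
set d := Num.min d1 (Num.min d2 d3).
have d0 : 0 < d by rewrite !lt_min d10 d20.
have [x xd ax] : exists2 x, `|x - z.1| < d & same_side z.1 w.1 x.
  case: (ltgtP w.1 z.1) => wz.
  - exists (z.1 - d / 2); first by rewrite addrAC subrr add0r normrN gtr0_norm; lra.
    by rewrite /same_side wz /=; apply/orP; left; lra.
  - exists (z.1 + d / 2); first by rewrite addrAC subrr add0r gtr0_norm; lra.
    by rewrite /same_side wz /=; apply/orP; right; lra.
  - by case: (adjacent_neq sz zw).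
move: xd; rewrite !lt_min => /and3P[x1 x2 x3].
have strip := (d2P _ x2).2 _ zw ax.
set c := linear_like r s (x, z.2).
exists (x, z.2), (w.1, (c - r w.1) / s w.1); split.
- by apply: dU => //=; rewrite subrr normr0.
- apply: eV => /=; rewrite ?subrr ?normr0//.
  rewrite (linear_like_solve sw (_ : linear_like r s (w.1, w.2) = linear_like r s z)); last first.
    by rewrite -surjective_pairing.
  rewrite -mulrBl normrM normfV ltr_pdivrMr ?normr_gt0//.
  have -> : c - r w.1 - (linear_like r s z - r w.1) = c - linear_like r s z by ring.
  by apply: d3P => //=; rewrite subrr normr0.
have sx : s x <> 0 by apply: same_strip_neq0 (same_strip_sym strip).
apply/(leaf_strip _ t) => //=; split; first exact: same_strip_sym.
exact: linear_like_solveK.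
Qed.

Lemma same_side_nbhs b z : b <> z.1 -> \forall u \near z, same_side b z.1 u.1.
Proof.
move=> /eqP bz; apply/nbhs_planeP; exists `|z.1 - b|.
  by rewrite normr_gt0 subr_eq0 eq_sym.
by move=> w wz _; exact: same_side_near.
Qed.

(** Any zero other than [w.1] has whole neighbourhoods of both points off its line, and leaves
    starting near [z] do not cross it; only [w.1] itself can separate the two points. *)
Lemma insep_strip r s sg z w : tame r s sg -> s z.1 <> 0 ->
  insep (linear_like r s) z w ->
  leaf (linear_like r s) z w \/ (s w.1 = 0 /\ borders s w.1 z.1).
Proof.
move=> t sz zw; have [rc sc _ _ _] := t.
have pzw := insep_value (linear_like_continuous rc sc) zw.
have side b : s b = 0 -> b <> w.1 -> same_side b z.1 w.1.
  move=> sb bw; have bz : b <> z.1 by move=> bz; apply: sz; rewrite -bz.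
  have sznb : \forall u \near z, s u.1 != 0.
    have : s u.1 @[u --> z] --> s z.1.
      by apply: (@cvg_comp _ _ _ (fun u : R * R => u.1) s); [exact: cvg_fst|exact: sc].
    move/cvgr_neq0; apply; exact/eqP.
  have U : \forall u \near z, s u.1 != 0 /\ same_side b z.1 u.1.
    by apply: filterI => //; exact: same_side_nbhs.
  have [u [v [[/eqP su zu] wv uv]]] := zw _ _ U (same_side_nbhs bw).
  have [/(_ b sb) suv _] := (leaf_strip v t su).1 uv.
  by apply: same_side_trans zu _; apply: same_side_trans suv (same_side_sym wv).
have [sw|/eqP sw] := eqVneq (s w.1) 0.
  right; split=> //; split=> // b sb bw; exact/same_side_sym/side.
left; apply/(leaf_strip _ t) => //; split=> // b sb; apply: side => // bw.
by apply: sw; rewrite -bw.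
Qed.

Lemma values_insep r s sg c : tame r s sg ->
  (r @` zero_set s) c <-> exists z w, [/\ insep (linear_like r s) z w,
    ~ leaf (linear_like r s) z w & linear_like r s z = c].
Proof.
move=> t; have [rc sc _ _ _] := t; split.
  move=> [a sa <-]; have [x ax adj] := adjacent_right t sa.
  have [sx _] := adj.
  exists (a, 0), (x, (r a - r x) / s x); split.
  - apply: (insep_adjacent t) => //=; rewrite linear_like_solveK//.
    by rewrite linear_like0.
  - by move=> /(leaf_vertical _ t)/= => /(_ sa) xa; rewrite xa ltxx in ax.
  - by rewrite linear_like0.
move=> [z [w [zw nl <-]]]; have [sz|/eqP sz] := eqVneq (s z.1) 0.
  by exists z.1 => //; rewrite linear_like0.
have [//|[sw _]] := insep_strip t sz zw.
exists w.1 => //; rewrite (insep_value (linear_like_continuous rc sc) zw).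
by rewrite linear_like0.
Qed.

Lemma leaf_image p q (h : R * R -> R * R) z w : continuous h ->
  (forall u v, p u = p v -> q (h u) = q (h v)) -> leaf p z w -> leaf q (h z) (h w).
Proof.
move=> hc hp zw.
apply: (connected_component_max (B := h @` leaf p z)).
- by exists z => //; exact: leaf_refl.
- by move=> _ [u /leaf_level/hp <- <-].
- apply: connected_continuous_connected; first exact: component_connected.
  exact: continuous_subspaceT.
- by exists w.
Qed.

(** Pointwise form of an equivalence homeomorphism of foliations; the equivalence makes it symmetric
    under inversion. *)
Definition leaf_equiv p q (h : R * R -> R * R) := homeomorphism h /\
  forall z w, leaf p z w <-> leaf q (h z) (h w).

Lemma homeomorphism_inv (T U : topologicalType) (h : T -> U) : homeomorphism h ->
  exists2 g, homeomorphism g & cancel h g /\ cancel g h.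
Proof. by move=> [g [hg gh hc gc]]; exists g => //; exists h. Qed.

Lemma leaf_equivP p q (h : R * R -> R * R) :
  equiv_homeomorphism (foliation p) (foliation q) h -> leaf_equiv p q h.
Proof.
move=> [hh hL]; split=> // z w.
have [g [hg gh hc gc]] := hh.
have E : h @` leaf p z = leaf q (h z).
  have [u zu] := hL (leaf p z) (ex_intro _ z erefl).
  have : leaf q u (h z) by rewrite /leaf -zu; exists z => //; exact: leaf_refl.
  by move=> uhz; rewrite zu -/(leaf q u) /leaf (leaf_level uhz); exact: same_connected_component.
rewrite -E; split=> [zw|[v zv /(can_inj hg) <-]//]; by exists w.
Qed.

Lemma leaf_equiv_foliation p q (h : R * R -> R * R) :
  leaf_equiv p q h -> equiv_homeomorphism (foliation p) (foliation q) h.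
Proof.
move=> [hh hL]; split=> // _ [z ->]; have [g [hg gh hc gc]] := hh.
exists (h z); apply/seteqP; split=> [_ [w /hL zw <-]//|w zw].
by exists (g w); rewrite ?gh//; apply/hL; rewrite gh.
Qed.

Lemma leaf_equiv_inv p q (h : R * R -> R * R) : leaf_equiv p q h ->
  exists2 g, leaf_equiv q p g & cancel h g /\ cancel g h.
Proof.
move=> [hh hL]; have [g gg [hg gh]] := homeomorphism_inv hh.
by exists g => //; split=> // z w; rewrite -{1}(gh z) -{1}(gh w); split=> /hL.
Qed.

Lemma leaf_equiv_trans p q u (h k : R * R -> R * R) :
  leaf_equiv p q h -> leaf_equiv q u k -> leaf_equiv p u (k \o h).
Proof.
move=> [[g [hg gh hc gc]] hL] [[f [kf fk kc fc]] kL]; split; last first.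
  by move=> z w; rewrite hL kL.
exists (g \o f); split=> [z|z|z|z] /=; rewrite ?kf ?gh ?hg ?fk//.
- by apply: continuous_comp; [exact: hc|exact: kc].
- by apply: continuous_comp; [exact: fc|exact: gc].
Qed.

Lemma leaf_equiv_conj p q (h : R * R -> R * R) (l : R -> R) : homeomorphism h ->
  injective l -> l \o p = q \o h -> leaf_equiv p q h.
Proof.
move=> hh li lpq; split=> // z w; have [g [hg gh hc gc]] := hh.
have E u : l (p u) = q (h u) by have := congr1 (fun f => f u) lpq.
split; first by apply: leaf_image => // u v puv; rewrite -!E puv.
move=> zw; rewrite -(hg z) -(hg w); apply: leaf_image zw => // u v quv.
by apply: li; rewrite !E !gh.
Qed.

Lemma insep_equiv p q (h : R * R -> R * R) z w : leaf_equiv p q h ->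
  insep p z w -> insep q (h z) (h w).
Proof.
move=> [[g [hg gh hc gc]] hL] zw U V Uz Vw.
have [u [v [Uu Vv uv]]] := zw _ _ (hc _ _ Uz) (hc _ _ Vw).
by exists (h u), (h v); split=> //; apply/hL.
Qed.

End Inseparable.

(** * Vertical leaves under an equivalence *)

Lemma finite_has_max (R : realType) (A : set R) : finite_set A -> A !=set0 ->
  exists2 m, A m & forall a, A a -> a <= m.
Proof.
move=> /finite_seqP[l ->{A}] [a0 /= a0l].
have : l != [::] by move: a0l; case: l.
elim: l {a0l} => // b l IH _; case: (eqVneq l [::]) => [->|/IH[m /= ml mP]].
  by exists b => /= [|a]; rewrite inE// => /eqP ->.
have [bm|mb] := leP b m.
  by exists m => /= [|a]; rewrite inE ?ml ?orbT// => /orP[/eqP ->//|/mP].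
exists b => /= [|a]; rewrite inE ?eqxx// => /orP[/eqP ->//|/mP].
by move/le_trans; apply; exact: ltW.
Qed.

Section Transfer.
Variable R : realType.
Implicit Types (x y a b c d e : R) (z w : R * R) (r s sg : R -> R) (p q : R * R -> R).

(* If a vertical leaf goes to a graph leaf, its right graph neighbour goes to a
   vertical leaf, which has a graph neighbour on either side; the second one can
   only come from a vertical leaf further to the right. *)
Lemma bad_line_right r1 s1 sg1 r2 s2 sg2 (h : R * R -> R * R) z :
  tame r1 s1 sg1 -> tame r2 s2 sg2 -> leaf_equiv (linear_like r1 s1) (linear_like r2 s2) h ->
  s1 z.1 = 0 -> s2 (h z).1 <> 0 ->
  exists w, [/\ z.1 < w.1, s1 w.1 = 0 & s2 (h w).1 <> 0].
Proof.
move=> t1 t2 H sz shz; have [_ hL] := H.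
have [x zx adj] := adjacent_right t1 sz; have [sx _] := adj.
pose m := (x, (linear_like r1 s1 z - r1 x) / s1 x).
have zm : insep (linear_like r1 s1) z m.
  by apply: (insep_adjacent t1) => //=; rewrite linear_like_solveK.
have hzm := insep_equiv H zm.
have [/hL/(leaf_vertical _ t1 sz)/= xz|[sm adjm]] := insep_strip t2 shz hzm.
  by rewrite xz ltxx in zx.
set b := (h m).1 in sm adjm.
have [x2 adj2 nside] : exists2 x2, borders s2 b x2 & ~~ same_side b (h z).1 x2.
  have nb := adjacent_neq sm adjm.
  case: (ltgtP (h z).1 b) => // zb.
  - have [x2 bx2 ?] := adjacent_right t2 sm; exists x2 => //.
    by rewrite /same_side zb ltNge ltW//= ltNge ltW.
  - have [x2 bx2 ?] := adjacent_left t2 sm; exists x2 => //.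
    by rewrite /same_side zb [_ < b]ltNge ltW//= ltNge ltW.
have [sx2 _] := adj2.
pose m2 := (x2, (linear_like r2 s2 (h m) - r2 x2) / s2 x2).
have mm2 : insep (linear_like r2 s2) (h m) m2.
  by apply: (insep_adjacent t2) => //=; rewrite linear_like_solveK.
have [g G [hg gh]] := leaf_equiv_inv H.
have := insep_equiv G mm2; rewrite hg => mgm2.
have [/hL|[sg2' adjg]] := insep_strip t1 (sx : s1 m.1 <> 0) mgm2.
  rewrite gh => /(leaf_vertical _ t2 sm)/= x2b.
  by case: sx2; rewrite x2b.
exists (g m2); rewrite gh; split=> //.
have neq : (g m2).1 <> z.1.
  move=> gz; have : leaf (linear_like r1 s1) z (g m2) by apply/(leaf_vertical _ t1).
  move/hL; rewrite gh => /(leaf_strip _ t2 shz)[/(_ _ sm)/= + _].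
  by apply/negP.
have := adjg.2 _ sz (fun zg => neq (esym zg)); rewrite /same_side /=.
by rewrite [x < _]ltNge (ltW zx) andbF /= => /andP[].
Qed.

(** Zeros being finite, the vertical leaves sent to graph leaves would include a rightmost one,
    against [bad_line_right]. *)
Lemma zero_line_image r1 s1 sg1 r2 s2 sg2 (h : R * R -> R * R) z :
  tame r1 s1 sg1 -> tame r2 s2 sg2 -> leaf_equiv (linear_like r1 s1) (linear_like r2 s2) h ->
  s1 z.1 = 0 -> s2 (h z).1 = 0.
Proof.
move=> t1 t2 H sz; apply: contrapT => nz.
pose W := [set a | s1 a = 0 /\ exists w, w.1 = a /\ s2 (h w).1 <> 0].
have Wf : finite_set W by have [_ _ + _ _] := t1; apply: sub_finite_set => a [].
have [|a [sa [w [wa sw]]] mP] := finite_has_max Wf; first by exists z.1; split=> //; exists z.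
rewrite -{}wa in sa mP.
have [u [wu su shu]] := bad_line_right t1 t2 H sa sw.
have : W u.1 by split=> //; exists u.
by move=> /mP; rewrite leNgt wu.
Qed.

End Transfer.

(** * Left and right sides of the vertical leaves *)

Section Sides.
Variable R : realType.
Implicit Types (x y a b c d e : R) (z w : R * R).
Variables (r1 s1 sg1 r2 s2 sg2 : R -> R) (h : R * R -> R * R).
Hypotheses (t1 : tame r1 s1 sg1) (t2 : tame r2 s2 sg2).
Hypothesis (H : leaf_equiv (linear_like r1 s1) (linear_like r2 s2) h).

(** At a zero [a] of [s1] the height 0 is immaterial: the whole vertical leaf has its image over
    this abscissa. *)
Definition line_image a := (h (a, 0)).1.

Lemma line_imageE a z : s1 a = 0 -> z.1 = a <-> (h z).1 = line_image a.
Proof.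
move=> sa; have [_ hL] := H; have ha := zero_line_image t1 t2 H (sa : s1 (a, 0).1 = 0).
split=> [za|hza].
  have : leaf (linear_like r1 s1) (a, 0) z by apply/(leaf_vertical _ t1).
  by move/hL/(leaf_vertical _ t2 ha).
have : leaf (linear_like r2 s2) (h (a, 0)) (h z) by apply/(leaf_vertical _ t2).
by move/hL/(leaf_vertical _ t1 (sa : s1 (a, 0).1 = 0)).
Qed.

Lemma line_image_zero a : s1 a = 0 -> s2 (line_image a) = 0.
Proof. by move=> sa; exact: (zero_line_image t1 t2 H (sa : s1 (a, 0).1 = 0)). Qed.

Lemma zero_lineE z : s1 z.1 = 0 <-> s2 (h z).1 = 0.
Proof.
split=> [sz|shz]; first exact: (zero_line_image t1 t2 H).
have [g G [hg gh]] := leaf_equiv_inv H.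
by rewrite -(hg z); exact: (zero_line_image t2 t1 G).
Qed.

Lemma segment_connected2 z w : exists2 C : set (R * R), connected C &
  [/\ C z, C w & forall b u, same_side b z.1 w.1 -> C u -> same_side b z.1 u.1].
Proof.
pose f (t : R) := (z.1 + t * (w.1 - z.1), z.2 + t * (w.2 - z.2)).
exists (f @` [set` `[0 : R, 1 : R]]).
  apply: connected_continuous_connected; first exact: segment_connected.
  apply: continuous_subspaceT => t.
  have f1 : z.1 + u * (w.1 - z.1) @[u --> t] --> z.1 + t * (w.1 - z.1).
    by apply: cvgD; [exact: cvg_cst|apply: cvgM; [exact: cvg_id|exact: cvg_cst]].
  have f2 : z.2 + u * (w.2 - z.2) @[u --> t] --> z.2 + t * (w.2 - z.2).
    by apply: cvgD; [exact: cvg_cst|apply: cvgM; [exact: cvg_id|exact: cvg_cst]].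
  exact: (cvg_pair f1 f2).
split.
- exists 0; first by rewrite /= in_itv /= lexx ler01.
  by rewrite /f !mul0r !addr0 -surjective_pairing.
- exists 1; first by rewrite /= in_itv /= lexx ler01.
  by rewrite /f !mul1r !subrKC -surjective_pairing.
move=> b _ + [t /= + <-] /=; rewrite in_itv /= => + /andP[t0 t1'].
have -> : z.1 + t * (w.1 - z.1) = (1 - t) * z.1 + t * w.1 by ring.
have [->|tn0] := eqVneq t 0.
  rewrite subr0 mul1r mul0r addr0.
  by rewrite /same_side => /orP[]/andP[-> _]; rewrite ?orbT.
have {tn0}t0' : 0 < t by rewrite lt_neqAle eq_sym tn0.
rewrite /same_side => /orP[]/andP[zb wb]; rewrite zb /=; apply/orP; [left|right].
  have : 0 < t * (b - w.1) by rewrite mulr_gt0// subr_gt0.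
  have : 0 <= (1 - t) * (b - z.1) by rewrite mulr_ge0 ?subr_ge0// ltW.
  lra.
have : 0 < t * (w.1 - b) by rewrite mulr_gt0// subr_gt0.
have : 0 <= (1 - t) * (z.1 - b) by rewrite mulr_ge0 ?subr_ge0// ltW.
lra.
Qed.

Lemma same_side_image a z w : s1 a = 0 -> same_side a z.1 w.1 ->
  same_side (line_image a) (h z).1 (h w).1.
Proof.
move=> sa zw; apply: contrapT => /negP nside.
have [C Cc [Cz Cw Cside]] := segment_connected2 z w.
have hc : continuous h by have [[g []]] := H.
have hCc : connected (h @` C).
  by apply: connected_continuous_connected => //; exact: continuous_subspaceT.
have [_ [v Cv <-] /(line_imageE _ sa) va] := connected_fst hCc (imageP h Cz) (imageP h Cw) nside.
by have := Cside _ _ zw Cv; rewrite va /same_side ltxx !andbF.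
Qed.

Definition keeps_sides a := forall z,
  (z.1 < a <-> (h z).1 < line_image a) /\ (a < z.1 <-> line_image a < (h z).1).

Definition swaps_sides a := forall z,
  (z.1 < a <-> line_image a < (h z).1) /\ (a < z.1 <-> (h z).1 < line_image a).

Lemma keeps_or_swaps a : s1 a = 0 -> keeps_sides a \/ swaps_sides a.
Proof.
move=> sa; pose zl : R * R := (a - 1, 0); pose zr : R * R := (a + 1, 0).
have al : zl.1 < a by rewrite /=; lra.
have ar : a < zr.1 by rewrite /=; lra.
set b := line_image a.
have neq z : z.1 <> a -> (h z).1 <> b by move=> + hz; apply; apply/(line_imageE _ sa).
have lP z : z.1 < a -> same_side b (h zl).1 (h z).1.
  by move=> za; apply: same_side_image => //; rewrite /same_side al za.
have rP z : a < z.1 -> same_side b (h zr).1 (h z).1.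
  by move=> za; apply: same_side_image => //; rewrite /same_side ar za orbT.
(* Surjectivity of [h]: were both half-planes sent to the same side, the mirror image of [h zl] in
   the line over [b] would have no preimage. *)
have opp : ~~ same_side b (h zl).1 (h zr).1.
  apply/negP => lr; have [[g [hg gh _ _]] _] := H.
  pose v := g (2 * b - (h zl).1, 0).
  have hv : (h v).1 = 2 * b - (h zl).1 by rewrite /v gh.
  have lb : (h zl).1 <> b by apply: neq => zla; rewrite zla ltxx in al.
  have va : v.1 <> a by move/(line_imageE _ sa); rewrite hv -/b => hvb; apply: lb; lra.
  have : same_side b (h zl).1 (h v).1.
    case: (ltgtP v.1 a) => // ? ; first exact: lP.
    by apply: same_side_trans lr _; exact: rP.
  by rewrite hv /same_side => /orP[]/andP[? ?]; lra.
have lb : (h zl).1 <> b by apply: neq => zla; rewrite zla ltxx in al.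
have rb : (h zr).1 <> b by apply: neq => zra; rewrite zra ltxx in ar.
have hE z : z.1 = a -> (h z).1 = b by move/(line_imageE _ sa).
case: (ltgtP (h zl).1 b) => // hl.
- left; have hr : b < (h zr).1.
    by move: opp; rewrite /same_side hl /=; case: (ltgtP (h zr).1 b).
  move=> z; case: (ltgtP z.1 a) => za.
  + by have := lP _ za; rewrite /same_side hl [b < (h zl).1]ltNge (ltW hl) orbF /= => zb;
      split; split=> //; rewrite ?zb// ltNge ltW.
  + by have := rP _ za; rewrite /same_side hr [(h zr).1 < b]ltNge (ltW hr) /= => zb;
      split; split=> //; rewrite ?zb// ltNge ltW.
  + by rewrite (hE _ za) !ltxx.
- right; have hr : (h zr).1 < b.
    by move: opp; rewrite /same_side hl /=; case: (ltgtP (h zr).1 b) => //; rewrite orbT.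
  move=> z; case: (ltgtP z.1 a) => za.
  + by have := lP _ za; rewrite /same_side hl [(h zl).1 < b]ltNge (ltW hl) /= => zb;
      split; split=> //; rewrite ?zb// ltNge ltW.
  + by have := rP _ za; rewrite /same_side hr [b < (h zr).1]ltNge (ltW hr) orbF /= => zb;
      split; split=> //; rewrite ?zb// ltNge ltW.
  + by rewrite (hE _ za) !ltxx.
Qed.

(** A point to the left of both lines would put the image of [a'] left of that of [a]; a point to
    the right of both would put it right. *)
Lemma not_keeps_swaps a a' : s1 a = 0 -> s1 a' = 0 -> keeps_sides a -> swaps_sides a' -> False.
Proof.
move=> sa sa' K S.
case: (ltgtP a a') => aa'.
- have := (K (a - 1, 0)).1.1 ltac:(rewrite /=; lra).
  have := (S (a - 1, 0)).1.1 ltac:(rewrite /=; lra).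
  have := (K (a' + 1, 0)).2.1 ltac:(rewrite /=; lra).
  have := (S (a' + 1, 0)).2.1 ltac:(rewrite /=; lra).
  lra.
- have := (K (a' - 1, 0)).1.1 ltac:(rewrite /=; lra).
  have := (S (a' - 1, 0)).1.1 ltac:(rewrite /=; lra).
  have := (K (a + 1, 0)).2.1 ltac:(rewrite /=; lra).
  have := (S (a + 1, 0)).2.1 ltac:(rewrite /=; lra).
  lra.
- subst a'.
  have := (K (a - 1, 0)).1.1 ltac:(rewrite /=; lra).
  have := (S (a - 1, 0)).1.1 ltac:(rewrite /=; lra).
  lra.
Qed.

End Sides.

(** * Transport of signs *)

Lemma continuous_injective_monotone (R : realType) (f : R -> R) :
  continuous f -> injective f ->
  (forall x y, x < y -> f x < f y) \/ (forall x y, x < y -> f y < f x).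
Proof.
move=> fc fi; have fc' : {within [set` (`]-oo, +oo[ : interval R)], continuous f}.
  exact: continuous_subspaceT.
have fi' : {in (`]-oo, +oo[ : interval R) &, injective f} by move=> x y _ _; exact: fi.
by have [m|m] := itv_continuous_inj_mono fc' fi'; [left|right] => x y xy; apply: m; rewrite ?in_itv.
Qed.

Section Oriented.
Variable R : realType.
Implicit Types (x y a b c d e : R) (z w : R * R).
Variables (r1 s1 sg1 r2 s2 sg2 : R -> R) (h : R * R -> R * R).
Hypotheses (t1 : tame r1 s1 sg1) (t2 : tame r2 s2 sg2).
Hypothesis (H : leaf_equiv (linear_like r1 s1) (linear_like r2 s2) h).
Hypothesis (K : forall a, s1 a = 0 -> keeps_sides h a).

Local Notation p1 := (linear_like r1 s1).
Local Notation p2 := (linear_like r2 s2).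
Local Notation beta := (line_image h).

Lemma beta_onto b : s2 b = 0 -> exists2 a, s1 a = 0 & beta a = b.
Proof.
move=> sb; have [[g [hg gh _ _]] _] := H.
have sg : s1 (g (b, 0)).1 = 0 by apply/(zero_lineE t1 t2 H); rewrite gh.
by exists (g (b, 0)).1 => //; have := (line_imageE t1 t2 H _ sg).1 erefl; rewrite gh => <-.
Qed.

Lemma beta_mono a a' : s1 a = 0 -> s1 a' = 0 -> a < a' -> beta a < beta a'.
Proof. by move=> _ sa' aa'; exact: (K sa' (a, 0)).1.1. Qed.

Lemma same_side_keeps a z w : s1 a = 0 ->
  same_side a z.1 w.1 = same_side (beta a) (h z).1 (h w).1.
Proof.
move=> sa; have [[zl zr] [wl wr]] := (K sa z, K sa w).
by apply/idP/idP; rewrite /same_side => /orP[]/andP[za wa]; apply/orP;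
  [left|right|left|right]; apply/andP; split; first [exact/zl|exact/zr|exact/wl|exact/wr].
Qed.

Lemma same_strip_keeps z w : same_strip s1 z.1 w.1 <-> same_strip s2 (h z).1 (h w).1.
Proof.
split=> zw b sb; last by rewrite same_side_keeps//; apply: zw; exact: (line_image_zero t1 t2 H).
by have [a sa <-] := beta_onto sb; rewrite -same_side_keeps//; exact: zw.
Qed.

Definition point1 x c : R * R := (x, (c - r1 x) / s1 x).
(* On values, [h] maps the leaf [c] of the strip of [x] to the leaf
   [transition x c]. *)
Definition transition x c := p2 (h (point1 x c)).

Lemma point1K x c : s1 x <> 0 -> p1 (point1 x c) = c.
Proof. exact: linear_like_solveK. Qed.

Lemma h_neq0 z : s1 z.1 <> 0 -> s2 (h z).1 <> 0.
Proof. by move=> sz /(zero_lineE t1 t2 H). Qed.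

Lemma transition_leaf x x' c : same_strip s1 x x' -> transition x c = transition x' c.
Proof.
move=> xx'; have sx := same_strip_neq0 xx'.
have sx' := same_strip_neq0 (same_strip_sym xx').
have : leaf p1 (point1 x c) (point1 x' c).
  by apply/(leaf_strip _ t1) => //; split=> //; rewrite !point1K.
by have [_ hL] := H; move=> /hL/leaf_level.
Qed.

Lemma transitionE z : s1 z.1 <> 0 -> p2 (h z) = transition z.1 (p1 z).
Proof.
move=> sz; rewrite /transition /point1 -(linear_like_solve sz (erefl : p1 (z.1, z.2) = _)).
  by rewrite -surjective_pairing.
Qed.

Lemma transition_continuous x : s1 x <> 0 -> continuous (transition x).
Proof.
move=> sx c; rewrite /transition.
have f : point1 x u @[u --> c] --> point1 x c.
  have f1 : x @[_ --> c] --> x by exact: cvg_cst.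
  have f2 : (u - r1 x) / s1 x @[u --> c] --> (c - r1 x) / s1 x.
    by apply: cvgM; [apply: cvgB; [exact: cvg_id|exact: cvg_cst]|exact: cvg_cst].
  exact: (cvg_pair f1 f2).
have hc : continuous h by have [[g []]] := H.
have [rc sc _ _ _] := t2.
have hp : h (point1 x u) @[u --> c] --> h (point1 x c) by apply: (cvg_comp _ _ f); exact: hc.
by apply: (cvg_comp _ _ hp); exact: linear_like_continuous.
Qed.

Lemma transition_inj x : s1 x <> 0 -> injective (transition x).
Proof.
move=> sx c c' cc'; have [_ hL] := H.
have : leaf p2 (h (point1 x c)) (h (point1 x c')).
  apply/(leaf_strip _ t2); first exact: h_neq0.
  split; first by apply/same_strip_keeps; exact: same_strip_refl.
  exact: esym.
by move=> /hL/leaf_level; rewrite !point1K.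
Qed.

(** The vertical leaf and the graph leaf of equal value are inseparable, so their images are
    inseparable and share a value. *)
Lemma transition_adjacent a x : s1 a = 0 -> borders s1 a x -> transition x (r1 a) = r2 (beta a).
Proof.
move=> sa ax; have [sx _] := ax.
have : insep p1 (a, 0) (point1 x (r1 a)).
  by apply: (insep_adjacent t1) => //=; rewrite point1K// linear_like0.
move/(insep_equiv H); have [rc sc _ _ _] := t2.
move/(insep_value (linear_like_continuous rc sc)) => pE; rewrite /transition -pE.
by rewrite linear_like0//; exact: (line_image_zero t1 t2 H).
Qed.

(** Two sample values decide, because [transition x] is continuous and injective, hence strictly
    monotone. *)
Definition preserves x := transition x 0 < transition x 1.

Lemma preserves_lt x c c' : s1 x <> 0 -> preserves x ->
  (c < c') = (transition x c < transition x c').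
Proof.
move=> sx px.
have [m|m] :=
  continuous_injective_monotone (transition_continuous sx) (transition_inj sx).
  case: (ltgtP c c') => [/m ->//|/m|->]; last by rewrite ltxx.
  by move=> cc'; apply/esym/negbTE; rewrite -leNgt ltW.
by have := m _ _ (ltr01); rewrite ltNge ltW.
Qed.

Lemma reverses_lt x c c' : s1 x <> 0 -> ~ preserves x ->
  (c < c') = (transition x c' < transition x c).
Proof.
move=> sx px.
have [m|m] :=
  continuous_injective_monotone (transition_continuous sx) (transition_inj sx).
  by case: px; exact: m.
case: (ltgtP c c') => [/m ->//|/m|->]; last by rewrite ltxx.
by move=> cc'; apply/esym/negbTE; rewrite -leNgt ltW.
Qed.

Lemma preserves_sign x c c' e e' : s1 x <> 0 -> e = 1 \/ e = -1 -> e' = 1 \/ e' = -1 ->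
  0 < e * (c - c') -> 0 < e' * (transition x c - transition x c') ->
  preserves x <-> e = e'.
Proof.
move=> sx; have [px|/negP px] := boolP (preserves x).
  have := preserves_lt c c' sx px; have := preserves_lt c' c sx px.
  move=> lt1 lt2 [->|->] [->|->]; rewrite ?mul1r ?mulN1r ?opprB !subr_gt0 ?lt1 ?lt2;
  by move=> u v; first [have := lt_trans u v; rewrite ltxx|split].
have := reverses_lt c c' sx px; have := reverses_lt c' c sx px.
move=> lt1 lt2 [->|->] [->|->]; rewrite ?mul1r ?mulN1r ?opprB !subr_gt0 ?lt1 ?lt2;
move=> u v; first [by have := lt_trans u v; rewrite ltxx|by split=> // ?; lra].
Qed.

Lemma near_line a x : s1 a = 0 -> borders s1 a x -> forall d, 0 < d ->
  exists y, [/\ `|y - a| < d, borders s1 a y, same_side a x y & same_strip s1 x y].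
Proof.
move=> sa ax d d0; have [d2 d20 d2P] := adjacent_near t1 sa.
have e0 : 0 < Num.min d d2 by rewrite lt_min d0.
have [y yd xy] : exists2 y, `|y - a| < Num.min d d2 & same_side a x y.
  case: (ltgtP x a) => xa.
  - exists (a - Num.min d d2 / 2); first by rewrite addrAC subrr add0r normrN gtr0_norm; lra.
    by rewrite /same_side xa /=; apply/orP; left; lra.
  - exists (a + Num.min d d2 / 2); first by rewrite addrAC subrr add0r gtr0_norm; lra.
    by rewrite /same_side xa /=; apply/orP; right; lra.
  - by case: (adjacent_neq sa ax).
move: (yd); rewrite lt_min => /andP[yd1 yd2]; exists y; split=> //.
  apply: (d2P y yd2).1 => ya; move: xy; rewrite ya /same_side ltxx !andbF//.
exact: (d2P y yd2).2.
Qed.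

(** Passing from the vertical leaf to a nearby point on its right changes the first function in the
    direction [sg1 a]; as [h] keeps sides, the second function changes in the direction
    [sg2 (beta a)]. To the left both directions are reversed. [transition x] relates the two
    changes. *)
Lemma preserves_adjacent a x : s1 a = 0 -> borders s1 a x -> preserves x <-> sg1 a = sg2 (beta a).
Proof.
move=> sa ax; have [sx _] := ax.
have hc : continuous h by have [[g []]] := H.
have sb : s2 (beta a) = 0 by exact: (line_image_zero t1 t2 H).
have [_ _ _ _ /(_ a sa)[sg1P _]] := t1; have [_ _ _ _ /(_ _ sb)[sg2P _]] := t2.
have [d1 d10 d1P] := tame_monotone 0 t1 sa.
(* Monotonicity is available only for bounded heights; continuity of [h] at [(a, 0)] will keep the
   image heights within this bound. *)
have [d2 d20 d2P] := tame_monotone (`|(h (a, 0)).2| + 1) t2 sb.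
have U : nbhs (h (a, 0)) [set w | `|w.1 - beta a| < d2 /\ `|w.2| < `|(h (a, 0)).2| + 1].
  apply/nbhs_planeP; exists (Num.min d2 1); first by rewrite lt_min d20 ltr01.
  move=> w; rewrite !lt_min => /andP[w1 _] /andP[_ w2]; split=> //.
  have -> : w.2 = (h (a, 0)).2 + (w.2 - (h (a, 0)).2) by ring.
  by rewrite (le_lt_trans (ler_normD _ _))// ltrD2l.
have /nbhs_planeP[d3 d30 d3P] := hc _ _ U.
have [|y [yd ay xy sxy]] := near_line (d := Num.min d1 d3) sa ax; first by rewrite lt_min d10.
move: yd; rewrite lt_min => /andP[yd1 yd3].
have [hy1 hy2] : `|(h (y, 0)).1 - beta a| < d2 /\ `|(h (y, 0)).2| < `|(h (a, 0)).2| + 1.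
  by apply: d3P => //=; rewrite subrr normr0.
have sy := ay.1.
set Y := (h (y, 0)).2 in hy2; set X := (h (y, 0)).1 in hy1.
have E1 : p1 (a, 0) = r1 a by rewrite linear_like0.
(* The second function is constant on the image line, so the comparison can be made at the height
   [Y] of the nearby image point. *)
have E2 : p2 (beta a, Y) = r2 (beta a) by rewrite linear_like0.
have E3 : p2 (X, Y) = transition x (p1 (y, 0)).
  rewrite (transition_leaf _ sxy) -(transitionE (sy : s1 (y, 0).1 <> 0)).
  by rewrite /X /Y -surjective_pairing.
have TA := transition_adjacent sa ax.
have dd d (u : R) : 0 < d -> `|u - u| < d by rewrite subrr normr0.
have [Kl Kr] := K sa (y, 0); rewrite /= -/X in Kl Kr.
have ya : y <> a by exact: adjacent_neq ay.
case: (ltgtP y a) => // {}ya.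
- have := d2P _ _ Y (dd _ _ d20) hy1 (ltW hy2) (Kl.1 ya); rewrite E2 E3 -TA.
  have := d1P a y 0 (dd _ _ d10) yd1; rewrite normr0 lexx => /(_ isT ya); rewrite E1.
  exact: preserves_sign.
- have := d2P _ _ Y hy1 (dd _ _ d20) (ltW hy2) (Kr.1 ya); rewrite E2 E3 -TA.
  have := d1P y a 0 yd1 (dd _ _ d10); rewrite normr0 lexx => /(_ isT ya); rewrite E1.
  exact: preserves_sign.
Qed.

(* On either side of a zero [x] of [s1], near the vertical leaf, values lie on the
   side of [r1 x] prescribed by [sg1 x]: this extends [preserves] across [x]. *)
Definition preserving x := (s1 x <> 0 /\ preserves x) \/ (s1 x = 0 /\ sg1 x = sg2 (beta x)).

Lemma same_strip_near x : s1 x <> 0 ->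
  exists2 d, 0 < d & forall y, `|y - x| < d -> same_strip s1 x y.
Proof.
move=> sx; have [_ _ Zf _ _] := t1; have [d d0 dP] := finite_isolated x Zf.
exists d => // y yx b sb; apply: same_side_near; apply: lt_le_trans yx _.
rewrite distrC leNgt; apply/negP => /(dP _ sb) bx; by apply: sx; rewrite -bx.
Qed.

Lemma preserves_strip x y : same_strip s1 x y -> preserves x <-> preserves y.
Proof. by move=> xy; rewrite /preserves !(transition_leaf _ xy). Qed.

Lemma preserving_const x y : preserving x -> preserving y.
Proof.
apply: locally_constant => {y}{}x; have [sx|/eqP sx] := eqVneq (s1 x) 0.
  have [d d0 dP] := adjacent_near t1 sx; exists d => // y yx.
  have [->//|/eqP yn] := eqVneq y x.
  have xy := (dP y yx).1 yn; have sy := xy.1.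
  have := preserves_adjacent sx xy; rewrite /preserving; tauto.
have [d d0 dP] := same_strip_near sx; exists d => // y /dP xy.
have := preserves_strip xy; have := same_strip_neq0 (same_strip_sym xy).
rewrite /preserving; tauto.
Qed.

End Oriented.

(** * Orientation of the vertical leaves *)

Section Heights.
Variable R : realType.
Implicit Types (x y a b c d e : R) (z w : R * R).

Lemma pair_ext z w : z.1 = w.1 -> z.2 = w.2 -> z = w.
Proof. by case: z w => ? ? [? ?] /= -> ->. Qed.

Lemma same_strip_sign (s : R -> R) x y : continuous s -> same_strip s x y -> 0 < s x * s y.
Proof.
move=> sc; wlog xy : x y / x <= y => [hw|] st.
  case: (leP x y) => [xy|/ltW yx]; first exact: hw.
  by rewrite mulrC; apply: hw => //; exact: same_strip_sym.
have sx := same_strip_neq0 st; have sy := same_strip_neq0 (same_strip_sym st).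
rewrite ltNge; apply/negP => xy0.
have [t] : exists2 t, t \in `[x, y] & s t = 0.
  apply: IVT => //; first exact: continuous_subspaceT.
  by rewrite ge_min le_max; case: (ltgtP (s x) 0) => // h1; case: (ltgtP (s y) 0) => // h2; nra.
rewrite in_itv /= => /andP[xt ty] /st; rewrite /same_side => /orP[]/andP[? ?]; lra.
Qed.

(** Since [z] and [w] lie on one level, moving from [z.1] to [w.1] at height [z.2] changes the value
    by [s w.1 * (z.2 - w.2)]; [tame_monotone] reads the order of the abscissas off its sign. *)
Lemma level_order r s sg b B : tame r s sg -> s b = 0 -> exists2 d, 0 < d &
  forall z w, `|z.1 - b| < d -> `|w.1 - b| < d -> `|z.2| <= B ->
    linear_like r s z = linear_like r s w ->
    (z.1 < w.1) = (0 < sg b * (s w.1 * (z.2 - w.2))).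
Proof.
move=> t sb; have [d d0 dP] := tame_monotone B t sb; exists d => // z w zb wb zB zw.
have E : linear_like r s (w.1, z.2) - linear_like r s (z.1, z.2) = s w.1 * (z.2 - w.2).
  by rewrite -surjective_pairing zw /linear_like /=; ring.
rewrite -E; case: (ltgtP z.1 w.1) => zw1.
- by rewrite (dP w.1 z.1 z.2).
- apply/esym/negbTE; rewrite -leNgt -oppr_ge0 -mulrN opprB.
  by rewrite ltW// (dP z.1 w.1 z.2).
- by rewrite zw1 subrr mulr0 ltxx.
Qed.

Lemma sign_between (sg u v w : R) : sg = 1 \/ sg = -1 ->
  0 < sg * (v - u) -> 0 < sg * (v - w) -> `|w - v| < `|u - v| ->
  Num.min u v <= w <= Num.max u v.
Proof.
rewrite ge_min le_max => -[->|->]; rewrite ?mul1r ?mulN1r ?opprB !subr_gt0 => uv wv.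
  rewrite !ltr0_norm ?subr_lt0// => uw.
  by apply/andP; split; apply/orP; [left|right]; lra.
rewrite !gtr0_norm ?subr_gt0// => uw.
by apply/andP; split; apply/orP; [right|left]; lra.
Qed.

(** Sign bookkeeping for [height_sign]: [A] and [B] are the values of [s1] and [s2] at a point and
    at its image, [u] and [v] have the same signs as these, and [g] is a difference of image heights
    whose source counterpart is -1. *)
Lemma product_sign (sg A B g u v : R) : sg = 1 \/ sg = -1 -> A != 0 -> B != 0 ->
  0 < u * A -> 0 < v * B -> (0 < sg * - A) = (0 < sg * (B * g)) ->
  (g < 0 -> 0 < u * v) /\ (0 < g -> ~ 0 < u * v).
Proof.
rewrite !neq_lt => sgP /orP[]A0 /orP[]B0;
  rewrite ?(nmulr_lgt0 _ A0) ?(nmulr_lgt0 _ B0) ?(pmulr_lgt0 _ A0) ?(pmulr_lgt0 _ B0) => u0 v0;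
  case: sgP => ->; rewrite ?mul1r ?mulN1r ?opprK ?oppr_gt0 ?oppr_lt0;
  rewrite ?(pmulr_rgt0 _ B0) ?(nmulr_rgt0 _ B0) ?(nmulr_rlt0 _ B0) ?(pmulr_rlt0 _ B0);
  rewrite ?A0 ?(ltNge 0 A) ?(ltNge A 0) ?(ltW A0) /=;
  rewrite ?(nmulr_rgt0 _ u0) ?(pmulr_rgt0 _ u0) ?v0 => Eg;
  split=> g0; rewrite ?v0 // ?(ltNge 0 v) ?(ltNge v 0) ?(ltW v0) //;
  by move: Eg; rewrite ?g0 // ltNge (ltW g0).
Qed.

Variables (r1 s1 sg1 r2 s2 sg2 : R -> R) (h : R * R -> R * R).
Hypotheses (t1 : tame r1 s1 sg1) (t2 : tame r2 s2 sg2).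
Hypothesis (H : leaf_equiv (linear_like r1 s1) (linear_like r2 s2) h).
Hypothesis (K : forall a, s1 a = 0 -> keeps_sides h a).

Local Notation p1 := (linear_like r1 s1).
Local Notation p2 := (linear_like r2 s2).
Local Notation beta := (line_image h).
Local Notation point1 := (point1 r1 s1).

(** Within a graph leaf the abscissa determines the point, in the source and in the image. So the
    image abscissa is a continuous injective function of the abscissa, hence monotone, and one pair
    of points fixes its direction. *)
Lemma leaf_order c x y u v : x < y -> same_strip s1 x y ->
  (h (point1 x c)).1 < (h (point1 y c)).1 ->
  x <= u <= y -> x <= v <= y ->
  (u < v) = ((h (point1 u c)).1 < (h (point1 v c)).1).
Proof.
move=> xy st hxy uI vI; pose f t := (h (point1 t c)).1.
have [rc sc _ _ _] := t1; have [[g [hg gh hc gc]] hL] := H.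
have sub t : x <= t <= y -> same_strip s1 x t.
  move=> /andP[xt ty] b /st; rewrite /same_side => /orP[]/andP[h1 h2];
    apply/orP; [left|right]; apply/andP; split; lra.
have fc : {within [set` `[x, y]], continuous f}.
  apply: continuous_in_subspaceT => t; rewrite inE /= in_itv /=.
  move=> /sub/same_strip_sym/same_strip_neq0/eqP st0.
  have p : point1 u c @[u --> t] --> point1 t c.
    have f1 : u @[u --> t] --> t by exact: cvg_id.
    have f2 : (c - r1 u) / s1 u @[u --> t] --> (c - r1 t) / s1 t.
      by apply: cvgM; [apply: cvgB; [exact: cvg_cst|exact: rc]|apply: cvgV => //; exact: sc].
    exact: (cvg_pair f1 f2).
  have hp : h (point1 u c) @[u --> t] --> h (point1 t c) by apply: (cvg_comp _ _ p); exact: hc.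
  by apply: (cvg_comp _ _ hp); exact: cvg_fst.
have fi : {in `[x, y] &, injective f}.
  move=> t t'; rewrite !in_itv /= => /sub xt /sub xt' ff.
  have st' : same_strip s1 t t' := same_strip_trans (same_strip_sym xt) xt'.
  have nt := same_strip_neq0 st'; have nt' := same_strip_neq0 (same_strip_sym st').
  have : leaf p1 (point1 t c) (point1 t' c).
    by apply/(leaf_strip _ t1) => //; split=> //; rewrite !point1K.
  move/hL/leaf_level => pp; have := h_neq0 t1 t2 H (nt : s1 (point1 t c).1 <> 0).
  move=> sh; suff : point1 t c = point1 t' c by move=> /(congr1 fst).
  apply: (can_inj hg).
  have h2 z : (h z).1 = f t -> p2 (h z) = p2 (h (point1 t c)) ->
      (h z).2 = (p2 (h (point1 t c)) - r2 (f t)) / s2 (f t).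
    move=> hz pz; apply: linear_like_solve => //.
    by rewrite -pz -hz -surjective_pairing.
  by apply: pair_ext => //; rewrite !h2.
have xI : x \in `[x, y] by rewrite in_itv /= lexx ltW.
have yI : y \in `[x, y] by rewrite in_itv /= lexx ltW.
have {}uI : u \in `[x, y] by rewrite in_itv.
have {}vI : v \in `[x, y] by rewrite in_itv.
have [m|m] := itv_continuous_inj_mono fc fi; last first.
  by have := m _ _ yI xI xy; rewrite ltNge ltW.
case: (ltgtP u v) => [/(m _ _ uI vI) ->//|vu|->]; last by rewrite ltxx.
by apply/esym/negbTE; rewrite -leNgt ltW// m.
Qed.

Lemma near_point (f : R * R -> R) z e : continuous f -> 0 < e ->
  exists2 d, 0 < d & forall w, `|w.1 - z.1| < d -> `|w.2 - z.2| < d -> `|f w - f z| < e.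
Proof. by move=> fc e0; have /cvg_pt := fc z; apply. Qed.

Lemma h_fst_continuous : continuous (fun z => (h z).1).
Proof. by have [[g [_ _ hc _]] _] := H; move=> z; apply: continuous_fst; exact: hc. Qed.

Lemma h_snd_continuous : continuous (fun z => (h z).2).
Proof. by have [[g [_ _ hc _]] _] := H; move=> z; apply: continuous_snd; exact: hc. Qed.

Lemma p1_continuous : continuous p1.
Proof. by have [rc sc _ _ _] := t1; exact: linear_like_continuous. Qed.

(** The point of the leaf over [x] serves as a reference: its image stays away from the image line
    while those of [u] and [v] approach it, and [h] keeps sides. This supplies the direction
    required by [leaf_order]. *)
Lemma order_along_leaf a x y0 y1 : s1 a = 0 -> borders s1 a x ->
  exists2 d, 0 < d & forall u v,
    `|u.1 - a| < d -> `|u.2 - y0| < d -> `|v.1 - a| < d -> `|v.2 - y1| < d ->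
    same_side a x u.1 -> same_side a x v.1 -> p1 u = p1 v ->
    (u.1 < v.1) = ((h u).1 < (h v).1).
Proof.
move=> sa ax; have sx := ax.1; have xa := adjacent_neq sa ax.
pose m := point1 x (r1 a).
have hm : (h m).1 <> beta a by move/(line_imageE t1 t2 H _ sa).
(* Half the distance: the images of [u] and [v], within [e] of the image line, cannot overtake the
   reference point, within [e] of [h m]. *)
pose e := `|(h m).1 - beta a| / 2.
have e0 : 0 < e by rewrite divr_gt0// normr_gt0 subr_eq0; exact/eqP.
have [d1 d10 d1P] := near_point m h_fst_continuous e0.
have d1s : 0 < d1 * `|s1 x| by rewrite mulr_gt0// normr_gt0; exact/eqP.
have [d2 d20 d2P] := near_point (a, y0) p1_continuous d1s.
have [d3 d30 d3P] := near_point (a, y0) h_fst_continuous e0.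
have [d4 d40 d4P] := near_point (a, y1) h_fst_continuous e0.
have [d5 d50 d5P] := adjacent_near t1 sa.
have xa0 : 0 < `|x - a| by rewrite normr_gt0 subr_eq0; exact/eqP.
exists (Num.min d2 (Num.min d3 (Num.min d4 (Num.min d5 `|x - a|)))).
  by rewrite !lt_min d20 d30 d40 d50.
move=> u v; rewrite !lt_min => /and5P[u2 u3 u4 u5 u6] /and5P[w2 w3 w4 w5 w6].
move=> /and5P[v2 v3 v4 v5 v6] /and5P[z2 z3 z4 z5 z6] xu xv uv.
set c := p1 u in uv.
have su := (d5P _ u5).2 _ ax xu; have sv := (d5P _ v5).2 _ ax xv.
have su0 := same_strip_neq0 (same_strip_sym su).
have sv0 := same_strip_neq0 (same_strip_sym sv).
have uE : u = point1 u.1 c.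
  by apply: pair_ext => //=; apply: linear_like_solve; rewrite -?surjective_pairing.
have vE : v = point1 v.1 c.
  by apply: pair_ext => //=; apply: linear_like_solve; rewrite -?surjective_pairing.
have ba y : beta a = (h (a, y)).1 by have /(line_imageE t1 t2 H _ sa) := erefl : (a, y).1 = a.
have hu : `|(h u).1 - beta a| < e by rewrite (ba y0); exact: d3P.
have hv : `|(h v).1 - beta a| < e by rewrite (ba y1); exact: d4P.
have hmc : `|(h (point1 x c)).1 - (h m).1| < e.
  apply: d1P; rewrite /= ?subrr ?normr0//.
  rewrite -mulrBl normrM normfV ltr_pdivrMr ?normr_gt0; last exact/eqP.
  have -> : c - r1 x - (r1 a - r1 x) = c - p1 (a, y0) by rewrite linear_like0//=; ring.
  exact: d2P.
have [Kml Kmr] := K sa m; rewrite /= in Kml Kmr.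
have hu' : (h (point1 u.1 c)).1 = (h u).1 by rewrite -uE.
have hv' : (h (point1 v.1 c)).1 = (h v).1 by rewrite -vE.
move: hu hv hmc; rewrite !ltr_norml => /andP[hu1 hu2] /andP[hv1 hv2] /andP[hm1 hm2].
case: (ltgtP x a) => // {}xa.
- have eE : e = (beta a - (h m).1) / 2.
    by rewrite /e ltr0_norm ?opprB// subr_lt0; exact: Kml.1.
  have close t : same_side a x t -> `|t - a| < `|x - a| -> x < t.
    rewrite /same_side xa /= [a < x]ltNge (ltW xa) orbF => ta.
    by rewrite !ltr0_norm ?subr_lt0// ltrN2 ltrD2r.
  have hmu : (h (point1 x c)).1 < (h u).1 by move: hm2 hu1 eE; clear -t1 t2 H K; lra.
  have hmv : (h (point1 x c)).1 < (h v).1 by move: hm2 hv1 eE; clear -t1 t2 H K; lra.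
  have {}xu := close _ xu u6; have {}xv := close _ xv v6.
  rewrite -hu' -hv'; case: (leP u.1 v.1) => uv1.
  + apply: (leaf_order xv sv); rewrite ?hv' //.
      by rewrite uv1 ltW.
    by rewrite lexx ltW.
  + apply: (leaf_order xu su); rewrite ?hu' //.
      by rewrite lexx ltW.
    by rewrite !ltW.
- have eE : e = ((h m).1 - beta a) / 2.
    by rewrite /e gtr0_norm// subr_gt0; exact: Kmr.1.
  have close t : same_side a x t -> `|t - a| < `|x - a| -> t < x.
    rewrite /same_side xa /= [x < a]ltNge (ltW xa) /= => ta.
    by rewrite !gtr0_norm ?subr_gt0// ltrD2r.
  have hmu : (h u).1 < (h (point1 x c)).1 by move: hm1 hu2 eE; clear -t1 t2 H K; lra.
  have hmv : (h v).1 < (h (point1 x c)).1 by move: hm1 hv2 eE; clear -t1 t2 H K; lra.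
  have {}xu := close _ xu u6; have {}xv := close _ xv v6.
  rewrite -hu' -hv'; case: (leP u.1 v.1) => uv1.
  + apply: (leaf_order xu (same_strip_sym su)); rewrite ?hu' //.
      by rewrite lexx ltW.
    by rewrite uv1 ltW.
  + apply: (leaf_order xv (same_strip_sym sv)); rewrite ?hv' //.
      by rewrite !ltW.
    by rewrite lexx ltW.
Qed.

(** Fix [e] near [a], then take [x1] so close to [a] that the value at [(x1, 1)] is nearer to [r1 a]
    than the value at [(e, 0)]. Both lie on the same side of [r1 a], so the intermediate value
    theorem at height 0, between [a] and [e], yields [x0]. *)
Lemma common_leaf a x d : s1 a = 0 -> borders s1 a x -> 0 < d ->
  exists x0 x1, [/\ `|x0 - a| < d, `|x1 - a| < d, same_side a x x0, same_side a x x1 &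
    p1 (x0, 0) = p1 (x1, 1)].
Proof.
move=> sa ax d0; have [rc sc _ _ /(_ a sa)[sgP _]] := t1.
have [d1 d10 d1P] := tame_monotone 1 t1 sa.
have [|e [ed ae xe _]] := near_line t1 (d := Num.min d d1) sa ax; first by rewrite lt_min d0.
move: ed; rewrite lt_min => /andP[ed ed1].
have ea := adjacent_neq sa ae.
have pa y : p1 (a, y) = r1 a by rewrite linear_like0.
have aa t : 0 < t -> `|a - a| < t by rewrite subrr normr0.
have re : 0 < `|p1 (e, 0) - r1 a|.
  rewrite normr_gt0 subr_eq0 -(pa 0); apply/eqP => pe.
  case: (ltgtP e a) => // {}ea.
    have := d1P _ _ 0 (aa _ d10) ed1; rewrite normr0 ler01 => /(_ isT ea).
    by rewrite pe subrr mulr0 ltxx.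
  have := d1P _ _ 0 ed1 (aa _ d10); rewrite normr0 ler01 => /(_ isT ea).
  by rewrite pe subrr mulr0 ltxx.
have [d2 d20 d2P] := near_point (a, 1) p1_continuous re.
have [|x1 [x1d ax1 xx1 _]] := near_line t1 (d := Num.min d (Num.min d1 d2)) sa ax.
  by rewrite !lt_min d0 d10.
move: x1d; rewrite !lt_min => /and3P[x1d x1d1 x1d2].
have x1a := adjacent_neq sa ax1.
have := d2P (x1, 1) x1d2 (ltac:(by rewrite subrr normr0)); rewrite pa => close.
have ex : same_side a e x1 by apply: same_side_trans xx1; exact: same_side_sym.
suff [x0 [x0a ex0 x0e px0]] : exists x0, [/\ x0 <> a, same_side a e x0,
   `|x0 - a| <= `|e - a| & r1 x0 = p1 (x1, 1)].
  exists x0, x1; split=> //; first exact: le_lt_trans ed.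
    exact: same_side_trans ex0.
  by rewrite [LHS]/linear_like /= mulr0 addr0.
have p0 t : p1 (t, 0) = r1 t by rewrite /linear_like /= mulr0 addr0.
rewrite p0 in close re.
case: (ltgtP e a) => // {}ea.
- have x1a' : x1 < a by move: ex; rewrite /same_side ea /= [a < e]ltNge (ltW ea) orbF.
  have m0 := d1P _ _ 0 (aa _ d10) ed1; move: m0; rewrite normr0 ler01 => /(_ isT ea).
  have m1 := d1P _ _ 1 (aa _ d10) x1d1; move: m1; rewrite normr1 lexx => /(_ isT x1a').
  rewrite !pa p0 => m1 m0.
  have [x0] : exists2 x0, x0 \in `[e, a] & r1 x0 = p1 (x1, 1).
    apply: IVT; [exact: ltW|exact: continuous_subspaceT|].
    exact: sign_between sgP m0 m1 close.
  rewrite in_itv /= => /andP[ex0 x0a] px0.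
  have x0n : x0 <> a.
    by move=> x0E; move: m1; rewrite -px0 x0E subrr mulr0 ltxx.
  have {}x0a : x0 < a by rewrite lt_neqAle x0a andbT; exact/eqP.
  exists x0; split=> //; first by rewrite /same_side ea x0a.
  by rewrite !ltr0_norm ?subr_lt0//; lra.
- have x1a' : a < x1 by move: ex; rewrite /same_side ea /= [e < a]ltNge (ltW ea).
  have m0 := d1P _ _ 0 ed1 (aa _ d10); move: m0; rewrite normr0 ler01 => /(_ isT ea).
  have m1 := d1P _ _ 1 x1d1 (aa _ d10); move: m1; rewrite normr1 lexx => /(_ isT x1a').
  rewrite !pa p0 => m1 m0.
  have [x0] : exists2 x0, x0 \in `[a, e] & r1 x0 = p1 (x1, 1).
    apply: IVT; [exact: ltW|exact: continuous_subspaceT|].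
    rewrite minC maxC; apply: (@sign_between (- sg1 a)) close; rewrite ?mulNr -?mulrN ?opprB//.
    by case: sgP => ->; [right|left; rewrite opprK].
  rewrite in_itv /= => /andP[ax0 x0e] px0.
  have x0n : x0 <> a.
    by move=> x0E; move: m1; rewrite -px0 x0E subrr mulr0 ltxx.
  have {}ax0 : a < x0 by rewrite lt_neqAle ax0 andbT; apply/eqP => ax0E; apply: x0n.
  exists x0; split=> //; first by rewrite /same_side ea ax0 orbT.
  by rewrite !gtr0_norm ?subr_gt0//; lra.
Qed.

(** Orientation of [h] along the vertical leaf over a zero [a], which is mapped homeomorphically
    onto a vertical leaf; two sample heights decide it. *)
Definition rises a := (h (a, 0)).2 < (h (a, 1)).2.

Hypothesis sgE : forall a, s1 a = 0 -> sg1 a = sg2 (beta a).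

(* A leaf passing close to the vertical leaf over [a] meets the heights 0 and 1 in
   an order given by the signs of [s1] and [sg1], and [h] preserves the order of
   the abscissas along that leaf. *)
Lemma height_sign a x : s1 a = 0 -> borders s1 a x ->
  0 < s1 x * s2 (h (x, 0)).1 <-> rises a.
Proof.
move=> sa ax; have [[g [hg gh hc gc]] hL] := H.
have sb : s2 (beta a) = 0 by exact: (line_image_zero t1 t2 H).
have [rc sc _ _ /(_ a sa)[sgP _]] := t1; have [rc2 sc2 _ _ _] := t2.
set Y0 := (h (a, 0)).2; set Y1 := (h (a, 1)).2.
have hb y : (h (a, y)).1 = beta a by have /(line_imageE t1 t2 H _ sa) := erefl : (a, y).1 = a.
have Y01 : Y0 <> Y1.
  move=> Y01; suff : (0 : R) = 1 by move/eqP; rewrite eq_sym oner_eq0.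
  have : h (a, 0) = h (a, 1) by apply: pair_ext => //; rewrite !hb.
  by move/(can_inj hg) => [].
(* Image heights within [e] of [Y0] and of [Y1] compare as [Y0] and [Y1] do. *)
pose e := `|Y1 - Y0| / 2.
have e0 : 0 < e by rewrite divr_gt0// normr_gt0 subr_eq0; apply/eqP => /esym.
have [d1 d10 d1P] := order_along_leaf 0 1 sa ax.
have [d2 d20 d2P] := level_order 1 t1 sa.
have [d3 d30 d3P] := level_order (`|Y0| + e) t2 sb.
have [d4 d40 d4P] := near_point (a, 0) h_snd_continuous e0.
have [d5 d50 d5P] := near_point (a, 1) h_snd_continuous e0.
have [d6 d60 d6P] := near_point (a, 0) h_fst_continuous d30.
have [d7 d70 d7P] := near_point (a, 1) h_fst_continuous d30.
have [d8 d80 d8P] := adjacent_near t1 sa.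
have D0 : 0 < Num.min d1 (Num.min d2 (Num.min d4 (Num.min d5 (Num.min d6 (Num.min d7 d8))))).
  by rewrite !lt_min d10 d20 d40 d50 d60 d70.
have [x0 [x1 [+ + xx0 xx1 pE]]] := common_leaf sa ax D0.
rewrite !lt_min => /and5P[u1 u2 u4 u5 /and3P[u6 u7 u8]] /and5P[v1 v2 v4 v5 /and3P[v6 v7 v8]].
have dd d y : 0 < d -> `|(y : R) - y| < d by rewrite subrr normr0.
have su := (d8P _ u8).2 _ ax xx0; have sv := (d8P _ v8).2 _ ax xx1.
pose u : R * R := (x0, 0); pose v : R * R := (x1, 1).
have o1 : (u.1 < v.1) = ((h u).1 < (h v).1) by apply: d1P => //; exact: dd.
have o2 : (u.1 < v.1) = (0 < sg1 a * (s1 v.1 * (u.2 - v.2))).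
  by apply: d2P => //; rewrite normr0.
have hU : `|(h u).2 - Y0| < e by apply: d4P => //; exact: dd.
have hV : `|(h v).2 - Y1| < e by apply: d5P => //; exact: dd.
have uv : leaf p1 u v.
  apply/(leaf_strip _ t1); first exact: (same_strip_neq0 (same_strip_sym su)).
  by split=> //; exact: same_strip_trans (same_strip_sym su) sv.
have o3 : ((h u).1 < (h v).1) = (0 < sg2 (beta a) * (s2 (h v).1 * ((h u).2 - (h v).2))).
  apply: d3P.
  - by rewrite -(hb 0); apply: d6P => //; exact: dd.
  - by rewrite -(hb 1); apply: d7P => //; exact: dd.
  - have -> : (h u).2 = Y0 + ((h u).2 - Y0) by ring.
    by rewrite (le_trans (ler_normD _ _))// lerD2l ltW.
  - by apply/esym; move/hL/leaf_level : uv.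
have S1 : 0 < s1 x * s1 v.1 by exact: same_strip_sign sv.
have S2 : 0 < s2 (h (x, 0)).1 * s2 (h v).1.
  apply: same_strip_sign => //.
  by apply/(same_strip_keeps t1 t2 H K (x, 0) v).
rewrite o1 o3 -(sgE sa) /= sub0r mulrN1 in o2.
move: hU hV; rewrite !ltr_norml => /andP[hU1 hU2] /andP[hV1 hV2].
rewrite /rises -/Y0 -/Y1.
have sv0 : s1 v.1 != 0 by apply/eqP; exact: (same_strip_neq0 (same_strip_sym sv)).
have shv0 : s2 (h v).1 != 0.
  by apply/eqP; apply: (h_neq0 t1 t2 H); exact/eqP.
have sP := product_sign sgP sv0 shv0 S1 S2 (esym o2).
case: (ltgtP Y0 Y1) => // Y.
- have eE : e = (Y1 - Y0) / 2 by rewrite /e gtr0_norm ?subr_gt0.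
  by split=> // _; apply: sP.1; move: hU2 hV1 eE; clear -t1 t2 H K sgE; lra.
- have eE : e = (Y0 - Y1) / 2 by rewrite /e ltr0_norm ?subr_lt0// opprB.
  by split=> // xX; exfalso; apply: sP.2 xX; move: hU1 hV2 eE; clear -t1 t2 H K sgE; lra.
Qed.

(** Counterpart of [preserving] for heights: the clause at the zeros is what makes the property
    locally constant across them. *)
Definition heights_agree x :=
  (s1 x <> 0 /\ 0 < s1 x * s2 (h (x, 0)).1) \/ (s1 x = 0 /\ rises x).

Lemma heights_agree_const x y : heights_agree x -> heights_agree y.
Proof.
apply: locally_constant => {y}{}x; have [sx|/eqP sx] := eqVneq (s1 x) 0.
  have [d d0 dP] := adjacent_near t1 sx; exists d => // y yx.
  have [->//|/eqP yn] := eqVneq y x.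
  have xy := (dP y yx).1 yn; have sy := xy.1.
  have := height_sign sx xy; rewrite /heights_agree; tauto.
have [d d0 dP] := same_strip_near t1 sx; exists d => // y /dP xy.
have [rc sc _ _ _] := t1; have [rc2 sc2 _ _ _] := t2.
have S1 := same_strip_sign sc xy.
have S2 : 0 < s2 (h (x, 0)).1 * s2 (h (y, 0)).1.
  apply: same_strip_sign => //.
  by apply/(same_strip_keeps t1 t2 H K (x, 0) (y, 0)).
have : 0 < s1 x * s2 (h (x, 0)).1 <-> 0 < s1 y * s2 (h (y, 0)).1.
  by split=> p; have := mulr_gt0 S1 S2; rewrite mulrACA; [rewrite pmulr_rgt0|rewrite pmulr_lgt0].
have := same_strip_neq0 (same_strip_sym xy).
rewrite /heights_agree; tauto.
Qed.

End Heights.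

(** * Increasing bijections of the line *)

Section IncreasingBijections.
Variable R : realType.
Implicit Types (x y a b c d e m v : R) (f g k : R -> R) (l : seq R).

(** The increasing homeomorphisms of the line: continuity follows from monotonicity and
    surjectivity. *)
Definition increasing_bij f := {homo f : x y / x < y} /\ forall y, exists x, f x = y.

Lemma increasing_bij_mono f x y : increasing_bij f -> (f x < f y) = (x < y).
Proof.
move=> [fi _]; case: (ltgtP x y) => [/fi ->//|/fi yx|->]; last by rewrite ltxx.
by apply/negbTE; rewrite -leNgt ltW.
Qed.

Lemma increasing_bij_inv f : increasing_bij f ->
  exists2 g, increasing_bij g & cancel f g /\ cancel g f.
Proof.
move=> fP; have [fi fs] := fP; have [g gf] := choice fs.
have fg : cancel f g.
  by move=> x; have := gf (f x); case: (ltgtP (g (f x)) x) => [/fi lt eq|/fi lt eq|//];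
    rewrite eq ltxx in lt.
exists g => //; split; last by move=> x; exists (f x).
by move=> x y xy; rewrite -(increasing_bij_mono _ _ fP) !gf.
Qed.

Lemma increasing_bij_continuous f : increasing_bij f -> continuous f.
Proof.
move=> fP; have [g _ [fg gf]] := increasing_bij_inv fP; have fm := increasing_bij_mono _ _ fP.
apply/continuous_lineP => x e e0.
have xl : g (f x - e) < x by rewrite -fm gf; lra.
have xr : x < g (f x + e) by rewrite -fm gf; lra.
exists (Num.min (x - g (f x - e)) (g (f x + e) - x)); first by rewrite lt_min !subr_gt0 xl.
move=> y; rewrite lt_min => /andP[]; rewrite !ltr_norml => /andP[y1 _] /andP[_ y2].
have : f (g (f x - e)) < f y by rewrite fm; lra.
have : f y < f (g (f x + e)) by rewrite fm; lra.
by rewrite !gf => ? ?; apply/andP; split; lra.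
Qed.

Lemma increasing_bij_homeo f : increasing_bij f -> homeomorphism f.
Proof.
move=> fP; have [g gP [fg gf]] := increasing_bij_inv fP.
by exists g; split=> //; exact: increasing_bij_continuous.
Qed.

Lemma increasing_bij_glue f g a b : increasing_bij f -> increasing_bij g ->
  a < b -> f a < g b -> exists k, [/\ increasing_bij k,
    forall x, x <= a -> k x = f x & forall x, b <= x -> k x = g x].
Proof.
move=> fP gP ab fgab.
pose q := (g b - f a) / (b - a).
have ba : 0 < b - a by lra.
have q0 : 0 < q by rewrite divr_gt0//; lra.
have qE : q * (b - a) = g b - f a by rewrite divfK// gt_eqF.
pose k x := if x <= a then f x else if b <= x then g x else f a + q * (x - a).
have ka x : x <= a -> k x = f x by rewrite /k => ->.
have kb x : b <= x -> k x = g x.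
  by move=> bx; rewrite /k leNgt (lt_le_trans ab bx) bx.
have fm x y : x <= y -> f x <= f y.
  by rewrite le_eqVlt => /orP[/eqP->//|xy]; rewrite ltW// increasing_bij_mono.
have gm x y : x <= y -> g x <= g y.
  by rewrite le_eqVlt => /orP[/eqP->//|xy]; rewrite ltW// increasing_bij_mono.
exists k; split=> //; split=> [x y xy|y].
  rewrite /k; case: (leP x a) => xa; case: (leP y a) => ya.
  - by rewrite increasing_bij_mono.
  - have := fm _ _ xa; case: (leP b y) => yb.
      by have := gm _ _ yb; lra.
    have : 0 < q * (y - a) by rewrite mulr_gt0// subr_gt0.
    lra.
  - by have := lt_trans (lt_le_trans xy ya) xa; rewrite ltxx.
  - case: (leP b x) => xb; case: (leP b y) => yb.
    + by rewrite increasing_bij_mono.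
    + by have := lt_trans (le_lt_trans xb xy) yb; rewrite ltxx.
    + have := gm _ _ yb.
      have : 0 < q * (b - x) by rewrite mulr_gt0// subr_gt0.
      lra.
    + have : 0 < q * (y - x) by rewrite mulr_gt0// subr_gt0.
      lra.
case: (leP y (f a)) => ya.
  have [x fx] := fP.2 y; exists x; rewrite ka//.
  by rewrite leNgt -(increasing_bij_mono _ _ fP) fx -leNgt.
case: (leP (g b) y) => yb.
  have [x gx] := gP.2 y; exists x; rewrite kb//.
  by rewrite leNgt -(increasing_bij_mono _ _ gP) gx -leNgt.
exists (a + (y - f a) / q); rewrite /k.
have q1 : 0 < (y - f a) / q by rewrite divr_gt0// subr_gt0.
have q2 : (y - f a) / q < b - a by rewrite ltr_pdivrMr// mulrC qE; lra.
rewrite !ifF; [|apply/negbTE; rewrite -ltNge; lra|apply/negbTE; rewrite -ltNge; lra].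
by rewrite addrAC subrr add0r mulrC divfK ?gt_eqF//; lra.
Qed.

(** Supplies both the change of abscissa and the change of values. The induction glues the germ at
    the leftmost point to a bijection built for the remaining ones. *)
Lemma increasing_bij_germs l (w : R -> R) (G : R -> R -> R) : sorted <%R l ->
  {in l &, {homo w : x y / x < y}} ->
  {in l, forall v, increasing_bij (G v) /\ G v v = w v} ->
  exists2 f, increasing_bij f & {in l, forall v, exists2 d, 0 < d &
    forall x, `|x - v| < d -> f x = G v x}.
Proof.
elim: l => [|v l IH] ls wi GP.
  by exists id => //; split=> // y; exists y.
have [f fP fG] : exists2 f, increasing_bij f & {in l, forall v, exists2 d, 0 < d &
    forall x, `|x - v| < d -> f x = G v x}.
  apply: IH; first exact: path_sorted ls.
    by move=> x y xl yl; apply: wi; rewrite inE ?xl ?yl orbT.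
  by move=> x xl; apply: GP; rewrite inE xl orbT.
have [gP gv] := GP v (mem_head _ _).
case: l ls wi GP fG {IH} => [|v1 l] /=.
  move=> _ _ _ _; exists (G v) => // u; rewrite inE => /eqP ->.
  by exists 1.
move=> /andP[vv1 pl] wi GP fG.
have fv1 : f v1 = w v1.
  have [d d0 ->] := fG v1 (mem_head _ _); last by rewrite subrr normr0.
  by have [] := GP v1; rewrite ?inE ?eqxx ?orbT.
have ww : w v < w v1 by apply: wi; rewrite ?inE ?eqxx ?orbT.
(* Half the gap between the prescribed values, so that [G v] just right of [v] stays below [f] just
   left of [v1]. *)
pose e := (w v1 - w v) / 2.
have e0 : 0 < e by rewrite divr_gt0// subr_gt0.
have [d1 d10 d1P] := (continuous_lineP _).1 (increasing_bij_continuous gP) v e e0.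
have [d2 d20 d2P] := (continuous_lineP _).1 (increasing_bij_continuous fP) v1 e e0.
(* The factor 3 leaves room for the joining piece between [v + d] and [v1 - d]. *)
pose d := Num.min d1 (Num.min d2 (v1 - v)) / 3.
have d0 : 0 < d by rewrite divr_gt0// !lt_min d10 d20 subr_gt0.
have [dd1 dd2 dd3] : [/\ d < d1, d < d2 & d *+ 3 <= v1 - v].
  have /andP[m1 /andP[m2 m3]] : [&& Num.min d1 (Num.min d2 (v1 - v)) <= d1,
     Num.min d1 (Num.min d2 (v1 - v)) <= d2 & Num.min d1 (Num.min d2 (v1 - v)) <= v1 - v].
    by rewrite !ge_min !lexx !orbT.
  by rewrite /d in d0 *; split; lra.
have m1 := d1P (v + d) ltac:(by rewrite addrAC subrr add0r gtr0_norm).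
have m2 := d2P (v1 - d) ltac:(by rewrite addrAC subrr add0r normrN gtr0_norm).
move: m1 m2; rewrite gv fv1 !ltr_norml => /andP[_ m1] /andP[m2 _].
have [||k [kP kl kr]] := @increasing_bij_glue (G v) f (v + d) (v1 - d) gP fP.
- lra.
- rewrite /e in m1 m2; lra.
exists k => // u; rewrite inE => /orP[/eqP ->|ul].
  by exists d => // x; rewrite ltr_norml => /andP[_ xd]; apply: kl; lra.
have [d3 d30 d3P] := fG u ul.
have v1u : v1 <= u.
  move: ul; rewrite inE => /orP[/eqP ->//|ul].
  by have /allP/(_ u ul)/ltW := order_path_min lt_trans pl.
exists (Num.min d d3); first by rewrite lt_min d0.
move=> x; rewrite lt_min => /andP[xd xd3]; rewrite kr ?d3P//.
by move: xd; rewrite ltr_norml => /andP[+ _]; lra.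
Qed.

Lemma finite_sorted (Z : set R) : finite_set Z ->
  exists2 l, sorted <%R l & forall x, x \in l <-> Z x.
Proof.
move=> /finite_seqP[l ->]; exists (sort <=%R (undup l)).
  by rewrite sort_lt_sorted undup_uniq.
by move=> x; rewrite mem_sort mem_undup.
Qed.

Lemma increasing_bij_extend f a d : 0 < d -> continuous f ->
  (forall x y, `|x - a| < d -> `|y - a| < d -> x < y -> f x < f y) ->
  exists2 g, increasing_bij g & forall x, `|x - a| <= d / 2 -> g x = f x.
Proof.
move=> d0 fc fi.
pose b := a - d / 2; pose c := a + d / 2.
have bd x : b <= x <= c -> `|x - a| < d.
  by rewrite /b /c ltr_norml => /andP[? ?]; apply/andP; split; lra.
have bc : b < c by rewrite /b /c; lra.
have fi' x y : b <= x -> x < y -> y <= c -> f x < f y.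
  by move=> bx xy yc; apply: fi => //; apply: bd; lra.
pose g x := if x <= b then f b + (x - b) else if c <= x then f c + (x - c) else f x.
have fbc : f b < f c by apply: fi'; lra.
exists g; last first.
  move=> x; rewrite ler_norml /g /b /c => /andP[? ?].
  case: leP => h1; first by (have -> : x = a - d / 2 by lra); ring.
  by case: leP => // h2; (have -> : x = a + d / 2 by lra); ring.
split=> [x y xy|y].
  rewrite /g; case: (leP x b) => xb; case: (leP y b) => yb.
  - lra.
  - case: (leP c y) => yc; first lra.
    by have := fi' b y (lexx _) yb (ltW yc); lra.
  - lra.
  - case: (leP c x) => xc; case: (leP c y) => yc; try lra.
      by have := fi' x c (ltW xb) xc (lexx _); lra.
    by apply: fi'; lra.
case: (leP y (f b)) => yb.
  by exists (y - f b + b); rewrite /g ifT; [ring|lra].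
case: (leP (f c) y) => yc.
  exists (y - f c + c); rewrite /g ifF; last by apply/negbTE; rewrite -ltNge; lra.
  by rewrite ifT; [ring|lra].
have [x] : exists2 x, x \in `[b, c] & f x = y.
  apply: IVT; [exact: ltW|exact: continuous_subspaceT|].
  by rewrite ge_min le_max (ltW yb) (ltW yc) orbT.
rewrite in_itv /= => /andP[bx xc] fx; exists x; rewrite /g.
case: (leP x b) => xb; first by (have E : x = b by lra); rewrite E subrr addr0 -E.
case: (leP c x) => cx //; have E : x = c by lra.
by rewrite E subrr addr0 -E.
Qed.

End IncreasingBijections.

(** * Sliding along the leaves *)

Section Bend.
Variable R : realType.
Implicit Types (x y a b c d e m v K L u : R).

(* A Moebius map of [0, K] extended oddly: slope L at 0, fixes K, and the
   inverse for L is the map for L^-1. *)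
Definition bend L K u := if `|u| < K then L * K * u / (K + (L - 1) * `|u|) else u.

Lemma bend_denominator L K u : 0 < L -> `|u| < K -> 0 < K + (L - 1) * `|u|.
Proof.
move=> L0 uK; have u0 : 0 <= `|u| by [].
have : 0 <= L * `|u| by rewrite mulr_ge0// ltW.
have : L = 1 + (L - 1) by ring.
rewrite mulrBl mul1r; have [->|un] := eqVneq `|u| 0; first by rewrite mulr0; move: uK; lra.
lra.
Qed.

Lemma bend_norm L K u : 0 < L -> `|u| < K ->
  `|bend L K u| = L * K * `|u| / (K + (L - 1) * `|u|).
Proof.
move=> L0 uK; have D := bend_denominator L0 uK; rewrite /bend uK.
have K0 : 0 < K by exact: le_lt_trans uK.
by rewrite normrM normfV normrM normrM (gtr0_norm L0) (gtr0_norm K0) (gtr0_norm D).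
Qed.

Lemma bend_id L K u : K <= `|u| -> bend L K u = u.
Proof. by rewrite /bend ltNge => ->. Qed.

Lemma bend_lt L K u : 0 < L -> (`|bend L K u| < K) = (`|u| < K).
Proof.
move=> L0; have [uK|Ku] := ltP `|u| K; last by rewrite bend_id// ltNge Ku.
rewrite bend_norm// ltr_pdivrMr ?bend_denominator//.
have K0 : 0 < K by exact: le_lt_trans uK.
rewrite -mulrA [L * _]mulrCA ltr_pM2l//.
by rewrite mulrBl mul1r; lra.
Qed.

Lemma bendK L K u : 0 < L -> bend L^-1 K (bend L K u) = u.
Proof.
move=> L0; have [uK|Ku] := ltP `|u| K; last by rewrite !bend_id.
have buK : `|bend L K u| < K by rewrite bend_lt.
rewrite {1}/bend buK bend_norm// {1}/bend uK.
have D := bend_denominator L0 uK.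
have K0 : 0 < K by exact: le_lt_trans uK.
set n := `|u| in uK D *.
have n0 : 0 <= n by exact: normr_ge0.
have L0' : L != 0 by rewrite gt_eqF.
have E : K + (L^-1 - 1) * (L * K * n / (K + (L - 1) * n)) = K * K / (K + (L - 1) * n).
  by field; rewrite L0' gt_eqF.
rewrite E; field.
by rewrite L0' !gt_eqF.
Qed.

Lemma bend1 K u : bend 1 K u = u.
Proof.
rewrite /bend subrr mul0r addr0 mul1r; case: ltP => // uK.
have K0 : 0 < K by exact: le_lt_trans uK.
by rewrite mulrAC divff ?mul1r// gt_eqF.
Qed.

(** The minimum merges both cases into one formula, from which continuity across [|u| = K] is read
    off. *)
Lemma bend_min L K u : 0 < L -> 0 < K ->
  bend L K u = L * K * u / (K + (L - 1) * Num.min `|u| K).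
Proof.
move=> L0 K0; rewrite /bend; case: ltP => // uK.
have -> : K + (L - 1) * K = L * K by ring.
by rewrite mulrAC divff ?mul1r// mulf_neq0 // gt_eqF.
Qed.

(** With [A * B * D = 1 + q], the expansion of [q] has seven terms, each at most [m]. The bound
    [14^-1] gives [|q| <= 1/2], so dividing by [1 + q] at most doubles the error [7 * m]. *)
Lemma ratio_estimate A B D y m : 0 <= m -> m <= 14^-1 ->
  `|A - 1| <= m -> `|B - 1| <= m -> `|D - 1| <= m ->
  `|y / (A * B * D) - y| <= 14 * m * `|y|.
Proof.
move=> m0 m1 Am Bm Dm.
pose q := A * B * D - 1.
have qE : A * B * D = 1 + q by rewrite /q; ring.
have qm : `|q| <= 7 * m.
  have -> : q = (A - 1) + (B - 1) + (D - 1) + (A - 1) * (B - 1) + (A - 1) * (D - 1)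
     + (B - 1) * (D - 1) + (A - 1) * (B - 1) * (D - 1) by rewrite /q; ring.
  have M (u v n : R) : `|u| <= m -> `|v| <= n -> n <= 1 -> `|u * v| <= m.
    move=> um vn n1; rewrite normrM -[leRHS]mulr1 ler_pM//; exact: le_trans n1.
  have m1' : m <= 1 by rewrite (le_trans m1)// invf_le1//; lra.
  have h1 := M _ _ _ Am Bm m1'; have h2 := M _ _ _ Am Dm m1'; have h3 := M _ _ _ Bm Dm m1'.
  have h4 := M _ _ _ h1 Dm m1'.
  move: Am Bm Dm h1 h2 h3 h4; rewrite !ler_norml.
  do 7! move=> /andP[? ?].
  by apply/andP; split; lra.
have q1 : 2^-1 <= 1 + q by move: qm; rewrite ler_norml => /andP[? ?]; lra.
have q0 : 0 < 1 + q by apply: lt_le_trans q1; rewrite invr_gt0.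
have -> : y / (A * B * D) - y = - (y * q / (1 + q)) by rewrite qE; field; rewrite gt_eqF.
rewrite normrN normrM normfV (gtr0_norm q0) normrM ler_pdivrMr//.
have h1 : `|y| * `|q| <= `|y| * (7 * m) by rewrite ler_wpM2l.
have h2 : 14 * m * `|y| * 2^-1 <= 14 * m * `|y| * (1 + q).
  by rewrite ler_wpM2l// mulr_ge0// mulr_ge0.
lra.
Qed.

End Bend.

Section Slide.
Variable R : realType.
Implicit Types (x y a b c d e t n : R) (r s : R -> R) (z w : R * R).

(** The functions [s1] and [s2] differ only within [n / 2] of [a], while [r] is affine within [n];
    the margin is where [slide] returns to the identity. *)
Record slidable r s1 s2 (o a n : R) : Prop := Slidable {
  slide_r : continuous r;
  slide_s1 : continuous s1;
  slide_s2 : continuous s2;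
  slide_n0 : 0 < n;
  slide_o : o = 1 \/ o = -1;
  slide_s1a : s1 a = 0;
  slide_s2a : s2 a = 0;
  slide_flat1 : flat_at s1 a;
  slide_flat2 : flat_at s2 a;
  slide_affine : forall x, `|x - a| < n -> r x = r a + o * (x - a);
  slide_pos : forall x, x <> a -> `|x - a| < n -> 0 < s1 x * s2 x;
  slide_far : forall x, n / 2 <= `|x - a| -> s1 x = s2 x }.

Lemma slidable_sym r s1 s2 o a n : slidable r s1 s2 o a n -> slidable r s2 s1 o a n.
Proof.
move=> [*]; split=> //.
  by move=> x xa xn; rewrite mulrC; auto.
by move=> x xn; apply/esym; auto.
Qed.

(** Here [a + t] is where the leaf meets height 0. The default 1 agrees with the quotient as soon as
    [n / 2 <= |t|]. At [t = 0] the quotient is a division by zero, but the window used in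
    [slide_fst] is then empty. *)
Definition slide_ratio s1 s2 a n t := if `|t| < n then s2 (a + t) / s1 (a + t) else 1.

(** The window of radius [|t| / 2] around [a + t] avoids [a], so a point never crosses the vertical
    line, and it shrinks as the leaf approaches that line. *)
Definition slide_fst s1 s2 a n t x := a + t + bend (slide_ratio s1 s2 a n t) (`|t| / 2) (x - a - t).

(* Within the leaf of value [c], [slide] fixes the point at height 0, of abscissa
   [a + t], and stretches by [s2 / s1] around it: near the line [x = a] the height
   [(c - r x) / s x] is then unchanged in the limit, although [s1] and [s2] may
   vanish at different rates. *)
Definition slide r s1 s2 (o a n : R) z :=
  let c := linear_like r s1 z in
  let x := slide_fst s1 s2 a n (o * (c - r a)) z.1 in
  if (z.1 == a) || (n <= `|z.1 - a|) then z else (x, (c - r x) / s2 x).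

Section Properties.
Variables (r s1 s2 : R -> R) (o a n : R).
Hypothesis S : slidable r s1 s2 o a n.

Lemma slide_nz x : x <> a -> `|x - a| < n -> s1 x != 0 /\ s2 x != 0.
Proof.
move=> xa xn; have := slide_pos S xa xn.
by split; apply/eqP => s0; move: H; rewrite s0 ?mul0r ?mulr0 ltxx.
Qed.

Lemma slide_ratio_gt0 t : t <> 0 -> 0 < slide_ratio s1 s2 a n t.
Proof.
move=> t0; rewrite /slide_ratio; case: (ltP `|t| n) => // tn.
have ata : a + t <> a by move/eqP; rewrite -subr_eq0 addrAC subrr add0r => /eqP.
have atn : `|a + t - a| < n by rewrite addrAC subrr add0r.
have := slide_pos S ata atn; have [s10 s20] := slide_nz ata atn.
have -> : s2 (a + t) / s1 (a + t) = (s1 (a + t) * s2 (a + t)) / (s1 (a + t) ^+ 2).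
  by field.
by move=> p; rewrite divr_gt0// exprn_even_gt0.
Qed.

Lemma slide_ratio1 t : n / 2 <= `|t| -> slide_ratio s1 s2 a n t = 1.
Proof.
move=> nt; rewrite /slide_ratio; case: (ltP `|t| n) => // tn.
have n0 := slide_n0 S.
have ata : a + t <> a.
  move/eqP; rewrite -subr_eq0 addrAC subrr add0r => /eqP t0.
  by move: nt; rewrite t0 normr0; lra.
have atn : `|a + t - a| < n by rewrite addrAC subrr add0r.
have [s10 _] := slide_nz ata atn.
by rewrite -(slide_far S) ?divff// addrAC subrr add0r.
Qed.

Lemma slide_ratioV t : slide_ratio s2 s1 a n t = (slide_ratio s1 s2 a n t)^-1.
Proof. by rewrite /slide_ratio; case: ifP; rewrite ?invr1// invf_div. Qed.

Lemma slide_fst0 x : slide_fst s1 s2 a n 0 x = x.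
Proof. by rewrite /slide_fst bend_id ?normr0 ?mul0r//; ring. Qed.

Lemma slide_fst_far t x : n / 2 <= `|t| -> slide_fst s1 s2 a n t x = x.
Proof. by move=> tn; rewrite /slide_fst slide_ratio1// bend1; ring. Qed.

Lemma slide_fst_id t x : `|t| / 2 <= `|x - a - t| -> slide_fst s1 s2 a n t x = x.
Proof. by move=> tx; rewrite /slide_fst bend_id//; ring. Qed.

Lemma slide_fst_bounds t x : x <> a -> `|x - a| < n ->
  slide_fst s1 s2 a n t x <> a /\ `|slide_fst s1 s2 a n t x - a| < n.
Proof.
move=> xa xn; have n0 := slide_n0 S.
have [->|/eqP t0] := eqVneq t 0; first by rewrite slide_fst0.
have [tn|tn] := leP (n / 2) `|t|; first by rewrite slide_fst_far.
have [tx|tx] := leP (`|t| / 2) `|x - a - t|; first by rewrite slide_fst_id.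
set u := bend (slide_ratio s1 s2 a n t) (`|t| / 2) (x - a - t).
have ut : `|u| < `|t| / 2 by rewrite bend_lt//; exact: slide_ratio_gt0.
have -> : slide_fst s1 s2 a n t x = a + (t + u) by rewrite /slide_fst addrA.
split.
  move/eqP; rewrite -subr_eq0 addrAC subrr add0r addr_eq0 => /eqP tu.
  by move: ut; rewrite tu normrN; have := normr_ge0 u; lra.
rewrite addrAC subrr add0r (le_lt_trans (ler_normD _ _))//; lra.
Qed.

Lemma slide_fstK t x : slide_fst s2 s1 a n t (slide_fst s1 s2 a n t x) = x.
Proof.
have [->|/eqP t0] := eqVneq t 0; first by rewrite slide_fst0 /slide_fst bend_id ?normr0 ?mul0r//; ring.
rewrite /slide_fst slide_ratioV.
set u := bend (slide_ratio s1 s2 a n t) _ _; have -> : a + t + u - a - t = u by ring.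
by rewrite /u bendK; [ring|exact: slide_ratio_gt0].
Qed.

Lemma slide_value z : linear_like r s2 (slide r s1 s2 o a n z) = linear_like r s1 z.
Proof.
rewrite /slide; case: eqVneq => [za|/eqP za] /=.
  by rewrite /linear_like za (slide_s1a S) (slide_s2a S) !mul0r.
have n0 := slide_n0 S.
case: leP => zn; first by rewrite /linear_like (slide_far S)//; lra.
have [xa xn] := slide_fst_bounds (o * (linear_like r s1 z - r a)) za zn.
have [_ /eqP s20] := slide_nz xa xn.
exact: linear_like_solveK.
Qed.

Lemma slideK : cancel (slide r s1 s2 o a n) (slide r s2 s1 o a n).
Proof.
move=> z; rewrite {1}/slide slide_value.
rewrite /slide; case: (eqVneq z.1 a) => [za|/eqP za] /=; first by rewrite za eqxx.
case: (leP n `|z.1 - a|) => zn; first by rewrite zn orbT.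
set t := o * _; have [xa xn] := slide_fst_bounds t za zn.
rewrite leNgt xn orbF; move/eqP/negbTE: (xa) => -> /=.
rewrite slide_fstK; have [/eqP s10 _] := slide_nz za zn.
by rewrite -(linear_like_solve s10 (erefl : linear_like r s1 (z.1, z.2) = _)) -surjective_pairing.
Qed.

Lemma slide_id z : n * (3 / 4) < `|z.1 - a| -> slide r s1 s2 o a n z = z.
Proof.
move=> zn; rewrite /slide; case: ifP => // /negbT; rewrite negb_or -ltNge => /andP[/eqP za zn'].
have n0 := slide_n0 S.
set t := o * _.
have -> : slide_fst s1 s2 a n t z.1 = z.1.
  have [tn|tn] := leP (n / 2) `|t|; first by rewrite slide_fst_far.
  apply: slide_fst_id.
  have : `|z.1 - a| <= `|z.1 - a - t| + `|t|.
    by rewrite -{1}(subrK t (z.1 - a)); exact: ler_normD.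
  lra.
have [_ /eqP s20] := slide_nz za zn'.
rewrite {1}/linear_like (slide_far S); last lra.
by rewrite -(linear_like_solve s20 (erefl : linear_like r s2 (z.1, z.2) = _)) -surjective_pairing.
Qed.

(** Gives continuity at the vertical line. By flatness [x] differs from [a + t] by some [u] small
    against [|x - a|]. The new height is [y] divided by three factors close to 1: the ratios of [s1]
    and of [s2] at neighbouring points, and the normalized denominator [D] of [bend]. The constant
    140 is the 14 of [ratio_estimate] times the tolerance 10 allowed for [D]. *)
Lemma slide_estimate e B d z : 0 < e -> 0 < B -> e * B <= 140^-1 -> d <= n ->
  (forall x y, `|x - a| < d -> `|y - a| < d -> `|s1 x - s1 y| <= e * `|x - y|) ->
  (forall x y, `|x - a| < d -> `|y - a| < d -> `|s2 x - s2 y| <= e * `|x - y|) ->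
  z.1 <> a -> `|z.1 - a| < d / 2 -> `|z.2| <= B ->
  `|(slide r s1 s2 o a n z).1 - z.1| <= 3 * `|z.1 - a| /\
  `|(slide r s1 s2 o a n z).2 - z.2| <= 140 * (e * B) * `|z.2|.
Proof.
move=> e0 B0 eB dn f1 f2 za zd zB.
have n0 := slide_n0 S.
set x := z.1 in za zd *; set y := z.2 in zB *.
set X := `|x - a| in zd *.
have X0 : 0 < X by rewrite normr_gt0 subr_eq0; exact/eqP.
have d0 : 0 < d by lra.
have xn : `|x - a| < n by rewrite -/X; lra.
have oo : o * o = 1 by case: (slide_o S) => ->; ring.
have o1 : `|o| = 1 by case: (slide_o S) => ->; rewrite ?normrN normr1.
set m := e * B in eB *.
have m0 : 0 < m by rewrite mulr_gt0.
have [sx0 _] := slide_nz za xn.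
set sx := s1 x in sx0 *.
have asx0 : 0 < `|sx| by rewrite normr_gt0.
have sxX : `|sx| <= e * X.
  have := f1 x a; rewrite (slide_s1a S) subr0 subrr normr0 => /(_ _ d0); apply; rewrite -/X; lra.
set c := linear_like r s1 z.
have cE : c = r a + o * (x - a) + sx * y by rewrite /c /linear_like -/x (slide_affine S xn).
set t := o * (c - r a).
pose u := x - a - t.
have uE : u = - (o * sx * y).
  have -> : u = (1 - o * o) * (x - a) - o * sx * y by rewrite /u /t cE; ring.
  by rewrite oo subrr mul0r add0r.
have un : `|u| = `|sx| * `|y| by rewrite uE normrN !normrM o1 mul1r.
have y0 : 0 <= `|y| by [].
have usx : `|u| <= `|sx| * B by rewrite un ler_wpM2l// ltW.
have eu : e * `|u| <= m * `|sx|.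
  by rewrite /m -mulrA [B * _]mulrC ler_pM2l.
have uX : `|u| <= m * X.
  by apply: le_trans usx _; rewrite /m mulrAC ler_wpM2r// ltW.
have mX : m * X <= X / 140 by rewrite mulrC ler_wpM2l// ltW.
have tE : t = x - a - u by rewrite /u; ring.
have tX1 : X <= `|t| + `|u|.
  have -> : X = `|t + u| by rewrite tE /X; congr (`|_|); ring.
  exact: ler_normD.
have tX2 : `|t| <= X + `|u| by rewrite tE (le_trans (ler_normB _ _)).
have t0 : t <> 0 by move=> t0; move: tX1; rewrite t0 normr0; move: uX mX X0; clear -S; lra.
have tn : `|t| < n by move: tX2 uX mX X0 zd dn; clear -S; lra.
pose K := `|t| / 2.
have K0 : 0 < K by move: tX1 uX mX X0; rewrite /K; clear -S; lra.
have uK : `|u| < K by move: tX1 uX mX X0; rewrite /K; clear -S; lra.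
set L := slide_ratio s1 s2 a n t.
have L0 : 0 < L by exact: slide_ratio_gt0.
have ata : a + t <> a by move/eqP; rewrite -subr_eq0 addrAC subrr add0r => /eqP.
have atE : a + t - a = t by ring.
have atn : `|a + t - a| < n by rewrite atE.
have atd : `|a + t - a| < d by rewrite atE; move: tX2 uX mX X0 zd; clear -S; lra.
have [A0 S0] := slide_nz ata atn.
have LE : L = s2 (a + t) / s1 (a + t) by rewrite /L /slide_ratio tn.
set A := s1 (a + t) in A0 LE *; set C := s2 (a + t) in S0 LE *.
have aA0 : 0 < `|A| by rewrite normr_gt0.
have aC0 : 0 < `|C| by rewrite normr_gt0.
have sxA : `|A - sx| <= m * `|sx|.
  rewrite distrC; apply: le_trans eu.
  have -> : `|u| = `|x - (a + t)| by rewrite /u; congr (`|_|); ring.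
  by apply: f1 => //; rewrite -/X; move: zd d0; clear -S; lra.
have msx : m * `|sx| <= `|sx| / 140 by rewrite mulrC ler_wpM2l// ltW.
have sx2A : `|sx| <= 2 * `|A|.
  have : `|sx| <= `|A| + `|A - sx|.
    by rewrite distrC -{1}(subrKC A sx); exact: ler_normD.
  by move: msx sxA aA0; clear -S; lra.
have Ct : `|C| <= e * `|t|.
  by have := f2 (a + t) a atd; rewrite (slide_s2a S) subr0 atE subrr normr0; apply.
(* The ratio [L] turns the bound on [u] by [s1] into a bound by [s2], which the flatness of [s2]
   makes small against [|t|]. *)
have Lu : L * `|u| <= 2 * (B * `|C|).
  have -> : L = `|C| / `|A| by rewrite -[LHS]gtr0_norm// LE normrM normfV.
  rewrite mulrAC ler_pdivrMr//.
  have uA : `|u| <= 2 * `|A| * B by apply: le_trans usx _; rewrite ler_wpM2r// ltW.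
  by move: (ler_wpM2l (ltW aC0) uA); clear -S; lra.
have LuK : L * `|u| <= 4 * m * K.
  by move: (ler_wpM2l (ltW B0) Ct) Lu; rewrite /K /m; clear -S; lra.
have uK3 : `|u| <= 3 * m * K.
  have XK : X <= 3 * K by move: tX1 uX mX X0; rewrite /K; clear -S; lra.
  by move: (ler_wpM2l (ltW m0) XK) uX; clear -S; lra.
have m1 : 10 * m <= 14^-1 by move: eB; clear -S; lra.
pose D := (K + (L - 1) * `|u|) / K.
have Dm : `|D - 1| <= 10 * m.
  have -> : D - 1 = (L * `|u| - `|u|) / K by rewrite /D; field; rewrite gt_eqF.
  rewrite normrM normfV (gtr0_norm K0) ler_pdivrMr//.
  have mK : 0 < m * K by rewrite mulr_gt0.
  have Lu0 : 0 <= L * `|u| by rewrite mulr_ge0// ltW.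
  have uu : 0 <= `|u| by [].
  by rewrite ler_norml; apply/andP; split; move: LuK uK3 Lu0 uu mK; clear -S; lra.
have D2 : 2^-1 <= D.
  by move: Dm m1; clear -S; rewrite ler_norml => /andP[? ?] ?; lra.
have D0 : 0 < D by apply: lt_le_trans D2; rewrite invr_gt0.
pose v := bend L K u.
have vK : `|v| < K by rewrite bend_lt.
have vE : v = L * u / D.
  rewrite /v /bend uK /D; field.
  by rewrite gt_eqF// gt_eqF// bend_denominator.
have vC : `|v| <= 4 * (B * `|C|).
  rewrite vE normrM normfV normrM (gtr0_norm L0) (gtr0_norm D0) ler_pdivrMr//.
  have BC0 : 0 <= B * `|C| by rewrite mulr_ge0// ltW.
  by move: (ler_wpM2l BC0 D2) Lu; clear -S; lra.
set T := slide_fst s1 s2 a n t x.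
have TE : T = a + t + v by [].
have TaE : T - a = t + v by rewrite TE; ring.
have Td : `|T - a| < d.
  by rewrite TaE (le_lt_trans (ler_normD _ _))//; move: vK tX2 uX mX zd X0; rewrite /K; clear -S; lra.
have [Ta Tn] := slide_fst_bounds t za xn.
have [_ E0] := slide_nz Ta Tn; rewrite -/T in Ta Tn E0.
set E := s2 T in E0.
have EC : `|E - C| <= 4 * m * `|C|.
  have := f2 T (a + t) Td atd; have -> : T - (a + t) = v by rewrite TE; ring.
  by move/le_trans; apply; move: (ler_wpM2l (ltW e0) vC); rewrite /m; clear -S; lra.
have -> : slide r s1 s2 o a n z = (T, (c - r T) / E).
  by rewrite /slide -/c -/t -/x -/T ifF//; apply/negbTE; rewrite negb_or -ltNge xn andbT; exact/eqP.
rewrite /=; split.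
  have -> : T - x = v - u by rewrite TE /u; ring.
  by rewrite (le_trans (ler_normB _ _))//; move: vK uK tX2 uX mX X0; rewrite /K; clear -S; lra.
have -> : (c - r T) / E = y / ((A / sx) * (E / C) * D).
  rewrite (slide_affine S Tn) -/T TaE vE.
  have -> : c - (r a + o * (t + L * u / D)) = L * sx * y / D.
    have -> : c - (r a + o * (t + L * u / D)) = (1 - o * o) * (c - r a) + (o * o) * (L * sx * y / D).
      by rewrite uE /t; ring.
    by rewrite oo subrr mul0r add0r mul1r.
  rewrite LE; field.
  by rewrite A0 E0 S0 sx0 gt_eqF.
have -> : 140 * m * `|y| = 14 * (10 * m) * `|y| by ring.
apply: ratio_estimate => //; first by rewrite mulr_ge0// ltW.
  have -> : A / sx - 1 = (A - sx) / sx by field.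
  rewrite normrM normfV ler_pdivrMr//; move: (mulr_gt0 m0 asx0) sxA; clear -S; lra.
have -> : E / C - 1 = (E - C) / C by field.
rewrite normrM normfV ler_pdivrMr//; move: (mulr_gt0 m0 aC0) EC; clear -S; lra.
Qed.

Lemma cvg_near (T U : topologicalType) (f g : T -> U) (q : T) (l : U) :
  (\forall p \near q, f p = g p) -> g p @[p --> q] --> l -> f p @[p --> q] --> l.
Proof.
move=> fg gl V /gl /= gV.
have : nbhs q ((fun p => f p = g p) `&` (g @^-1` V)) by exact: filterI.
by apply: filterS => p [/= fgp]; rewrite /preimage /= fgp.
Qed.

Lemma continuous_near (T U : topologicalType) (f g : T -> U) (q : T) :
  (\forall p \near q, f p = g p) -> {for q, continuous g} -> {for q, continuous f}.
Proof.
move=> fg gc; have fgq : f q = g q by exact: (nbhs_singleton fg).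
have fl : f p @[p --> q] --> g q by exact: cvg_near fg gc.
by move=> V; rewrite fgq => /fl.
Qed.

Lemma slide_ratio_continuous t : t <> 0 -> {for t, continuous (slide_ratio s1 s2 a n)}.
Proof.
move=> t0; have n0 := slide_n0 S.
have [tn|tn] := ltP `|t| n.
  have ata : a + t <> a by move/eqP; rewrite -subr_eq0 addrAC subrr add0r => /eqP.
  have atE : a + t - a = t by ring.
  have atn : `|a + t - a| < n by rewrite atE.
  have [A0 S0] := slide_nz ata atn.
  have E : \forall u \near t, slide_ratio s1 s2 a n u = s2 (a + u) / s1 (a + u).
    apply/nbhs_lineP; exists (n - `|t|); first by rewrite subr_gt0.
    move=> u ut; rewrite /slide_ratio ifT//.
    by rewrite -(subrK t u) (le_lt_trans (ler_normD _ _))//; lra.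
  have at' : a + u @[u --> t] --> a + t by apply: cvgD; [exact: cvg_cst|exact: cvg_id].
  have q : s2 (a + u) / s1 (a + u) @[u --> t] --> s2 (a + t) / s1 (a + t).
    apply: cvgM; first by apply: (cvg_comp _ _ at'); exact: (slide_s2 S).
    by apply: cvgV => //; apply: (cvg_comp _ _ at'); exact: (slide_s1 S).
  exact: continuous_near E q.
have E : \forall u \near t, slide_ratio s1 s2 a n u = 1.
  apply/nbhs_lineP; exists (n / 2); first by rewrite divr_gt0.
  move=> u ut; apply: slide_ratio1.
  have : `|t| <= `|u| + `|u - t|.
    by rewrite distrC -{1}(subrKC u t); exact: ler_normD.
  lra.
by apply: (continuous_near E); exact: cvg_cst.
Qed.

Lemma slide_time_continuous : continuous (fun w => o * (linear_like r s1 w - r a)).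
Proof.
move=> z; apply: cvgM; first exact: cvg_cst.
apply: cvgB; last exact: cvg_cst.
exact: linear_like_continuous (slide_r S) (slide_s1 S) z.
Qed.

Lemma slide_fst_continuous z : z.1 <> a ->
  slide_fst s1 s2 a n (o * (linear_like r s1 w - r a)) w.1 @[w --> z] -->
  slide_fst s1 s2 a n (o * (linear_like r s1 z - r a)) z.1.
Proof.
move=> za.
pose T w := o * (linear_like r s1 w - r a).
rewrite -/(T z).
have Tc : T w @[w --> z] --> T z by exact: slide_time_continuous.
have xc : w.1 @[w --> z] --> z.1 by exact: cvg_fst.
pose U w := w.1 - a - T w.
have Uc : U w @[w --> z] --> U z by apply: cvgB => //; apply: cvgB => //; exact: cvg_cst.
have aU : `|U w| @[w --> z] --> `|U z| by exact: cvg_norm.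
have Kc : `|T w| / 2 @[w --> z] --> `|T z| / 2.
  by apply: cvgM; [exact: cvg_norm|exact: cvg_cst].
have [far|] := ltP (`|T z| / 2) `|U z|.
  have dc : `|U w| - `|T w| / 2 @[w --> z] --> `|U z| - `|T z| / 2 by exact: cvgB.
  have d0 : 0 < `|U z| - `|T z| / 2 by rewrite subr_gt0.
  have E : \forall w \near z, slide_fst s1 s2 a n (T w) w.1 = w.1.
    have pos : \forall w \near z, 0 < `|U w| - `|T w| / 2 by exact: cvgr_gt dc _ d0.
    apply: filterS pos => w; rewrite subr_gt0 => dw.
    by apply: slide_fst_id; exact: ltW.
  rewrite slide_fst_id; last exact: ltW.
  exact: cvg_near E xc.
(* Inside the window or on its boundary [T z = 0] would give [z.1 = a]; so [T] is nonzero near [z]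
   and the single formula of [bend_min] applies. *)
move=> near.
have Tz0 : T z != 0.
  apply/eqP => Tz; move: near; rewrite Tz normr0 mul0r normr_le0 /U Tz subr0 subr_eq0 => /eqP.
  exact: za.
have Kz0 : 0 < `|T z| / 2 by rewrite divr_gt0// normr_gt0.
have Tn0 : \forall w \near z, T w != 0 by exact: cvgr_neq0 Tc Tz0.
pose F w := a + T w + slide_ratio s1 s2 a n (T w) * (`|T w| / 2) * U w /
  (`|T w| / 2 + (slide_ratio s1 s2 a n (T w) - 1) * Num.min `|U w| (`|T w| / 2)).
have FE w : T w != 0 -> slide_fst s1 s2 a n (T w) w.1 = F w.
  move=> Tw; rewrite /slide_fst bend_min//; last by rewrite divr_gt0// normr_gt0.
  by apply: slide_ratio_gt0; exact/eqP.
rewrite FE//; apply: (cvg_near (g := F)); first by apply: filterS Tn0 => w; exact: FE.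
have Lc : slide_ratio s1 s2 a n (T w) @[w --> z] --> slide_ratio s1 s2 a n (T z).
  by apply: (cvg_comp _ _ Tc); apply: slide_ratio_continuous; exact/eqP.
have L0 : 0 < slide_ratio s1 s2 a n (T z) by apply: slide_ratio_gt0; exact/eqP.
have mc : Num.min `|U w| (`|T w| / 2) @[w --> z] --> Num.min `|U z| (`|T z| / 2).
  exact: (continuous_min aU Kc).
apply: cvgD; first by apply: cvgD => //; exact: cvg_cst.
apply: cvgM; first by apply: cvgM => //; exact: cvgM.
apply: cvgV; last first.
  by apply: cvgD => //; apply: cvgM => //; apply: cvgB => //; exact: cvg_cst.
have m0 : 0 <= Num.min `|U z| (`|T z| / 2) by rewrite le_min normr_ge0 ltW.
have mK : Num.min `|U z| (`|T z| / 2) <= `|T z| / 2 by rewrite ge_min lexx orbT.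
rewrite gt_eqF//.
move: m0 mK; set m := Num.min _ _; set K := _ / 2 in Kz0 *; set L := slide_ratio _ _ _ _ _ in L0 * => m0 mK.
have : 0 <= L * m by rewrite mulr_ge0// ltW.
have [mKe|mKn] := eqVneq m K.
  have -> : K + (L - 1) * m = L * K by rewrite mKe; ring.
  by rewrite mulr_gt0.
have {}mK : m < K by rewrite lt_neqAle mKn.
by rewrite mulrBl mul1r; lra.
Qed.

Lemma slide_continuous_off z : z.1 <> a -> {for z, continuous (slide r s1 s2 o a n)}.
Proof.
move=> za; have n0 := slide_n0 S.
have [zn|zn] := leP n `|z.1 - a|.
  have E : \forall w \near z, slide r s1 s2 o a n w = w.
    apply/nbhs_planeP; exists (n / 8); first by rewrite divr_gt0.
    move=> w wz _; apply: slide_id.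
    have : `|z.1 - a| <= `|w.1 - a| + `|w.1 - z.1|.
      rewrite [`|w.1 - z.1|]distrC; have -> : z.1 - a = (w.1 - a) + (z.1 - w.1) by ring.
      exact: ler_normD.
    lra.
  by apply: (continuous_near E); exact: cvg_id.
pose X w := slide_fst s1 s2 a n (o * (linear_like r s1 w - r a)) w.1.
have Xc : X w @[w --> z] --> X z by exact: slide_fst_continuous.
pose F w := (X w, (linear_like r s1 w - r (X w)) / s2 (X w)).
have E : \forall w \near z, slide r s1 s2 o a n w = F w.
  have x0 : 0 < `|z.1 - a| by rewrite normr_gt0 subr_eq0; exact/eqP.
  apply/nbhs_planeP; exists (Num.min `|z.1 - a| (n - `|z.1 - a|)).
    by rewrite lt_min x0 subr_gt0.
  move=> w; rewrite lt_min => /andP[w1 w2] _; rewrite /slide ifF//.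
  apply/negbTE; rewrite negb_or -ltNge; apply/andP; split.
    by apply/eqP => wa; rewrite wa distrC ltxx in w1.
  have -> : w.1 - a = (w.1 - z.1) + (z.1 - a) by ring.
  by rewrite (le_lt_trans (ler_normD _ _))//; lra.
have [Xa Xn] := slide_fst_bounds (o * (linear_like r s1 z - r a)) za zn.
have [_ s20] := slide_nz Xa Xn.
have F2 : (linear_like r s1 w - r (X w)) / s2 (X w) @[w --> z] -->
    (linear_like r s1 z - r (X z)) / s2 (X z).
  apply: cvgM.
    apply: cvgB; first exact: linear_like_continuous (slide_r S) (slide_s1 S) z.
    by apply: (cvg_comp _ _ Xc); exact: (slide_r S).
  by apply: cvgV => //; apply: (cvg_comp _ _ Xc); exact: (slide_s2 S).
have Fc : F w @[w --> z] --> F z by exact: (cvg_pair Xc F2).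
exact: (continuous_near E Fc).
Qed.

Lemma slide_continuous_at z : z.1 = a -> {for z, continuous (slide r s1 s2 o a n)}.
Proof.
move=> za U; have n0 := slide_n0 S.
have -> : slide r s1 s2 o a n z = z by rewrite /slide za eqxx.
move=> /nbhs_planeP[e e0 eU].
pose B := `|z.2| + 1.
have B1 : 1 <= B by rewrite lerDr.
have B0 : 0 < B by lra.
(* The first bound meets the hypothesis of [slide_estimate]; the second makes the height error
   [140 * (q * B) * B] at most [e / 2]. *)
pose q := Num.min (B * 140)^-1 (e / (B * B * 280)).
have B140 : 0 < B * 140 by apply: mulr_gt0 => //; rewrite ltr0n.
have BB : 0 < B * B * 280 by apply: mulr_gt0; [exact: mulr_gt0|rewrite ltr0n].
have q0 : 0 < q by rewrite lt_min invr_gt0 B140 divr_gt0.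
have qB : q * B <= 140^-1.
  have qi : q <= (B * 140)^-1 by rewrite ge_min lexx.
  apply: le_trans (ler_wpM2r (ltW B0) qi) _.
  by rewrite invfM mulrAC mulVf ?mul1r// gt_eqF.
have qBB : 140 * (q * B) * B <= e / 2.
  have : q <= e / (B * B * 280) by rewrite ge_min lexx orbT.
  by rewrite ler_pdivlMr//; lra.
have [d1 d10 f1] := slide_flat1 S q0; have [d2 d20 f2] := slide_flat2 S q0.
pose d := Num.min n (Num.min d1 d2).
have d0 : 0 < d by rewrite !lt_min n0 d10.
(* The quarter of [e] absorbs a displacement of at most three times the distance to the line, plus
   that distance itself. *)
pose d' := Num.min (d / 2) (Num.min (e / 4) (Num.min 1 (e / 2))).
have d'0 : 0 < d' by rewrite !lt_min ltr01 !divr_gt0.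
apply/nbhs_planeP; exists d' => // w.
rewrite !lt_min za => /and4P[w1 w2 w3 w4] /and4P[v1 v2 v3 v4].
have wB : `|w.2| <= B.
  by rewrite -(subrKC z.2 w.2) (le_trans (ler_normD _ _))// lerD2l ltW.
have [wa|/eqP wa] := eqVneq w.1 a.
  have -> : (slide r s1 s2 o a n @^-1` U) w = U w by rewrite /preimage /= /slide wa eqxx.
  by apply: eU; rewrite ?za; move: w4 v4 e0; clear -S; lra.
have [|||h1 h2] := @slide_estimate q B d w q0 B0 qB _ _ _ wa w1 wB.
- by rewrite ge_min lexx.
- by move=> x y; rewrite !lt_min => /and3P[_ ? _] /and3P[_ ? _]; exact: f1.
- by move=> x y; rewrite !lt_min => /and3P[_ _ ?] /and3P[_ _ ?]; exact: f2.
apply: eU.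
  rewrite za; have -> : (slide r s1 s2 o a n w).1 - a = ((slide r s1 s2 o a n w).1 - w.1) + (w.1 - a) by ring.
  by rewrite (le_lt_trans (ler_normD _ _))//; lra.
have -> : (slide r s1 s2 o a n w).2 - z.2 = ((slide r s1 s2 o a n w).2 - w.2) + (w.2 - z.2) by ring.
rewrite (le_lt_trans (ler_normD _ _))//.
have : 140 * (q * B) * `|w.2| <= 140 * (q * B) * B.
  by rewrite ler_wpM2l// !mulr_ge0// ltW.
lra.
Qed.

Lemma slide_continuous : continuous (slide r s1 s2 o a n).
Proof.
move=> z; have [/slide_continuous_at//|/eqP] := eqVneq z.1 a.
exact: slide_continuous_off.
Qed.

End Properties.

Lemma slide_equiv r s1 s2 o a n : slidable r s1 s2 o a n ->
  equiv_functions (linear_like r s1) (linear_like r s2).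
Proof.
move=> S; exists (slide r s1 s2 o a n), id; split.
- exists (slide r s2 s1 o a n); split.
  + exact: slideK.
  + exact: slideK (slidable_sym S).
  + exact: slide_continuous.
  + exact: slide_continuous (slidable_sym S).
- by exists id; split=> // x; exact: cvg_id.
- by apply/funext => z /=; rewrite slide_value.
Qed.
End Slide.

(** * Functions with the same combinatorial data *)

Section Construction.
Variable R : realType.
Implicit Types (x y a b c d e t n : R) (r s o : R -> R) (z w : R * R) (p q : R * R -> R).

Lemma homeomorphism_comp (T U V : topologicalType) (f : T -> U) (g : U -> V) :
  homeomorphism f -> homeomorphism g -> homeomorphism (g \o f).
Proof.
move=> [f' [ff' f'f fc f'c]] [g' [gg' g'g gc g'c]].
exists (f' \o g'); split=> [u|u|u|u] /=; rewrite ?gg' ?ff' ?f'f ?g'g//.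
- by apply: continuous_comp; [exact: fc|exact: gc].
- by apply: continuous_comp; [exact: g'c|exact: f'c].
Qed.

Lemma equiv_functions_trans p q (f : R * R -> R) :
  equiv_functions p q -> equiv_functions q f -> equiv_functions p f.
Proof.
move=> [h [l [hh hl lh]]] [k [m [hk hm mk]]]; exists (k \o h), (m \o l).
split; [exact: homeomorphism_comp|exact: homeomorphism_comp|].
apply/funext => z /=.
have := congr1 (fun F => F z) lh; have := congr1 (fun F => F (h z)) mk.
by rewrite /= => <- ->.
Qed.

Lemma equiv_functions_sym p q : equiv_functions p q -> equiv_functions q p.
Proof.
move=> [h [l [[h' [hh' h'h hc h'c]] [l' [ll' l'l lc l'c]] lh]]]; exists h', l'.
split; [by exists h|by exists l|].
apply/funext => z /=; have := congr1 (fun F => F (h' z)) lh.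
by rewrite /= h'h => <-; rewrite ll'.
Qed.

(** The last field makes [shear] the identity near every point of a vertical leaf, where its
    quotient degenerates. *)
Record shearable (l : R -> R) r1 s1 r2 s2 : Prop := Shearable {
  shear_l : continuous l;
  shear_r1 : continuous r1;
  shear_s1 : continuous s1;
  shear_r2 : continuous r2;
  shear_s2 : continuous s2;
  shear_zero : forall x, s1 x = 0 <-> s2 x = 0;
  shear_near : forall a, s1 a = 0 -> exists2 d, 0 < d &
     (forall x, `|x - a| < d -> s2 x = s1 x /\ r2 x - r2 a = r1 x - r1 a) /\
     (forall t, `|t - r1 a| < d -> l t - r2 a = t - r1 a) }.

Lemma shearable_sym (l l' : R -> R) r1 s1 r2 s2 : continuous l' -> cancel l l' ->
  shearable l r1 s1 r2 s2 -> shearable l' r2 s2 r1 s1.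
Proof.
move=> lc ll' [? ? ? ? ? Z N]; split=> //; first by move=> x; split=> /Z.
move=> a /Z sa; have [d d0 [dP lP]] := N a sa; exists d => //; split.
  by move=> x /dP[-> ->].
move=> t td; have := lP (t - r2 a + r1 a); rewrite addrK => /(_ td) lE.
have {lE}<- : l (t - r2 a + r1 a) = t by apply/eqP; rewrite -subr_eq0; apply/eqP; lra.
by rewrite ll'; move: (lP (t - r2 a + r1 a)); rewrite addrK => /(_ td) ->; ring.
Qed.

Definition shear (l : R -> R) r1 s1 r2 s2 z :=
  if s1 z.1 == 0 then z else (z.1, (l (linear_like r1 s1 z) - r2 z.1) / s2 z.1).

Lemma shear_value (l : R -> R) r1 s1 r2 s2 z : shearable l r1 s1 r2 s2 ->
  linear_like r2 s2 (shear l r1 s1 r2 s2 z) = l (linear_like r1 s1 z).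
Proof.
move=> S; rewrite /shear; case: eqVneq => [sz|sz].
  have [d d0 [_ lP]] := shear_near S sz.
  rewrite linear_like0; last exact/(shear_zero S).
  rewrite linear_like0//.
  have := lP (r1 z.1); rewrite !subrr normr0 => /(_ d0)/eqP; rewrite subr_eq0.
  by move/eqP.
by apply: linear_like_solveK => /(shear_zero S) s0; rewrite s0 eqxx in sz.
Qed.

Lemma shearK (l l' : R -> R) r1 s1 r2 s2 : cancel l l' -> shearable l r1 s1 r2 s2 ->
  cancel (shear l r1 s1 r2 s2) (shear l' r2 s2 r1 s1).
Proof.
move=> ll' S z; rewrite {1}/shear (shear_value _ S) ll'.
have E : (shear l r1 s1 r2 s2 z).1 = z.1 by rewrite /shear; case: ifP.
rewrite E; case: eqVneq => [/(shear_zero S) s0|s20]; first by rewrite /shear s0 eqxx.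
have s10 : s1 z.1 <> 0 by move/(shear_zero S) => s20'; rewrite s20' eqxx in s20.
by rewrite -(linear_like_solve s10 (erefl : linear_like r1 s1 (z.1, z.2) = _)) -surjective_pairing.
Qed.

Lemma shear_continuous (l : R -> R) r1 s1 r2 s2 : shearable l r1 s1 r2 s2 ->
  continuous (shear l r1 s1 r2 s2).
Proof.
move=> S z.
have pc := linear_like_continuous (shear_r1 S) (shear_s1 S).
have [sz|sz] := eqVneq (s1 z.1) 0.
  have [d d0 [dP lP]] := shear_near S sz.
  have /cvg_pt/(_ d d0)[d1 d10 d1P] := pc z.
  have E : \forall w \near z, shear l r1 s1 r2 s2 w = w.
    apply/nbhs_planeP; exists (Num.min d d1); first by rewrite lt_min d0.
    move=> w; rewrite !lt_min => /andP[w1 w1'] /andP[_ w2].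
    rewrite /shear; case: eqVneq => // sw.
    have [E1 E2] := dP _ w1.
    have E3 := lP (linear_like r1 s1 w); rewrite -(linear_like0 r1 sz) in E3.
    have {}E3 := E3 (d1P w w1' w2); rewrite (linear_like0 r1 sz) in E3.
    have -> : l (linear_like r1 s1 w) - r2 w.1 = s1 w.1 * w.2.
      by move: E2 E3; rewrite /linear_like; lra.
    by rewrite E1 mulrC mulKf// -surjective_pairing.
  by apply: (continuous_near E); exact: cvg_id.
have s2z : s2 z.1 != 0.
  by apply/eqP => /(shear_zero S) s0; rewrite s0 eqxx in sz.
have xc : w.1 @[w --> z] --> z.1 by exact: cvg_fst.
have sc : s1 w.1 @[w --> z] --> s1 z.1 by apply: (cvg_comp _ _ xc); exact: (shear_s1 S).
have E : \forall w \near z, shear l r1 s1 r2 s2 w =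
    (w.1, (l (linear_like r1 s1 w) - r2 w.1) / s2 w.1).
  have nz : \forall w \near z, s1 w.1 != 0 by exact: cvgr_neq0 sc sz.
  by apply: filterS nz => w sw; rewrite /shear ifF//; exact/negbTE.
apply: (continuous_near E).
have yc : (l (linear_like r1 s1 w) - r2 w.1) / s2 w.1 @[w --> z] -->
    (l (linear_like r1 s1 z) - r2 z.1) / s2 z.1.
  apply: cvgM.
    apply: cvgB; last by apply: (cvg_comp _ _ xc); exact: (shear_r2 S).
    by apply: (cvg_comp _ _ (pc z)); exact: (shear_l S).
  by apply: cvgV => //; apply: (cvg_comp _ _ xc); exact: (shear_s2 S).
exact: (cvg_pair xc yc).
Qed.

Lemma shear_equiv (l : R -> R) r1 s1 r2 s2 : homeomorphism l ->
  shearable l r1 s1 r2 s2 -> equiv_functions (linear_like r1 s1) (linear_like r2 s2).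
Proof.
move=> hl S; have [l' [ll' l'l lc l'c]] := hl.
have S' := shearable_sym l'c ll' S.
exists (shear l r1 s1 r2 s2), l; split=> //.
  exists (shear l' r2 s2 r1 s1); split.
  - exact: shearK.
  - exact: shearK.
  - exact: shear_continuous.
  - exact: shear_continuous.
by apply/funext => z /=; rewrite shear_value.
Qed.

Definition straight r s o := [/\ continuous r, continuous s, finite_set (zero_set s),
  forall a, s a = 0 -> flat_at s a &
  forall a, s a = 0 -> (o a = 1 \/ o a = -1) /\ exists2 d, 0 < d &
    forall x, `|x - a| < d -> r x = r a + o a * (x - a)].

Lemma flat_at_near s s' a d : 0 < d -> (forall x, `|x - a| < d -> s' x = s x) ->
  flat_at s a -> flat_at s' a.
Proof.
move=> d0 ss' sf e e0; have [d1 d10 d1P] := sf e e0.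
exists (Num.min d d1); first by rewrite lt_min d0.
move=> x y; rewrite !lt_min => /andP[xd xd1] /andP[yd yd1].
by rewrite !ss'//; exact: d1P.
Qed.

Definition bump a n x := Num.max 0 (Num.min 1 (2 - 4 * `|x - a| / n)).

Lemma bump_continuous a n : continuous (bump a n).
Proof.
move=> x; have c : 2 - 4 * `|u - a| / n @[u --> x] --> 2 - 4 * `|x - a| / n.
  apply: cvgB; first exact: cvg_cst.
  apply: cvgM; last exact: cvg_cst.
  apply: cvgM; first exact: cvg_cst.
  by apply: cvg_norm; apply: cvgB; [exact: cvg_id|exact: cvg_cst].
have one : (1 : R) @[u --> x] --> (1 : R) by exact: cvg_cst.
have zero : (0 : R) @[u --> x] --> (0 : R) by exact: cvg_cst.
exact: (continuous_max zero (continuous_min one c)).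
Qed.

Lemma bump_ge0 a n x : 0 <= bump a n x.
Proof. by rewrite /bump le_max lexx. Qed.

Lemma bump_le1 a n x : bump a n x <= 1.
Proof. by rewrite /bump ge_max ler01 ge_min lexx. Qed.

Lemma bump1 a n x : 0 < n -> `|x - a| <= n / 4 -> bump a n x = 1.
Proof.
move=> n0 xa; have : 4 * `|x - a| / n <= 1 by rewrite ler_pdivrMr//; lra.
by move=> h; rewrite /bump min_l; [rewrite max_r//|lra].
Qed.

Lemma bump0 a n x : 0 < n -> n / 2 <= `|x - a| -> bump a n x = 0.
Proof.
move=> n0 xa; have : 2 <= 4 * `|x - a| / n by rewrite ler_pdivlMr//; lra.
by move=> h; rewrite /bump max_l// ge_min; apply/orP; right; lra.
Qed.

(** One zero at a time, [s] is blended with [s'] by a cut-off. Both have the same sign, so the blend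
    has the same zeros, and [slide_equiv] compares it with the previous function. The radius
    isolates the zero, so matches already made near the others survive. *)
Lemma match_near r s o s' (l : seq R) : straight r s o -> continuous s' ->
  (forall a, s a = 0 -> s' a = 0) -> (forall a, s a = 0 -> flat_at s' a) ->
  (forall x, s x <> 0 -> 0 < s x * s' x) -> {in l, forall a, s a = 0} ->
  exists s3, [/\ straight r s3 o, equiv_functions (linear_like r s) (linear_like r s3),
    forall x, s3 x = 0 <-> s x = 0, forall x, s x <> 0 -> 0 < s3 x * s' x &
    {in l, forall a, exists2 d, 0 < d & forall x, `|x - a| < d -> s3 x = s' x}].
Proof.
move=> st sc' z' fl' pos; elim: l => [_|a l IH al].
  exists s; split=> //; exists id, id; split=> //;
    by exists id; split=> // x; exact: cvg_id.
have [|s3 [st3 eq3 z3 pos3 near3]] := IH.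
  by move=> b bl; apply: al; rewrite inE bl orbT.
have sa : s a = 0 by apply: al; rewrite mem_head.
have [rc sc3 Zf3 fl3 aff3] := st3.
have s3a : s3 a = 0 by apply/z3.
have [d1 d10 d1P] := finite_isolated a Zf3.
have [oa [d2 d20 d2P]] := aff3 a s3a.
pose n := Num.min d1 d2.
have n0 : 0 < n by rewrite lt_min d10.
pose k x := (1 - bump a n x) * s3 x + bump a n x * s' x.
have kfar x : n / 2 <= `|x - a| -> k x = s3 x.
  by move=> xa; rewrite /k bump0// subr0 mul1r mul0r addr0.
have knear x : `|x - a| < n / 4 -> k x = s' x.
  by move=> xa; rewrite /k bump1 ?ltW// subrr mul0r mul1r add0r.
have kc : continuous k.
  move=> x; have bc := @bump_continuous a n x.
  apply: cvgD; apply: cvgM => //; [|exact: sc3|exact: sc'].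
  by apply: cvgB => //; exact: cvg_cst.
have kpos x : s3 x <> 0 -> 0 < s3 x * k x /\ 0 < k x * s' x.
  move=> s30; have p := pos3 x (fun zx => s30 ((z3 x).2 zx)).
  have b0 := bump_ge0 a n x; have b1 := bump_le1 a n x.
  have s3s : 0 < s3 x * s3 x by rewrite -expr2 exprn_even_gt0//=; exact/eqP.
  have s's : 0 < s' x * s' x.
    rewrite -expr2 exprn_even_gt0//=; apply/eqP => s0.
    by move: p; rewrite s0 mulr0 ltxx.
  have conv (u v : R) : 0 < u -> 0 < v -> 0 < (1 - bump a n x) * u + bump a n x * v.
    move=> u0 v0; have [be|bn] := eqVneq (bump a n x) 0.
      by rewrite be subr0 mul1r mul0r addr0.
    apply: ltr_wpDl; first by rewrite mulr_ge0 ?subr_ge0// ltW.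
    by rewrite mulr_gt0// lt_neqAle eq_sym bn.
  by split; [have := conv _ _ s3s p|have := conv _ _ p s's]; rewrite /k; lra.
have kz x : k x = 0 <-> s3 x = 0.
  split=> [k0|s0]; last by rewrite /k s0 z' ?mulr0 ?addr0//; apply/z3.
  by apply: contrapT => /kpos[]; rewrite k0 mulr0 ltxx.
have far b : s3 b = 0 -> b <> a -> n <= `|b - a|.
  move=> sb ba; rewrite leNgt; apply/negP; rewrite lt_min => /andP[/(d1P _ sb) + _].
  exact: ba.
have kflat b : s3 b = 0 -> flat_at k b.
  move=> sb; have [->|/eqP ba] := eqVneq b a.
    apply: (flat_at_near _ knear); first by rewrite divr_gt0.
    exact: fl'.
  apply: (@flat_at_near s3 _ _ (n / 2)); [by rewrite divr_gt0| |exact: fl3].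
  move=> x xb; apply: kfar.
  have : `|b - a| <= `|b - x| + `|x - a|.
    by have -> : b - a = (b - x) + (x - a); [ring|exact: ler_normD].
  by rewrite distrC in xb; have := far b sb ba; lra.
exists k; split.
- split=> //.
  + by apply: sub_finite_set Zf3 => x /kz.
  + by move=> b /kz; exact: kflat.
  + by move=> b /kz; exact: aff3.
- apply: equiv_functions_trans eq3 _; apply: (@slide_equiv _ _ _ _ (o a) a n).
  split=> //.
  + exact/kz.
  + exact: fl3.
  + exact: kflat.
  + by move=> x; rewrite lt_min => /andP[_]; exact: d2P.
  + by move=> x xa xn; apply: (kpos x _).1 => s0; have := far x s0 xa; rewrite leNgt xn.
  + by move=> x /kfar.
- by move=> x; split=> [/kz/z3|/z3/kz].
- by move=> x sx; apply: (kpos x _).2 => /z3.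
- move=> b; rewrite inE => /orP[/eqP ->|bl].
    by exists (n / 4); [rewrite divr_gt0|exact: knear].
  have [->|/eqP ba] := eqVneq b a.
    by exists (n / 4); [rewrite divr_gt0|exact: knear].
  have [d d0 dP] := near3 b bl.
  have sb : s3 b = 0 by apply/z3/al; rewrite inE bl orbT.
  exists (Num.min d (n / 2)); first by rewrite lt_min d0 divr_gt0.
  move=> x; rewrite lt_min => /andP[xd xn]; rewrite kfar ?dP//.
  have : `|b - a| <= `|b - x| + `|x - a|.
    by have -> : b - a = (b - x) + (x - a); [ring|exact: ler_normD].
  by rewrite distrC in xn; have := far b sb ba; lra.
Qed.

End Construction.

(** * Straightening the abscissa and comparing combinatorial data *)

Section Normalize.
Variable R : realType.
Implicit Types (x y a b c d e t n : R) (r s o : R -> R) (z w : R * R) (p q : R * R -> R).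

(** Near a zero the new abscissa is [r] itself up to sign and translation, so [r \o k] is affine
    with slope [1] or [-1]; [f] allows the zeros of one function to be moved onto those of
    another. *)
Lemma normalize r s o (f : R -> R) : tame r s o ->
  (forall a b, s a = 0 -> s b = 0 -> a < b -> f a < f b) ->
  exists g k, [/\ increasing_bij g /\ increasing_bij k, cancel g k /\ cancel k g,
    forall a, s a = 0 -> g a = f a, straight (r \o k) (s \o k) (o \o k) &
    equiv_functions (linear_like r s) (linear_like (r \o k) (s \o k))].
Proof.
move=> [rc sc Zf sf st] fi.
have [l ls lZ] := finite_sorted Zf.
have /choice[G GP] : forall a, exists g, s a = 0 -> increasing_bij g /\
    exists2 d, 0 < d & forall x, `|x - a| < d -> g x = f a + o a * (r x - r a).
  move=> a; have [sa|/eqP sa] := eqVneq (s a) 0; last by exists id.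
  have [oa [C [d [C0 d0 dP]]]] := st a sa.
  have [||g gP gE] := @increasing_bij_extend R (fun x => f a + o a * (r x - r a)) a d d0.
  - move=> x; apply: cvgD; first exact: cvg_cst.
    by apply: cvgM; [exact: cvg_cst|apply: cvgB; [exact: rc|exact: cvg_cst]].
  - move=> x y xd yd xy; have := dP y x yd xd (ltW xy).
    have : 0 < y - x by rewrite subr_gt0.
    move=> h1 h2; have : 0 < C * (o a * (r y - r x)) by exact: lt_le_trans h2.
    by rewrite pmulr_rgt0// => ?; lra.
  - exists g => _; split=> //; exists (d / 2); first by rewrite divr_gt0.
    by move=> x /ltW; exact: gE.
have lZ1 a : a \in l -> s a = 0 by move/lZ.
have [||g gP gG] := @increasing_bij_germs R l f G ls.
- by move=> a b /lZ1 sa /lZ1 sb; exact: fi.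
- move=> a /lZ1 sa; have [Ga [d d0 dP]] := GP a sa; split=> //.
  by rewrite dP subrr ?normr0// mulr0 addr0.
have near a : s a = 0 -> exists2 d, 0 < d &
    forall x, `|x - a| < d -> g x = f a + o a * (r x - r a).
  move=> sa; have [d1 d10 d1P] := gG a ((lZ a).2 sa).
  have [_ [d2 d20 d2P]] := GP a sa.
  exists (Num.min d1 d2); first by rewrite lt_min d10.
  by move=> x; rewrite lt_min => /andP[x1 x2]; rewrite d1P// d2P.
have ga a : s a = 0 -> g a = f a.
  by move=> /near[d d0 dP]; rewrite dP subrr ?normr0// mulr0 addr0.
have [k kP [gk kg]] := increasing_bij_inv gP.
have kc := increasing_bij_continuous kP.
exists g, k; split=> //; last first.
  exists (fun z => (g z.1, z.2)), id; split.
  - exists (fun z => (k z.1, z.2)); split.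
    + by move=> [x y] /=; rewrite gk.
    + by move=> [x y] /=; rewrite kg.
    + apply: continuous_planeP => z /=; last exact: cvg_snd.
      have xc : w.1 @[w --> z] --> z.1 by exact: cvg_fst.
      by apply: (cvg_comp _ _ xc); exact: increasing_bij_continuous.
    + apply: continuous_planeP => z /=; last exact: cvg_snd.
      have xc : w.1 @[w --> z] --> z.1 by exact: cvg_fst.
      by apply: (cvg_comp _ _ xc); exact: kc.
  - by exists id; split=> // x; exact: cvg_id.
  - by apply/funext => z; rewrite /linear_like /= gk.
split.
- by move=> x; apply: continuous_comp; [exact: kc|exact: rc].
- by move=> x; apply: continuous_comp; [exact: kc|exact: sc].
- apply: sub_finite_set (finite_image g Zf) => x /= sx.
  by exists (k x) => //; rewrite kg.
- move=> u /= su e e0.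
  have [oa [C [d1 [C0 d10 d1P]]]] := st _ su.
  have [d2 d20 d2P] := near _ su.
  have eC : 0 < e / C by rewrite divr_gt0.
  have [d3 d30 d3P] := sf _ su _ eC.
  have D0 : 0 < Num.min d1 (Num.min d2 d3) by rewrite !lt_min d10 d20.
  have [d d0 dP] := (continuous_lineP _).1 kc u _ D0.
  exists d => // x y /dP + /dP; rewrite !lt_min => /and3P[x1 x2 x3] /and3P[y1 y2 y3].
  apply: le_trans (d3P _ _ x3 y3) _.
  (* Steepness of [r] makes [k] Lipschitz with constant [C], so flatness of [s] passes to
     [s \o k]. *)
  suff : `|k x - k y| <= C * `|x - y|.
    move=> h; rewrite mulrAC ler_pdivrMr//.
    by have := ler_wpM2l (ltW e0) h; lra.
  have xE := d2P _ x2; have yE := d2P _ y2; rewrite !kg in xE yE.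
  case: (leP (k y) (k x)) => kxy.
    have := d1P _ _ x1 y1 kxy; have -> : o (k u) * (r (k x) - r (k y)) = x - y.
      by rewrite [in RHS]xE [in RHS]yE; ring.
    rewrite ger0_norm ?subr_ge0// => /le_trans; apply.
    by rewrite ler_pM2l// ler_norm.
  have := d1P _ _ y1 x1 (ltW kxy); have -> : o (k u) * (r (k y) - r (k x)) = y - x.
    by rewrite [in RHS]xE [in RHS]yE; ring.
  rewrite distrC [`|x - y|]distrC gtr0_norm ?subr_gt0// => /le_trans; apply.
  by rewrite ler_pM2l// ler_norm.
- move=> u /= su; have [oa _] := st _ su; split=> //.
  have [d2 d20 d2P] := near _ su.
  have [d d0 dP] := (continuous_lineP _).1 kc u _ d20.
  exists d => // x /dP /d2P; rewrite kg => xE.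
  have uE : u = f (k u) by rewrite -ga ?kg.
  have -> : x - u = o (k u) * (r (k x) - r (k u)) by move: xE uE; lra.
  rewrite mulrA; have -> : o (k u) * o (k u) = 1 by case: oa => ->; ring.
  by ring.
Qed.

Lemma equiv_of_combinatorics r1 s1 o1 r2 s2 o2 (f : R -> R) :
  tame r1 s1 o1 -> tame r2 s2 o2 ->
  (forall a, s1 a = 0 -> s2 (f a) = 0) ->
  (forall b, s2 b = 0 -> exists2 a, s1 a = 0 & f a = b) ->
  (forall a b, s1 a = 0 -> s1 b = 0 -> a < b -> f a < f b) ->
  (forall a, s1 a = 0 -> o1 a = o2 (f a)) ->
  (forall a b, s1 a = 0 -> s1 b = 0 -> r1 a < r1 b -> r2 (f a) < r2 (f b)) ->
  (forall a b, s1 a = 0 -> s1 b = 0 -> r1 a = r1 b -> r2 (f a) = r2 (f b)) ->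
  (forall x y, s1 x <> 0 -> s2 y <> 0 -> (forall a, s1 a = 0 -> (a < x) = (f a < y)) ->
     0 < s1 x * s2 y) ->
  equiv_functions (linear_like r1 s1) (linear_like r2 s2).
Proof.
move=> t1 t2 fz fs fi fo rlt req pos.
have /choice[g gP] : forall b, exists a, s2 b = 0 -> s1 a = 0 /\ f a = b.
  move=> b; have [sb|/eqP sb] := eqVneq (s2 b) 0; last by exists b.
  by have [a sa fa] := fs b sb; exists a.
have gi a b : s2 a = 0 -> s2 b = 0 -> a < b -> g a < g b.
  move=> sa sb ab; have [sga fga] := gP a sa; have [sgb fgb] := gP b sb.
  case: (ltgtP (g a) (g b)) => // [ba|gab].
    by have := fi _ _ sgb sga ba; rewrite fga fgb; lra.
  by move: ab; rewrite -fga -fgb gab ltxx.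
(* The first function is straightened with its zeros fixed, the second with its zeros moved onto
   those of the first. *)
have [k1 [l1 [[k1P l1P] [kl1 lk1] k1z st1 eq1]]] := @normalize _ _ _ id t1 (fun a b _ _ ab => ab).
have [k2 [l2 [[k2P l2P] [kl2 lk2] k2z st2 eq2]]] := normalize t2 gi.
have l1z a : s1 a = 0 -> l1 a = a by move=> sa; rewrite -{1}(k1z a sa).
have l1z' x : s1 (l1 x) = 0 -> l1 x = x by move=> sx; rewrite -[RHS]lk1 (k1z _ sx).
have fgK a : s1 a = 0 -> g (f a) = a.
  move=> sa; have [sg fg] := gP _ (fz a sa).
  case: (ltgtP (g (f a)) a) => // ag.
    by have := fi _ _ sg sa ag; rewrite fg ltxx.
  by have := fi _ _ sa sg ag; rewrite fg ltxx.
have l2z a : s1 a = 0 -> l2 a = f a.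
  by move=> sa; rewrite -[RHS]kl2 (k2z _ (fz a sa)) fgK.
have zero x : (s1 \o l1) x = 0 <-> (s2 \o l2) x = 0.
  rewrite /=; split=> sx.
    by have := l1z' _ sx => xE; rewrite xE in sx; rewrite l2z//; exact: fz.
  have [sg fg] := gP _ sx; have := k2z _ sx; rewrite lk2 => xE.
  by rewrite xE l1z.
have pos12 x : (s1 \o l1) x <> 0 -> 0 < (s1 \o l1) x * (s2 \o l2) x.
  move=> sx; apply: pos => //; first by move/zero.
  move=> a sa; have -> : (a < l1 x) = (a < x).
    by rewrite -(increasing_bij_mono _ _ k1P) lk1 k1z.
  by rewrite -[f a < l2 x](increasing_bij_mono _ _ k2P) lk2 k2z ?fgK//; exact: fz.
have [rc1 sc1 Zf1 fl1 af1] := st1; have [rc2 sc2 Zf2 fl2 af2] := st2.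
have [L Ls LZ] := finite_sorted Zf1.
have [||||s3 [st3 eq3 z3 _ near3]] := @match_near R _ _ _ (s2 \o l2) L st1 sc2.
- by move=> a /zero.
- by move=> a /zero; exact: fl2.
- exact: pos12.
- by move=> a /LZ.
apply: equiv_functions_trans eq1 _; apply: equiv_functions_trans eq3 _.
apply: equiv_functions_trans (equiv_functions_sym eq2).
have [_ _ Zf _ _] := t1.
have [V Vs VZ] := finite_sorted (finite_image r1 Zf).
(* Several zeros may share a value; [req] makes the target value independent of the zero chosen. *)
have /choice[W WP] : forall v, exists v', forall a, s1 a = 0 -> r1 a = v -> v' = r2 (f a).
  move=> v; have [[a [sa av]]|no] := pselect (exists a, s1 a = 0 /\ r1 a = v).
    by exists (r2 (f a)) => b sb bv; apply: req => //; rewrite av.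
  by exists v => a sa av; exfalso; apply: no; exists a.
(* Near matching zeros both straightened functions [r] have the same slope, so a translation is the
   right germ for the change of values; [rlt] puts these germs in order. *)
have [||l lP lG] := @increasing_bij_germs R V W (fun v t => t - v + W v) Vs.
- move=> u v /VZ[a sa <-] /VZ[b sb <-] ab.
  by rewrite (WP _ a)// (WP _ b)//; exact: rlt.
- move=> v _; split; last by rewrite subrr add0r.
  by split=> [x y xy|y]; [lra|exists (y - W v + v); ring].
apply: (@shear_equiv _ l); first exact: increasing_bij_homeo.
have [rc3 sc3 _ _ af3] := st3.
split=> //.
- exact: increasing_bij_continuous.
- by move=> x; split=> [/z3/zero|/zero/z3].
move=> a s3a; have s1a : (s1 \o l1) a = 0 by apply/z3.
have l1a : l1 a = a by exact: l1z'.
have sa : s1 a = 0 by rewrite -l1a.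
have [d1 d10 d1P] := near3 a ((LZ a).2 s1a).
have [ _ [d2 d20 d2P]] := af1 a s1a.
have [ _ [d3 d30 d3P]] := af2 a ((zero a).1 s1a).
have r1V : r1 a \in V by apply/VZ; exists a.
have [d4 d40 d4P] := lG _ r1V.
exists (Num.min (Num.min d1 d2) (Num.min d3 d4)); first by rewrite !lt_min d10 d20 d30.
split.
  move=> x; rewrite !lt_min => /andP[/andP[x1 x2] /andP[x3 _]]; split; first by rewrite d1P.
  rewrite d2P// d3P//=.
  have -> : o2 (l2 a) = o1 (l1 a) by rewrite l2z// l1a fo.
  by ring.
move=> t; rewrite !lt_min => /andP[_ /andP[_ x4]].
rewrite /= l1a in x4 *; rewrite d4P// l2z// (WP _ a)//; ring.
Qed.

End Normalize.

(** * Smooth submersions and reflections *)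

Section SmoothTame.
Variable R : realType.
Implicit Types (x y a b c d e t n : R) (r s o : R -> R) (z w : R * R) (p q : R * R -> R).

Lemma smooth_derivable r x : smooth r -> derivable r x 1.
Proof. by move=> /(_ 0 x). Qed.

Lemma smooth_continuous r : smooth r -> continuous r.
Proof.
by move=> sr x; apply/differentiable_continuous/derivable1_diffP; exact: smooth_derivable.
Qed.

Lemma smooth_derive_continuous r : smooth r -> continuous (derive1 r).
Proof.
by move=> sr x; apply/differentiable_continuous/derivable1_diffP; exact: (sr 1).
Qed.

Lemma smooth_increment r a d x y : smooth r -> `|x - a| < d -> `|y - a| < d ->
  exists2 c, `|c - a| < d & r x - r y = derive1 r c * (x - y).
Proof.
move=> sr; wlog yx : x y / y <= x => [hw xd yd|].
  have [yx|/ltW xy] := leP y x; first exact: hw.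
  by have [c cd E] := hw _ _ xy yd xd; exists c => //; rewrite -opprB E; ring.
move=> xd yd.
have [||c] := @MVT_segment R r (derive1 r) y x yx.
- by move=> c _; rewrite derive1E; apply: DeriveDef => //; exact: smooth_derivable.
- exact/continuous_subspaceT/smooth_continuous.
rewrite in_itv /= => /andP[yc cx] E; exists c => //.
by move: xd yd; rewrite !ltr_norml => /andP[? ?] /andP[? ?]; apply/andP; split; lra.
Qed.

Lemma derive_fst r s x y : smooth r -> smooth s ->
  'D_(1, 0) (linear_like r s) (x, y) = derive1 r x + derive1 s x * y.
Proof.
move=> sr ss.
have -> : 'D_(1, 0) (linear_like r s) (x, y) = 'D_1 (fun t => r t + s t * y) x.
  rewrite /derive; set F := fun _ => _; set G := fun _ => _.
  suff -> : F = G by [].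
  by apply/funext => t; rewrite /F /G /linear_like /= scaler0 add0r.
have dr : is_derive x (1 : R) r (derive1 r x).
  by rewrite derive1E; apply: DeriveDef => //; exact: smooth_derivable.
have ds : is_derive x (1 : R) s (derive1 s x).
  by rewrite derive1E; apply: DeriveDef => //; exact: smooth_derivable.
have dc : is_derive x (1 : R) (fun=> y) 0 by exact: is_derive_cst.
have := is_deriveD dr (is_deriveM ds dc) => d.
rewrite (@derive_val _ _ _ _ _ _ _ d).
by rewrite scaler0 add0r /GRing.scale /=; ring.
Qed.

Lemma derive_snd r s x y : 'D_(0, 1) (linear_like r s) (x, y) = s x.
Proof.
have -> : 'D_(0, 1) (linear_like r s) (x, y) = 'D_1 (fun t => r x + s x * t) y.
  rewrite /derive; set F := fun _ => _; set G := fun _ => _.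
  suff -> : F = G by [].
  by apply/funext => t; rewrite /F /G /linear_like /= scaler0 add0r.
have d1 : is_derive y (1 : R) (fun=> r x) 0 by exact: is_derive_cst.
have d2 : is_derive y (1 : R) (fun=> s x) 0 by exact: is_derive_cst.
have d3 : is_derive y (1 : R) (fun t : R => t) 1 by exact: is_derive_id.
have := is_deriveD d1 (is_deriveM d2 d3) => d.
rewrite (@derive_val _ _ _ _ _ _ _ d).
by rewrite /GRing.scale /=; ring.
Qed.

(** At [(a, y)] only the first component of the gradient can be nonzero; it is affine in [y] and
    must have no root. *)
Lemma submersion_zero r s a : smooth r -> smooth s -> submersion (linear_like r s) ->
  s a = 0 -> derive1 s a = 0 /\ derive1 r a <> 0.
Proof.
move=> sr ss sub sa.
have nz y : derive1 r a + derive1 s a * y <> 0.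
  by move=> E; apply: (sub (a, y)); rewrite /gradient derive_fst// derive_snd E sa.
have s'0 : derive1 s a = 0.
  apply/eqP/negPn/negP => s'n; apply: (nz (- derive1 r a / derive1 s a)).
  by rewrite mulrC divfK// subrr.
by split=> // r'0; apply: (nz 0); rewrite r'0 mulr0 addr0.
Qed.

Lemma tame_of_submersion r s : finite_linear_like_submersion r s ->
  tame r s (fun a => Num.sg (derive1 r a)).
Proof.
move=> [sr ss sub Zf]; split=> //; [exact: smooth_continuous|exact: smooth_continuous| |].
  move=> a sa e e0; have [s'a _] := submersion_zero sr ss sub sa.
  have [d d0 dP] := (continuous_lineP _).1 (smooth_derive_continuous ss) a e e0.
  exists d => // x y xd yd; have [c /dP + ->] := smooth_increment ss xd yd.
  by rewrite s'a subr0 normrM => /ltW ce; rewrite ler_wpM2r.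
move=> a sa; have [_ r'a] := submersion_zero sr ss sub sa.
split; first by case: sgrP r'a => // _ _; [left|right].
(* Near [a] the derivative of [r] keeps its sign and at least half its size; the inverse of that
   half is the constant of [steep_at]. *)
have k0 : 0 < `|derive1 r a| / 2 by rewrite divr_gt0// normr_gt0; exact/eqP.
have [d d0 dP] := (continuous_lineP _).1 (smooth_derive_continuous sr) a _ k0.
exists (`|derive1 r a| / 2)^-1, d; split=> //; first by rewrite invr_gt0.
move=> x y xd yd yx; have [c /dP ca ->] := smooth_increment sr xd yd.
rewrite -ler_pdivrMl ?invr_gt0// invrK mulrA ler_wpM2r ?subr_ge0//.
move/eqP: r'a ca; rewrite neq_lt => /orP[r0|r0].
  by rewrite (ltr0_sg r0) (ltr0_norm r0) ltr_norml => /andP[? ?]; lra.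
by rewrite (gtr0_sg r0) (gtr0_norm r0) ltr_norml => /andP[? ?]; lra.
Qed.

End SmoothTame.

Section Reflections.
Variable R : realType.
Implicit Types (x y a b c d e t n : R) (r s o : R -> R) (z w : R * R) (p q : R * R -> R).

Lemma flat_at_opp s a : flat_at s a -> flat_at (fun x => - s x) a.
Proof.
move=> sf e /sf[d d0 dP]; exists d => // x y xd yd.
by rewrite -opprD normrN; exact: dP.
Qed.

Lemma tame_opp_height r s o : tame r s o -> tame r (fun x => - s x) o.
Proof.
move=> [rc sc Zf sf st]; split=> //.
- by move=> x; apply: cvgN; exact: sc.
- by apply: sub_finite_set Zf => x /eqP; rewrite oppr_eq0 => /eqP.
- by move=> a /eqP; rewrite oppr_eq0 => /eqP sa; apply: flat_at_opp; exact: sf.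
- by move=> a /eqP; rewrite oppr_eq0 => /eqP /st.
Qed.

Lemma tame_opp r s o : tame r s o ->
  tame (fun x => - r x) (fun x => - s x) (fun x => - o x).
Proof.
move=> t; have [rc sc Zf sf st] := tame_opp_height t; split=> //.
  by move=> x; apply: cvgN; exact: rc.
move=> a /st[oa [C [d [C0 d0 dP]]]]; split.
  by case: oa => ->; [right|left; rewrite opprK].
exists C, d; split=> // x y xd yd yx; have := dP x y xd yd yx.
by rewrite -opprD mulrNN.
Qed.

Lemma tame_reflect r s o : tame r s o ->
  tame (fun x => r (- x)) (fun x => s (- x)) (fun x => - o (- x)).
Proof.
move=> [rc sc Zf sf st].
have nc x : - u @[u --> x] --> - x by apply: cvgN; exact: cvg_id.
have dE (x a : R) : `|- x - - a| = `|x - a| by rewrite -opprD normrN.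
split.
- by move=> x; apply: (cvg_comp _ _ (nc x)); exact: rc.
- by move=> x; apply: (cvg_comp _ _ (nc x)); exact: sc.
- apply: sub_finite_set (finite_image (fun x => - x) Zf) => x sx.
  by exists (- x) => //; rewrite opprK.
- move=> a /sf fa e /fa[d d0 dP]; exists d => // x y xd yd.
  by rewrite -[`|x - y|]dE; apply: dP; rewrite dE.
- move=> a /st[oa [C [d [C0 d0 dP]]]]; split.
    by case: oa => ->; [right|left; rewrite opprK].
  exists C, d; split=> // x y xd yd yx.
  have := dP (- y) (- x); rewrite !dE lerN2 => /(_ yd xd yx) h.
  have -> : x - y = - y - - x by ring.
  by apply: (le_trans h); rewrite mulNr -mulrN opprB.
Qed.

Lemma homeomorphism_id (T : topologicalType) : homeomorphism (@id T).
Proof. by exists id; split=> // x; exact: cvg_id. Qed.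

Lemma homeomorphism_opp : homeomorphism (fun x : R => - x).
Proof.
by exists (fun x => - x); split=> x; rewrite ?opprK//; apply: cvgN; exact: cvg_id.
Qed.

Definition flip_fst z : R * R := (- z.1, z.2).
Definition flip_snd z : R * R := (z.1, - z.2).

Lemma flip_fst_homeo : homeomorphism flip_fst.
Proof.
exists flip_fst; split; try by move=> [x y]; rewrite /flip_fst /= opprK.
  by apply: continuous_planeP => z /=; [apply: cvgN; exact: cvg_fst|exact: cvg_snd].
by apply: continuous_planeP => z /=; [apply: cvgN; exact: cvg_fst|exact: cvg_snd].
Qed.

Lemma flip_snd_homeo : homeomorphism flip_snd.
Proof.
exists flip_snd; split; try by move=> [x y]; rewrite /flip_snd /= opprK.
  by apply: continuous_planeP => z /=; [exact: cvg_fst|apply: cvgN; exact: cvg_snd].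
by apply: continuous_planeP => z /=; [exact: cvg_fst|apply: cvgN; exact: cvg_snd].
Qed.

Lemma flip_fst_value r s z :
  linear_like (fun x => r (- x)) (fun x => s (- x)) (flip_fst z) = linear_like r s z.
Proof. by rewrite /linear_like /= opprK. Qed.

Lemma flip_snd_value r s z :
  linear_like r (fun x => - s x) (flip_snd z) = linear_like r s z.
Proof. by rewrite /linear_like /= mulrNN. Qed.

Lemma opp_value r s z :
  linear_like (fun x => - r x) (fun x => - s x) z = - linear_like r s z.
Proof. by rewrite /linear_like /= mulNr opprD. Qed.

Lemma equiv_of_conj p q (h : R * R -> R * R) (l : R -> R) : homeomorphism h -> homeomorphism l ->
  (forall z, q (h z) = l (p z)) -> leaf_equiv p q h /\ equiv_functions q p.
Proof.
move=> hh hl E; have li : injective l by have [l' [ll' _ _ _]] := hl; exact: can_inj ll'.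
have E' : l \o p = q \o h by apply/funext => z /=.
by split; [exact: leaf_equiv_conj E'|apply: equiv_functions_sym; exists h, l].
Qed.

End Reflections.

(** * The equivalence *)

Section Backward.
Variable R : realType.
Implicit Types (x y a b c d e t n : R) (r s o : R -> R) (z w : R * R) (p q : R * R -> R).

Definition value_match r1 s1 r2 (h : R * R -> R * R) (f : R -> R) :=
  monotone_on (r1 @` zero_set s1) f /\
  forall a, s1 a = 0 -> f (r1 a) = r2 (line_image h a).

Lemma adjacent_strip s a x y : borders s a x -> same_strip s x y -> borders s a y.
Proof.
move=> [sx ax] xy; split; first exact: same_strip_neq0 (same_strip_sym xy).
by move=> b sb ba; apply: same_side_trans (ax b sb ba) (xy b sb).
Qed.

(* If the value correspondence reverses the order while h preserves it along
   every strip, then all the exceptional values coincide. *)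
Lemma value_order r1 s1 o1 r2 s2 o2 (h : R * R -> R * R) (f : R -> R) :
  tame r1 s1 o1 -> tame r2 s2 o2 -> leaf_equiv (linear_like r1 s1) (linear_like r2 s2) h ->
  (forall a, s1 a = 0 -> keeps_sides h a) ->
  (forall x, s1 x <> 0 -> preserves r1 s1 r2 s2 h x) ->
  value_match r1 s1 r2 h f ->
  forall a b, s1 a = 0 -> s1 b = 0 -> r1 a < r1 b ->
  r2 (line_image h a) < r2 (line_image h b).
Proof.
move=> t1 t2 H K P [[fi|fd] fE] a b sa sb ab.
  by rewrite -!fE//; apply: fi => //; rewrite inE; [exists a|exists b].
exfalso.
(* Along a strip [transition] increases while [f] reverses the order, so two zeros bordering the
   same strip have equal values. *)
have step x c d : s1 c = 0 -> s1 d = 0 -> borders s1 c x -> borders s1 d x -> r1 c = r1 d.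
  move=> sc sd cx dx; have sx := cx.1.
  have no u v : s1 u = 0 -> s1 v = 0 -> borders s1 u x -> borders s1 v x -> ~ r1 u < r1 v.
    move=> su sv ux vx uv; have := uv.
    rewrite (preserves_lt t1 t2 H K (r1 u) (r1 v) sx (P x sx)).
    rewrite (transition_adjacent t1 t2 H su ux) (transition_adjacent t1 t2 H sv vx) -!fE//.
    by rewrite ltNge ltW// fd// inE; [exists v|exists u].
  by case: (ltgtP (r1 c) (r1 d)) => // h'; [case: (no _ _ sc sd)|case: (no _ _ sd sc)].
(* Spreads the equality with [r1 a] from a zero to the strips it borders and on to their other end
   points; local constancy carries it to [b]. *)
pose Q x := (s1 x = 0 /\ r1 x = r1 a) \/
  exists c, [/\ s1 c = 0, borders s1 c x & r1 c = r1 a].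
suff : Q b.
  by move=> [[_ ba]|[c [_ [sb' _] _]]]; [rewrite ba ltxx in ab|exact: sb'].
apply: (@locally_constant R Q _ a); last by left.
move=> x; have [sx|/eqP sx] := eqVneq (s1 x) 0.
  have [d d0 dP] := adjacent_near t1 sx; exists d => // y yx.
  have [->//|/eqP yn] := eqVneq y x.
  have xy := (dP y yx).1 yn.
  split=> [[[sy _]|[c [sc cy ca]]]|[[_ xa]|[c [_ [sx' _] _]]]]; [by case: xy.1| |  |by case: sx'].
    by left; split=> //; rewrite -ca; exact: step xy cy.
  by right; exists x.
have [d d0 dP] := same_strip_near t1 sx; exists d => // y /dP xy.
split=> [[[sy _]|[c [sc cy ca]]]|[[sx' _]|[c [sc cx ca]]]].
- by case: (same_strip_neq0 (same_strip_sym xy)).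
- by right; exists c; split=> //; exact: adjacent_strip cy (same_strip_sym xy).
- by case: sx.
- by right; exists c; split=> //; exact: adjacent_strip cx xy.
Qed.

Lemma equiv_of_leaf_equiv_oriented r1 s1 o1 r2 s2 o2 (h : R * R -> R * R) (f : R -> R) :
  tame r1 s1 o1 -> tame r2 s2 o2 -> leaf_equiv (linear_like r1 s1) (linear_like r2 s2) h ->
  (forall a, s1 a = 0 -> keeps_sides h a) ->
  (forall x, s1 x <> 0 -> preserves r1 s1 r2 s2 h x) ->
  (forall a, s1 a = 0 -> o1 a = o2 (line_image h a)) ->
  (forall x, s1 x <> 0 -> 0 < s1 x * s2 (h (x, 0)).1) ->
  value_match r1 s1 r2 h f ->
  equiv_functions (linear_like r1 s1) (linear_like r2 s2).
Proof.
move=> t1 t2 H K P O T V.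
apply: (@equiv_of_combinatorics R r1 s1 o1 r2 s2 o2 (line_image h)) => //.
- exact: line_image_zero t1 t2 H.
- move=> b sb; exact: (beta_onto t1 t2 H sb).
- by move=> a b sa sb; exact: (beta_mono K sa sb).
- exact: (value_order t1 t2 H K P V).
- by move=> a b sa sb ab; case: V => _ fE; rewrite -!fE// ab.
move=> x y sx sy xy; have [_ sc2 _ _ _] := t2.
(* The image of [(x, 0)] and [y] lie on the same side of every image zero, since both are placed as
   [x] is relative to its preimage. *)
have st : same_strip s2 (h (x, 0)).1 y.
  move=> b sb; have [a sa ab] := beta_onto t1 t2 H sb.
  have [Kl Kr] := K a sa (x, 0); rewrite ab /= in Kl Kr.
  have xa : x <> a by move=> xa; apply: sx; rewrite xa.
  have yb : y <> b by move=> yb; apply: sy; rewrite yb.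
  have axy := xy a sa; rewrite ab in axy.
  rewrite /same_side; case: (ltgtP x a) => // ha.
    rewrite (Kl.1 ha); move: axy; rewrite ltNge (ltW ha) /= => /esym/negbT; rewrite -leNgt le_eqVlt.
    by move=> /orP[/eqP//|->].
  by rewrite (Kr.1 ha) -axy ha orbT.
have S := same_strip_sign sc2 st.
set u := s2 (h (x, 0)).1 in S.
have u0 : 0 < u ^+ 2.
  by rewrite exprn_even_gt0//=; apply/eqP => u0; rewrite u0 mul0r ltxx in S.
have := mulr_gt0 (T x sx) S; have -> : s1 x * u * (u * s2 y) = u ^+ 2 * (s1 x * s2 y) by ring.
by rewrite pmulr_rgt0.
Qed.

(** If the heights disagree at one abscissa they disagree at all, and negating [y] in the second
    plane repairs this without changing values or sides. *)
Lemma equiv_of_leaf_equiv_preserving r1 s1 o1 r2 s2 o2 (h : R * R -> R * R) (f : R -> R) :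
  tame r1 s1 o1 -> tame r2 s2 o2 -> leaf_equiv (linear_like r1 s1) (linear_like r2 s2) h ->
  (forall a, s1 a = 0 -> keeps_sides h a) ->
  (forall x, s1 x <> 0 -> preserves r1 s1 r2 s2 h x) ->
  (forall a, s1 a = 0 -> o1 a = o2 (line_image h a)) ->
  value_match r1 s1 r2 h f ->
  equiv_functions (linear_like r1 s1) (linear_like r2 s2).
Proof.
move=> t1 t2 H K P O V.
have [A|nA] := pselect (heights_agree s1 s2 h 0).
  apply: (equiv_of_leaf_equiv_oriented t1 t2 H K P O _ V) => x sx.
  by have [[]|[]] := heights_agree_const t1 t2 H K O x A.
have [H2 eq2] := equiv_of_conj (flip_snd_homeo R) (homeomorphism_id R) (flip_snd_value r2 s2).
apply: equiv_functions_trans eq2.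
apply: (equiv_of_leaf_equiv_oriented t1 (tame_opp_height t2) (leaf_equiv_trans H H2) K _ O _ V).
  by move=> x sx; have := P x sx; rewrite /preserves /transition /= !flip_snd_value.
move=> x sx /=; rewrite mulrN oppr_gt0 lt_neqAle mulf_eq0 negb_or.
apply/andP; split.
  apply/andP; split; first exact/eqP.
  by apply/eqP; apply: (h_neq0 t1 t2 H (sx : s1 (x, 0).1 <> 0)).
rewrite leNgt; apply/negP => A; apply: nA.
by apply: (heights_agree_const t1 t2 H K O (x := x)); left.
Qed.

Lemma equiv_of_leaf_equiv_keeping r1 s1 o1 r2 s2 o2 (h : R * R -> R * R) (f : R -> R) :
  tame r1 s1 o1 -> tame r2 s2 o2 -> leaf_equiv (linear_like r1 s1) (linear_like r2 s2) h ->
  (forall a, s1 a = 0 -> keeps_sides h a) ->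
  value_match r1 s1 r2 h f ->
  equiv_functions (linear_like r1 s1) (linear_like r2 s2).
Proof.
move=> t1 t2 H K V.
have [A|nA] := pselect (preserving r1 s1 o1 r2 s2 o2 h 0).
  have A' x := preserving_const t1 t2 H K x A.
  apply: (equiv_of_leaf_equiv_preserving t1 t2 H K _ _ V) => x sx.
    by have [[]|[]] := A' x.
  by have [[]|[]] := A' x.
have A x : ~ preserving r1 s1 o1 r2 s2 o2 h x.
  by move=> A; apply: nA; exact: (preserving_const t1 t2 H K 0 A).
have [H2 eq2] := equiv_of_conj (homeomorphism_id (R * R)%type) (homeomorphism_opp R) (opp_value r2 s2).
apply: equiv_functions_trans eq2.
have V' : value_match r1 s1 (fun x => - r2 x) h (fun x => - f x).
  have [Vm VE] := V; split; last by move=> a /VE ->.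
  by case: Vm => m; [right|left] => x y xA yA xy; rewrite ltrN2; apply: m.
apply: (equiv_of_leaf_equiv_preserving t1 (tame_opp t2) (leaf_equiv_trans H H2) K _ _ V').
  move=> x sx; rewrite /preserves /transition !opp_value ltrN2.
  rewrite -(reverses_lt t1 t2 H K 0 1 sx)//.
  by move=> px; apply: (A x); left.
move=> a sa; have sb := line_image_zero t1 t2 H sa.
have [_ _ _ _ /(_ a sa)[oa _]] := t1; have [_ _ _ _ /(_ _ sb)[ob _]] := t2.
have : o1 a <> o2 (line_image h a) by move=> oE; apply: (A a); right.
by case: oa ob => -> [->|->] // _; rewrite opprK.
Qed.

(** The reflection in [x] is settled before the other two: the constancy of [preserving] presupposes
    that sides are kept, and that of [heights_agree] also presupposes matching signs at the
    zeros. *)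
Lemma equiv_of_leaf_equiv r1 s1 o1 r2 s2 o2 (h : R * R -> R * R) (f : R -> R) :
  tame r1 s1 o1 -> tame r2 s2 o2 -> leaf_equiv (linear_like r1 s1) (linear_like r2 s2) h ->
  value_match r1 s1 r2 h f ->
  equiv_functions (linear_like r1 s1) (linear_like r2 s2).
Proof.
move=> t1 t2 H V.
have [K|nK] := pselect (forall a, s1 a = 0 -> keeps_sides h a).
  exact: equiv_of_leaf_equiv_keeping t1 t2 H K V.
have [a0 sa0 swa0] : exists2 a, s1 a = 0 & swaps_sides h a.
  apply: contrapT => no; apply: nK => a sa.
  by have [//|sw] := keeps_or_swaps t1 t2 H sa; case: no; exists a.
have W a : s1 a = 0 -> swaps_sides h a.
  move=> sa; have [K|//] := keeps_or_swaps t1 t2 H sa.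
  by case: (not_keeps_swaps sa sa0 K swa0).
have [H2 eq2] := equiv_of_conj (flip_fst_homeo R) (homeomorphism_id R) (flip_fst_value r2 s2).
apply: equiv_functions_trans eq2.
apply: (equiv_of_leaf_equiv_keeping (f := f) t1 (tame_reflect t2) (leaf_equiv_trans H H2)).
  by move=> a sa z; have [Wl Wr] := W a sa z; rewrite /line_image /= !ltrN2; split.
have [Vm VE] := V; split=> // a sa.
by rewrite /line_image /= opprK; exact: VE.
Qed.

End Backward.

(** * The direct implication and the final equivalence *)

Lemma corollary_forward (R : realType) (r1 s1 o1 r2 s2 o2 : R -> R)
    (h : R * R -> R * R) (l : R -> R) :
  tame r1 s1 o1 -> tame r2 s2 o2 -> homeomorphism h -> homeomorphism l ->
  l \o linear_like r1 s1 = linear_like r2 s2 \o h ->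
  [/\ leaf_equiv (linear_like r1 s1) (linear_like r2 s2) h,
      set_bij (r1 @` zero_set s1) (r2 @` zero_set s2) l &
      monotone_on (r1 @` zero_set s1) l].
Proof.
move=> t1 t2 hh hl E.
have [l' [ll' _ lc _]] := hl; have li : injective l := can_inj ll'.
have E' z : l (linear_like r1 s1 z) = linear_like r2 s2 (h z).
  by have := congr1 (fun F => F z) E.
have H := leaf_equiv_conj hh li E.
have [g G [hg gh]] := leaf_equiv_inv H.
split=> //; last first.
  have [m|m] := continuous_injective_monotone lc li; [left|right] => x y _ _; exact: m.
split.
- move=> c c1; have [z [w [zw nzw <-]]] := (values_insep c t1).1 c1; rewrite E'.
  apply/(values_insep _ t2); exists (h z), (h w); split=> //.
  + exact: (insep_equiv H).
  + by move/H.2.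
- by move=> x y _ _; exact: li.
- move=> c c2; have [z [w [zw nzw <-]]] := (values_insep c t2).1 c2.
  exists (linear_like r1 s1 (g z)); last by rewrite E' gh.
  apply/(values_insep _ t1); exists (g z), (g w); split=> //.
  + exact: (insep_equiv G).
  + by move/G.2.
Qed.

Unset Implicit Arguments.
Set Strict Implicit.

Theorem corollary5p3 (R : realType) (r1 s1 r2 s2 : R -> R)
    (hp1 : finite_linear_like_submersion r1 s1)
    (hp2 : finite_linear_like_submersion r2 s2) :
  let p1 := linear_like r1 s1 in
  let p2 := linear_like r2 s2 in
  let Z1 := zero_set s1 in
  let Z2 := zero_set s2 in
  equiv_functions p1 p2 <->
    (Z1 = set0 /\ Z2 = set0) \/
    (equiv_foliations (foliation p1) (foliation p2) /\
     exists (h : R * R -> R * R) (sigma : R -> R),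
       [/\ equiv_homeomorphism (foliation p1) (foliation p2) h,
           set_bij (r1 @` Z1) (r2 @` Z2) sigma,
           monotone_on (r1 @` Z1) sigma
         & forall a, Z1 a ->
             sigma (leaf_value p1 (vertical_line a)) =
             leaf_value p2 (h @` vertical_line a)]).
Proof.
move=> p1 p2 Z1 Z2.
have t1 := tame_of_submersion hp1; have t2 := tame_of_submersion hp2.
have value1 a : Z1 a -> leaf_value p1 (vertical_line a) = r1 a.
  move=> sa; rewrite (leaf_valueE (z := (a, 0))).
  - by rewrite /p1 linear_like0.
  - by move=> w wa; rewrite /p1 !linear_like0//= wa.
  - by [].
split=> [[h [l [hh hl E]]]|].
  have [H lb lm] := corollary_forward t1 t2 hh hl E.
  have H' := leaf_equiv_foliation H.
  right; split; first by exists h.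
  (* The change of values [l] itself serves as [sigma]. *)
  exists h, l; split=> // a sa; rewrite value1//.
  have E' z : l (p1 z) = p2 (h z) by have := congr1 (fun F => F z) E.
  have pa z : z.1 = a -> p1 z = r1 a by move=> za; rewrite /p1 linear_like0 za.
  rewrite (leaf_valueE (z := h (a, 0))).
  - by rewrite -E' pa.
  - by move=> _ [z za <-]; rewrite -!E' !pa.
  - by exists (a, 0).
move=> [[Z1E Z2E]|[_ [h [sigma [hH sb sm sv]]]]].
  have n1 x : s1 x <> 0 by move=> sx; have : Z1 x by []; rewrite Z1E.
  have n2 x : s2 x <> 0 by move=> sx; have : Z2 x by []; rewrite Z2E.
  have [rc1 sc1 _ _ _] := t1; have [rc2 sc2 _ _ _] := t2.
  (* Without zeros the shear over the identity of values is defined by its quotient everywhere, and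
     the condition near zeros is void. *)
  apply: (shear_equiv (homeomorphism_id R)); split=> //.
  - by move=> x; exact: cvg_id.
  - by move=> x; split=> sx; [case: (n1 x)|case: (n2 x)].
  - by move=> a /n1.
have H := leaf_equivP hH.
apply: (equiv_of_leaf_equiv t1 t2 H (f := sigma)); split=> // a sa.
rewrite -value1// sv//.
have hv z : z.1 = a -> p2 (h z) = p2 (h (a, 0)).
  move=> za; apply: leaf_level; apply/H.2; exact/(leaf_vertical _ t1).
rewrite (leaf_valueE (z := h (a, 0))).
- by rewrite /p2 linear_like0//; exact: (line_image_zero t1 t2 H).
- by move=> _ [z za <-]; exact: hv.
- by exists (a, 0).
Qed.
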